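(* Let $(A^\theta)_{\theta\in\Theta}$ be a non-empty family of linear operators $A^\theta\colon D(A^\theta)\to C_\kappa(\mathbb R^d)$, $D(A^\theta)\subset C_\kappa(\mathbb R^d)$, with resolvent sets $\varrho(A^\theta)$. Suppose that conditions (i), (ii), (iii), (iv) or conditions (i), (ii'), (iii), (iv) from the following list hold: (i) There exists $\omega\in\mathbb R$ with $(\omega,\infty)\subset\bigcap_{\theta\in\Theta}\varrho(A^\theta)$ such that, for all $\lambda\in(\omega,\infty)$ and $\theta\in\Theta$: $\|(\lambda-\omega)(\lambda-A^\theta)^{-1}f\|_\infty\le\|f\|_\infty$ for all $f\in\mathrm{Lip}_b(\mathbb R^d)$; $\|(\lambda-\omega)(\lambda-A^\theta)^{-1}f\|_\kappa\le\|f\|_\kappa$ for all $f\in C_\kappa(\mathbb R^d)$; and $(\lambda-A^\theta)^{-1}\colon C_\kappa(\mathbb R^d)\to C_\kappa(\mathbb R^d)$ is monotone. (ii) There exists a bounded continuous function $\tilde\kappa\colon\mathbb R^d\to(0,\infty)$ with $\lim_{|x|\to\infty}\frac{\tilde\kappa(x)}{\kappa(x)}=0$ and $\|(\lambda-\omega)(\lambda-A^\theta)^{-1}f\|_{\tilde\kappa}\le\|f\|_{\tilde\kappa}$ for all $\lambda\in(\omega,\infty)$, $\theta\in\Theta$ and $f\in C_\kappa(\mathbb R^d)$. (ii') For every $\epsilon>0$, $r\ge0$ and $K\Subset\mathbb R^d$ there exist a family $(\zeta_x)_{x\in K}$ of continuous functions $\zeta_x\colon\mathbb R^d\to\mathbb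 R$ and $\tilde K\Subset\mathbb R^d$ such that, for all $x\in K$: $0\le\zeta_x\le1$ and $\zeta_x(x)=1$; $\sup_{y\in\tilde K^c}\zeta_x(y)\le\epsilon$; $\frac r\kappa(1-\zeta_x)\in\bigcap_{\theta\in\Theta}D(A^\theta)$ and $\sup_{\theta\in\Theta}\|A^\theta(\frac r\kappa(1-\zeta_x))\|_\kappa\le\epsilon$. (iii) There exists $L\ge0$ with $(\lambda-\omega)^2\|\tau_x(\lambda-A^\theta)^{-1}f-(\lambda-A^\theta)^{-1}(\tau_xf)\|_\infty\le Lr|x|$ for all $r\ge0$, $f\in\mathrm{Lip}_b(\mathbb R^d,r)$, $x\in\mathbb R^d$, $\lambda\in(\omega,\infty)$ and $\theta\in\Theta$. (iv) $C_b^\infty(\mathbb R^d)\subset\bigcap_{\theta\in\Theta}D(A^\theta)$ and, for every $f\in C_b^\infty(\mathbb R^d)$ and $K\Subset\mathbb R^d$, $\sup_{\theta\in\Theta}\|A^\theta f\|_\kappa<\infty$ and $\lim_{\lambda\to\infty}\sup_{\theta\in\Theta}\|(\lambda-\omega)(\lambda-A^\theta)^{-1}A^\theta f-A^\theta f\|_{\infty,K}=0$. Let $(\lambda_n)_{n\in\mathbb N}\subset(\omega,\infty)$ with $\lambda_n\to\infty$, $h_n:=\frac1{\lambda_n-\omega}$, and $I_nf:=\sup_{\theta\in\Theta}\lambda_n(\lambda_n-A^\theta)^{-1}f$ (pointwise supremum) for $n\in\mathbb N$ and $f\in C_\kappa(\mathbb R^d)$. Then there exists a strongly continuous convex monotone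 semigroup $(S(t))_{t\ge0}$ on $C_\kappa(\mathbb R^d)$ with generator $A\colon D(A)\to C_\kappa(\mathbb R^d)$ such that $$S(t)f=\lim_{n\to\infty}I_n^{k_n^t}f\quad\text{for all }(f,t)\in C_\kappa(\mathbb R^d)\times\mathbb R_+,$$ where $(k_n^t)_{n\in\mathbb N}\subset\mathbb N$ is an arbitrary sequence with $k_n^th_n\to t$. It holds $C_b^\infty(\mathbb R^d)\subset D(A)$ and $Af=\sup_{\theta\in\Theta}A^\theta f$ for all $f\in C_b^\infty(\mathbb R^d)$.
   Context: Fix $d\in\mathbb N$ and a bounded continuous $\kappa:\mathbb R^d\to(0,\infty)$ with $\sup_{x\in\mathbb R^d}\sup_{|y|\le1}\kappa(x)/\kappa(x-y)<\infty$. $C_\kappa(\mathbb R^d)$ is the space of continuous $f:\mathbb R^d\to\mathbb R$ with $\|f\|_\kappa:=\sup_x|f(x)|\kappa(x)<\infty$; $\|f\|_{\tilde\kappa}:=\sup_x|f(x)|\tilde\kappa(x)$; $\|f\|_{\infty,K}:=\sup_{x\in K}|f(x)|$, $\|f\|_\infty:=\|f\|_{\infty,\mathbb R^d}$; $K\Subset\mathbb R^d$ means $K$ is compact. $C_\kappa(\mathbb R^d)$ carries the mixed topology (strongest locally convex topology coinciding on $\|\cdot\|_\kappa$-bounded sets with the topology of uniform convergence on compacts); for sequences, $f_n\to f$ iff $\sup_n\|f_n\|_\kappa<\infty$ and $\|f-f_n\|_{\infty,K}\to0$ for all compact $K$. All limits in $C_\kappa(\mathbb R^d)$ refer to it. Inequalities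 and suprema of functions are pointwise; $f_n\downarrow f$ means pointwise decreasing convergence. An operator $S$ is monotone if $f\le g$ implies $Sf\le Sg$, and convex if $S(\lambda f+(1-\lambda)g)\le\lambda Sf+(1-\lambda)Sg$ for $\lambda\in[0,1]$. $\mathrm{Lip}_b(\mathbb R^d)$: bounded Lipschitz functions; $\mathrm{Lip}_b(\mathbb R^d,r)$: $r$-Lipschitz $f$ with $\|f\|_\infty\le r$; $C_b^\infty(\mathbb R^d)$: bounded infinitely differentiable functions with all derivatives bounded; $(\tau_xf)(y):=f(x+y)$; $\mathbb R_+:=[0,\infty)$. The resolvent set is taken with respect to the norm $\|\cdot\|_\kappa$. A strongly continuous convex monotone semigroup on $C_\kappa(\mathbb R^d)$ is a family $(S(t))_{t\ge0}$ of operators on $C_\kappa(\mathbb R^d)$ such that: each $S(t)$ is convex and monotone with $S(t)f_n\downarrow0$ whenever $f_n\downarrow0$; $S(0)f=f$ and $S(s+t)f=S(s)S(t)f$; $\sup_{t\in[0,T]}\|S(t)\frac r\kappa\|_{\kappa}<\infty$ for all $r,T\ge0$; $\lim_{t\downarrow0}S(t)f=f$ for all $f$. Its generator is $Af:=\lim_{h\downarrow0}\frac{S(h)f-f}h$ with domain $D(A)$ the set of $f$ for which this limit exists in $C_\kappa(\mathbb R^d)$. *)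

(* Defs.v *)
From HB Require Import structures.
From mathcomp Require Import all_boot all_order all_algebra.
From mathcomp Require Import all_classical all_reals all_analysis.

Set Implicit Arguments.
Unset Strict Implicit.
Unset Printing Implicit Defensive.

Import Order.TTheory GRing.Theory Num.Theory.
Import numFieldNormedType.Exports.

Local Open Scope classical_set_scope.
Local Open Scope ring_scope.

(* R^d is 'rV[R]_d.  The library norm on 'rV[R]_d is the sup norm (with the
   usual topology), so the Euclidean norm |x| is introduced separately. *)
Definition enorm (R : realType) (d : nat) (x : 'rV[R]_d) : R :=
  Num.sqrt (\sum_(i < d) x ord0 i ^+ 2).

Section Functions.
Context {R : realType} {d : nat}.
Local Notation E := 'rV[R]_d.
Implicit Types (f g w kappa : E -> R) (K : set E).

Definition wnorm w f : \bar R :=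
  ereal_sup (range (fun x => (`|f x| * w x)%:E)).

(* ||f||_{oo,K}; adding 0 only matters for K = set0, where it gives the value 0
   instead of -oo. *)
Definition supnorm K f : \bar R :=
  ereal_sup (0%E |` [set `|f x|%:E | x in K]).

Definition inftynorm f : \bar R := supnorm [set: E] f.

Arguments wnorm (w f)%_ring_scope.
Arguments supnorm K%_classical_set_scope f%_ring_scope.
Arguments inftynorm f%_ring_scope.

Definition fle f g : Prop := forall x, f x <= g x.

Definition positive_bounded_continuous w : Prop :=
  [/\ continuous w, bounded_fun w & forall x, 0 < w x].

Definition weight kappa : Prop :=
  positive_bounded_continuous kappa /\
  exists M : R, forall x y, enorm y <= 1 -> kappa x / kappa (x - y) <= M.

Definition Ckappa kappa : set (E -> R) :=
  [set f | continuous f /\ (wnorm kappa f < +oo)%E].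

Definition lipschitz_fun (r : R) f : Prop :=
  forall x y, `|f x - f y| <= r * enorm (x - y).

Definition Lipb : set (E -> R) :=
  [set f | bounded_fun f /\ exists r : R, lipschitz_fun r f].

Definition Lipbr (r : R) : set (E -> R) :=
  [set f | lipschitz_fun r f /\ (inftynorm f <= r%:E)%E].

Definition translate (x : E) f : E -> R := fun y => f (x + y).

Definition partial (i : 'I_d) f : E -> R :=
  fun x => 'D_(delta_mx ord0 i : E) f x.

(* Every iterated partial derivative is Frechet differentiable and bounded. *)
Definition Cb_infty : set (E -> R) :=
  [set f | forall s : seq 'I_d,
     (forall x, differentiable (foldr partial f s) x) /\
     bounded_fun (foldr partial f s)].

Definition decreases_to (u : nat -> E -> R) f : Prop :=
  forall x, nonincreasing_seq (fun n => u n x) /\ u n x @[n --> \oo] --> f x.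

(* Sequential convergence for the mixed topology on C_kappa. *)
Definition mixed_cvg kappa (u : nat -> E -> R) f : Prop :=
  [/\ forall n, Ckappa kappa (u n),
      Ckappa kappa f,
      (ereal_sup (range (fun n => wnorm kappa (u n))) < +oo)%E &
      forall K, compact K -> supnorm K (f - u n) @[n --> \oo] --> 0%E].

(* Limit as h decreases to 0 in the mixed topology.  The filter of right
   neighbourhoods of 0 has a countable base, so in any topology convergence
   along it is convergence along all sequences h_n > 0 tending to 0. *)
Definition mixed_cvg_right0 kappa (F : R -> E -> R) f : Prop :=
  forall h : nat -> R, (forall n, 0 < h n) -> h n @[n --> \oo] --> (0 : R) ->
    mixed_cvg kappa (fun n => F (h n)) f.

Definition psup (T : Type) (F : T -> E -> R) : E -> R :=
  fun x => sup (range (fun i => F i x)).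

(* Possibly unbounded linear operators D(A) -> C_kappa; the values of [app]
   outside [dom] are irrelevant. *)
Record linop kappa := LinOp {
  dom : set (E -> R);
  app :> (E -> R) -> (E -> R);
  dom_Ckappa : dom `<=` Ckappa kappa;
  app_Ckappa : forall f, dom f -> Ckappa kappa (app f);
  dom0 : dom 0;
  domP : forall (a : R) f g, dom f -> dom g -> dom (a *: f + g);
  appP : forall (a : R) f g, dom f -> dom g ->
    app (a *: f + g) = a *: app f + app g }.

Definition resolvent kappa (A : linop kappa) (lam : R) f : E -> R :=
  xget (0 : E -> R) [set g | dom A g /\ lam *: g - A g = f].

Definition resolvent_set kappa (A : linop kappa) : set R :=
  [set lam |
     set_bij (dom A) (Ckappa kappa) (fun g => lam *: g - A g) /\
     exists M : R, forall f, Ckappa kappa f ->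
       (wnorm kappa (resolvent A lam f) <= M%:E * wnorm kappa f)%E].

Section Semigroup.
Variable kappa : E -> R.
Implicit Types S : R -> (E -> R) -> (E -> R).

Record convex_monotone_semigroup S : Prop := ConvexMonotoneSemigroup {
  sg_Ckappa : forall (t : R) f, 0 <= t -> Ckappa kappa f -> Ckappa kappa (S t f);
  sg_convex : forall (t : R) f g (lam : R), 0 <= t -> Ckappa kappa f ->
    Ckappa kappa g -> 0 <= lam <= 1 ->
    fle (S t (lam *: f + (1 - lam) *: g))
        (lam *: S t f + (1 - lam) *: S t g);
  sg_monotone : forall (t : R) f g, 0 <= t -> Ckappa kappa f -> Ckappa kappa g ->
    fle f g -> fle (S t f) (S t g);
  sg_above : forall (t : R) (u : nat -> E -> R), 0 <= t ->
    (forall n, Ckappa kappa (u n)) -> decreases_to u 0 ->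
    decreases_to (fun n => S t (u n)) 0;
  sg_0 : forall f, Ckappa kappa f -> S 0 f = f;
  sg_add : forall (s t : R) f, 0 <= s -> 0 <= t -> Ckappa kappa f ->
    S (s + t) f = S s (S t f);
  sg_bounded : forall r T : R, 0 <= r -> 0 <= T ->
    (ereal_sup [set wnorm kappa (S t (fun x => r / kappa x)%R) |
       t in [set t : R | (0 <= t <= T)%R]] < +oo)%E;
  sg_continuous : forall f, Ckappa kappa f ->
    mixed_cvg_right0 kappa (fun t => S t f) f }.

Definition generator_graph S f g : Prop :=
  mixed_cvg_right0 kappa (fun h => h^-1 *: (S h f - f)) g.

Definition generator_dom S : set (E -> R) :=
  [set f | Ckappa kappa f /\ exists g, generator_graph S f g].

Definition generator S f : E -> R :=
  xget (0 : E -> R) [set g | generator_graph S f g].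

End Semigroup.

Section Conditions.
Variables (kappa : E -> R) (Theta : Type) (A : Theta -> linop kappa).
Variable omega : R.

Definition cond_i : Prop :=
  (forall theta (lam : R), omega < lam -> resolvent_set (A theta) lam) /\
  forall (lam : R) theta, omega < lam ->
    [/\ forall f, Lipb f ->
          (inftynorm ((lam - omega) *: resolvent (A theta) lam f)
             <= inftynorm f)%E,
        forall f, Ckappa kappa f ->
          (wnorm kappa ((lam - omega) *: resolvent (A theta) lam f)
             <= wnorm kappa f)%E &
        forall f g, Ckappa kappa f -> Ckappa kappa g -> fle f g ->
          fle (resolvent (A theta) lam f) (resolvent (A theta) lam g)].

Definition cond_ii : Prop :=
  exists kappat : E -> R,
    [/\ positive_bounded_continuous kappat,
        forall eps : R, 0 < eps -> exists M : R, forall x,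
          M <= enorm x -> `|kappat x / kappa x| < eps &
        forall (lam : R) theta f, omega < lam -> Ckappa kappa f ->
          (wnorm kappat ((lam - omega) *: resolvent (A theta) lam f)
             <= wnorm kappat f)%E].

Definition cond_ii' : Prop :=
  forall (eps r : R) (K : set E), 0 < eps -> 0 <= r -> compact K ->
  exists (zeta : E -> E -> R) (Kt : set E), compact Kt /\
    forall x, K x ->
      let g : E -> R := fun y => r / kappa y * (1 - zeta x y) in
      [/\ continuous (zeta x),
          (forall y, 0 <= zeta x y <= 1) /\ zeta x x = 1,
          (ereal_sup [set (zeta x y)%:E | y in ~` Kt] <= eps%:E)%E,
          forall theta, dom (A theta) g &
          (ereal_sup (range (fun theta => wnorm kappa (A theta g)))
             <= eps%:E)%E].

Definition cond_iii : Prop :=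
  exists L : R, 0 <= L /\
    forall (r : R) f (x : E) (lam : R) theta,
      0 <= r -> Lipbr r f -> omega < lam ->
      (((lam - omega) ^+ 2)%:E *
         inftynorm (translate x (resolvent (A theta) lam f)
                    - resolvent (A theta) lam (translate x f))
       <= (L * r * enorm x)%:E)%E.

Definition cond_iv : Prop :=
  (forall theta, Cb_infty `<=` dom (A theta)) /\
  forall f (K : set E), Cb_infty f -> compact K ->
    (ereal_sup (range (fun theta => wnorm kappa (A theta f))) < +oo)%E /\
    ereal_sup (range (fun theta =>
      supnorm K ((lam - omega) *: resolvent (A theta) lam (A theta f)
                 - A theta f))) @[lam --> +oo] --> 0%E.

Definition sup_resolvent (lam : R) f : E -> R :=
  psup (fun theta => lam *: resolvent (A theta) lam f).

End Conditions.

End Functions.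

(* Main.v *)
From HB Require Import structures.
Require Import Defs.
From mathcomp Require Import all_boot all_order all_algebra.
From mathcomp Require Import all_classical all_reals all_analysis.
From mathcomp Require Import ring lra zify.

Import Order.TTheory GRing.Theory Num.Theory.
Import numFieldNormedType.Exports.

(** For [0 < lam n] the operator [I n] is a supremum of positive linear operators,
    hence monotone and sublinear: [I n f - I n g <= I n (f - g)]. All estimates
    rest on this inequality.

    A limit of the iterates comes for free: bounded real sequences converge along
    every ultrafilter finer than the neighbourhoods of infinity, so the iterates
    [iter (k n) (I n) f x] with [k n * h n] close to [t] have a limit [S t f x]
    ([ulim]). Each of [cond_ii] and [cond_ii'] makes the iterates equicontinuous
    in the mixed topology, uniformly in [n] ([iterate_tight] and
    [iterate_equicontinuous]). This yields continuity of the limit, the semigroup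
    law ([ulim_add]) and, together with the consistency required by [cond_iv], the
    expansion [S t v = v + t * G v + o(t)] for smooth [v] ([ulim_expand]), where
    [G v] is the supremum of the [A theta v].

    The main point is that the limit is the same for all ultrafilters
    ([ulim_unique_le]). For two of them, with limits [S1] and [S2], the path
    [phi s = S1 (t - s) (M (S2 s f)) x] interpolates between [S1 t (M f) x] and
    [M (S2 t f) x], where [M] is a convolution operator of radius [b] with smooth
    values. By Jensen's inequality, and because the resolvents almost commute with
    translations by [cond_iii], [S2 z (M u)] exceeds [M (S2 z u)] by at most a
    multiple of [b * z] ([ulim_averaging]); and on the smooth function
    [M (S2 s f)] both limits have the same expansion. Hence [phi s] is at most
    [phi (s + z)] up to a multiple of [b * z] and a term [o(z)] that may depend on
    [s] ([exchange_step]). As [phi] is continuous, this integrates to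
    [S1 t f <= S2 t f] after letting [b] tend to zero, and the roles of the two
    limits may be exchanged. A bounded sequence with the same limit along all
    ultrafilters converges.

    The operator [M] is an infinite product of means over segments in the
    coordinate directions, of geometrically decreasing lengths. Differentiation
    turns one mean into a difference quotient and leaves the other ones, so all
    derivatives exist and are bounded ([smoothing_averaging_exists]). Jensen's
    inequality holds because [M] is a limit of finite convex combinations of
    translations. *)

Set Implicit Arguments.
Unset Strict Implicit.
Unset Printing Implicit Defensive.

Local Open Scope classical_set_scope.
Local Open Scope ring_scope.

(** * Norms and Lipschitz functions *)

Section Norms.
Context {R : realType} {d : nat}.
Local Notation E := 'rV[R]_d.
Implicit Types (x y : E) (u : E -> R).

(** Unlike [enorm], this norm has an immediate triangle inequality and is
    additive along the coordinates; it dominates [enorm], so that bounds on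
    displacements may be given in it. *)
Definition norm1 x : R := \sum_(i < d) `|x ord0 i|.

Definition axis (i : 'I_d) : E := delta_mx ord0 i.

Lemma norm1_ge0 x : 0 <= norm1 x.
Proof. by apply: sumr_ge0. Qed.

Lemma norm1D x y : norm1 (x + y) <= norm1 x + norm1 y.
Proof.
by rewrite /norm1 -big_split; apply: ler_sum => i _; rewrite mxE ler_normD.
Qed.

Lemma norm10 : norm1 0 = 0.
Proof. by rewrite /norm1 big1 // => i _; rewrite mxE normr0. Qed.

Lemma norm1_axis (i : 'I_d) (t : R) : norm1 (t *: axis i) = `|t|.
Proof.
rewrite /norm1 (bigD1 i) //= big1 ?addr0.
  by rewrite !mxE !eqxx mulr1.
by move=> j ji; rewrite !mxE (negbTE ji) andbF mulr0 normr0.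
Qed.

Lemma coord_le_enorm x i : `|x ord0 i| <= enorm x.
Proof.
rewrite -sqrtr_sqr ler_wsqrtr // (bigD1 i) //= lerDl.
by apply: sumr_ge0 => j _; exact: sqr_ge0.
Qed.

Lemma enorm_ge0 x : 0 <= enorm x.
Proof. exact: sqrtr_ge0. Qed.

Lemma enorm_le_norm1 x : enorm x <= norm1 x.
Proof.
rewrite /enorm -[leRHS]ger0_norm ?norm1_ge0 // -sqrtr_sqr ler_wsqrtr //.
rewrite expr2 {1}/norm1 mulr_suml; apply: ler_sum => i _.
rewrite -real_normK ?num_real // expr2 ler_wpM2l //.
by rewrite /norm1 (bigD1 i) //= lerDl sumr_ge0.
Qed.

Lemma coord_le_norm x i : `|x ord0 i| <= `|x|.
Proof.
have -> : `|x| = mx_norm x by [].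
by rewrite mx_normrE (le_bigmax_cond _ (j := (ord0, i)) (fun ij => `|x ij.1 ij.2|)).
Qed.

Lemma norm_le_enorm x : `|x| <= enorm x.
Proof.
have -> : `|x| = mx_norm x by [].
rewrite mx_normrE; apply: bigmax_le => [|[i j] _]; first exact: enorm_ge0.
by rewrite ord1 coord_le_enorm.
Qed.

Lemma norm1_le_norm x : norm1 x <= d%:R * `|x|.
Proof.
apply: (@le_trans _ _ (\sum_(i < d) `|x|)).
  by apply: ler_sum => i _; exact: coord_le_norm.
by rewrite sumr_const card_ord mulr_natl.
Qed.

Lemma enorm_le_norm x : enorm x <= d%:R * `|x|.
Proof. exact: le_trans (enorm_le_norm1 x) (norm1_le_norm x). Qed.

Lemma enorm_axis i (t : R) : enorm (t *: axis i) <= `|t|.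
Proof. by rewrite -(norm1_axis i) enorm_le_norm1. Qed.

Lemma enorm0 : enorm (0 : E) = 0.
Proof.
by apply/eqP; rewrite eq_le enorm_ge0 andbT -norm10 enorm_le_norm1.
Qed.

Lemma enormN x : enorm (- x) = enorm x.
Proof.
by congr Num.sqrt; apply: eq_bigr => i _; rewrite mxE sqrrN.
Qed.

Lemma lipschitz_near (r : R) u x (e : R) : lipschitz_fun r u -> 0 < e ->
  \forall y \near x, `|u x - u y| < e.
Proof.
move=> lu e0.
have k0 : 0 < `|r| * d%:R + 1 by rewrite ltr_wpDl ?mulr_ge0.
have : \forall y \near x, `|x - y| < e / (`|r| * d%:R + 1).
  have /cvgrPdist_lt : y @[y --> x] --> x by exact: cvg_id.
  by apply; rewrite divr_gt0.
apply: filterS => y xy.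
apply: le_lt_trans (lu x y) _.
apply: (@le_lt_trans _ _ (`|r| * (d%:R * `|x - y|))).
  apply: le_trans (ler_wpM2r (enorm_ge0 _) (ler_norm r)) _.
  by rewrite ler_wpM2l // enorm_le_norm.
rewrite mulrA; move: xy; rewrite ltr_pdivlMr // mulrC mulrDl mul1r.
by apply: le_lt_trans; rewrite lerDl.
Qed.

Lemma lipschitz_continuous (r : R) u : lipschitz_fun r u -> continuous u.
Proof.
move=> lu x; apply/(@cvgrPdist_lt _ _ _ (nbhs x) (nbhs_filter x)) => e e0.
exact: lipschitz_near lu e0.
Qed.

End Norms.

(** * Means over segments *)

Section Box.
Context {R : realType} {d : nat}.
Local Notation E := 'rV[R]_d.
Implicit Types (x y : E) (u : E -> R) (g G : R -> R).

Lemma antiderivative g (c : R) : continuous g ->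
  exists G, forall s, `|s| < c -> is_derive (s : R) 1 G (g s).
Proof.
move=> cg.
exists (fun x : R => \int[lebesgue_measure]_(t in `[- c, x]) g t) => s.
rewrite ltr_norml => /andP[cs sc].
have ic : lebesgue_measure.-integrable `[- c, c] (EFin \o g).
  apply: continuous_compact_integrable; first exact: segment_compact.
  exact: continuous_subspaceT.
have [dG <-] := continuous_FTC1_closed sc ic cs (cg s).
by rewrite derive1E; apply: DeriveDef.
Qed.

Lemma is_derive_within_continuous g G (c a b : R) : a < b ->
  (forall s, `|s| < c -> is_derive (s : R) 1 G (g s)) ->
  - c < a -> b < c -> {within `[a, b], continuous G}.
Proof.
move=> ab dG ca bc; apply: continuous_in_subspaceT => s.
rewrite inE /= in_itv /= => /andP[als slb].
have sc : `|s| < c by rewrite ltr_norml (lt_le_trans ca als) (le_lt_trans slb bc).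
apply: differentiable_continuous; apply/derivable1_diffP.
exact: (@ex_derive _ _ _ _ _ _ _ (dG s sc)).
Qed.

Lemma antiderivative_MVT g G (c a b : R) : a < b ->
  (forall s, `|s| < c -> is_derive (s : R) 1 G (g s)) ->
  - c < a -> b < c -> exists2 z, a < z < b & G b - G a = g z * (b - a).
Proof.
move=> ab dG ca bc.
have [z|//|z] := @MVT R G g a b ab; last first.
- by rewrite in_itv /= => zab; exists z.
- exact: is_derive_within_continuous dG ca bc.
rewrite in_itv /= => /andP[az zb]; apply: dG.
by rewrite ltr_norml (lt_trans ca az) (lt_trans zb bc).
Qed.

Definition box (i : 'I_d) (a : R) u : E -> R := fun x =>
  (2 * a)^-1 * \int[lebesgue_measure]_(s in `[- a, a]) u (x + s *: axis i).

Lemma line_continuous u x v : continuous u ->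
  continuous (fun s : R => u (x + s *: v)).
Proof.
move=> cu s.
apply: (@continuous_comp _ _ _ (fun s : R => x + s *: v) u); last exact: cu.
apply: (@cvgD _ _ _ (nbhs s) _ (fun=> x)); first exact: cvg_cst.
by apply: (@cvgZr_tmp _ _ _ (nbhs s)); exact: cvg_id.
Qed.

Lemma antiderivative_is_derive_shift g G (c t : R) :
  (forall s, `|s| < c -> is_derive (s : R) 1 G (g s)) ->
  forall s, `|s + t| < c -> is_derive (s : R) 1 (fun s => G (s + t)) (g (s + t)).
Proof.
move=> dG s st; rewrite -[g _]mulr1.
apply: (@is_derive1_comp _ G (fun s => s + t)); first exact: dG.
rewrite -[X in is_derive _ _ _ X]addr0.
apply: (@is_deriveD _ _ _ (fun s : R => s) (fun=> t)).
Qed.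

(** The mean of [u] over a segment is an increment of any antiderivative of
    [u] along the line carrying it; this gives at once its derivative in that
    direction and its approximation by Riemann sums. *)
Lemma box_antiderivative i (a c t : R) u x G : continuous u -> 0 < a ->
  (forall s, `|s| < c -> is_derive (s : R) 1 G (u (x + s *: axis i))) ->
  `|t| + a < c ->
  box i a u (x + t *: axis i) = (2 * a)^-1 * (G (t + a) - G (t - a)).
Proof.
move=> cu a0 dG tac; rewrite /box; congr (_ * _).
have aa : - a < a by rewrite gtrN.
have cg := @line_continuous u (x + t *: axis i) (axis i) cu.
have st (s : R) : `|s| <= a -> `|s + t| < c.
  move=> sa; apply: le_lt_trans (ler_normD _ _) _; apply: le_lt_trans tac.
  by rewrite addrC lerD2l.
have dH (s : R) : `|s| <= a ->
    is_derive (s : R) 1 (fun s => G (s + t)) (u (x + t *: axis i + s *: axis i)).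
  move=> sa; rewrite -addrA -scalerDl (addrC t).
  apply: (antiderivative_is_derive_shift (g := fun s => u (x + s *: axis i)) dG).
  exact: st.
have cH (s : R) : `|s| <= a -> {for s, continuous (fun s => G (s + t))}.
  move=> sa; apply: differentiable_continuous; apply/derivable1_diffP.
  exact: (@ex_derive _ _ _ _ _ _ _ (dH s sa)).
have := @continuous_FTC2 R (fun s => u (x + t *: axis i + s *: axis i))
  (fun s => G (s + t)) (- a) a aa.
rewrite /Rintegral => ->.
- by rewrite -EFinB /= !(addrC _ t).
- exact: continuous_subspaceT.
- split.
  + move=> s; rewrite in_itv /= => /andP[/ltW as1 /ltW as2].
    apply: (@ex_derive _ _ _ _ _ _ _ (dH s _)).
    by rewrite ler_norml as1.
  + by apply: cvg_at_right_filter; apply: cH; rewrite normrN gtr0_norm.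
  + by apply: cvg_at_left_filter; apply: cH; rewrite gtr0_norm.
- move=> s; rewrite in_itv /= => /andP[/ltW as1 /ltW as2].
  rewrite derive1E; apply: (@derive_val _ _ _ _ _ _ _ (dH s _)).
  by rewrite ler_norml as1.
Qed.

Lemma is_derive_line u x v (l : R) :
  is_derive (0 : R) 1 (fun t : R => u (x + t *: v)) l -> is_derive x v u l.
Proof.
move=> [dl <-].
have e : (fun h : R => h^-1 *: (((fun t : R => u (x + t *: v)) \o shift 0) (h *: 1)
             - (fun t : R => u (x + t *: v)) 0)) =
         (fun h : R => h^-1 *: ((u \o shift x) (h *: v) - u x)).
  apply: funext => h /=; rewrite addr0 scale0r addr0 (addrC x).
  by congr (_ *: (u (_ *: _ + _) - _)); rewrite /GRing.scale /= mulr1.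
by split; rewrite /derivable /derive -e.
Qed.

Lemma box_is_derive i (a : R) u x : continuous u -> 0 < a ->
  is_derive x (axis i) (box i a u)
    ((2 * a)^-1 * (u (x + a *: axis i) - u (x - a *: axis i))).
Proof.
move=> cu a0; apply: is_derive_line.
have cg := @line_continuous u x (axis i) cu.
have [G dG] := antiderivative (3 * a) cg.
have d1 (s : R) : `|s| <= a -> is_derive (0 : R) 1 (fun t => G (t + s)) (u (x + s *: axis i)).
  move=> sa; have := @antiderivative_is_derive_shift _ G (3 * a) s dG 0.
  rewrite add0r; apply; apply: le_lt_trans sa _; lra.
have e : \forall t \near (0 : R),
   (2 * a)^-1 * (G (t + a) - G (t - a)) = box i a u (x + t *: axis i).
  have : \forall t \near (0 : R), `|0 - t| < a.
    have /cvgrPdist_lt : t @[t --> (0 : R)] --> (0 : R) by exact: cvg_id.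
    by apply.
  apply: filterS => t; rewrite sub0r normrN => ta.
  by rewrite (box_antiderivative cu a0 dG) //; lra.
apply: near_eq_is_derive e _.
rewrite -[_ * _]/(_ *: _) -scaleNr.
apply: is_deriveZ; apply: is_deriveB; apply: d1.
  by rewrite gtr0_norm.
by rewrite normrN gtr0_norm.
Qed.

End Box.

(** * Averaging operators *)

Section Averaging.
Context {R : realType} {d : nat}.
Local Notation E := 'rV[R]_d.
Local Notation op := ((E -> R) -> (E -> R)).
Implicit Types (x y : E) (u v : E -> R) (s : seq (R * E)) (S T : op).

Definition wavg s u : E -> R := fun x => \sum_(p <- s) p.1 * u (x + p.2).

Definition weights (delta : R) s : Prop :=
  (forall p, p \in s -> 0 <= p.1 /\ norm1 p.2 <= delta) /\
  \sum_(p <- s) p.1 = 1.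

(** Convolutions with probability measures carried by the ball of radius
    [delta], described without integrals: such an operator is a limit of
    finite convex combinations of translations, uniformly on functions with
    a common Lipschitz constant. Sublinear operators that almost commute with
    translations are thus compared with it by finite subadditivity alone. *)
Definition averaging (delta : R) T : Prop :=
  forall r e : R, 0 < e -> exists s, weights delta s /\
    forall u, lipschitz_fun r u -> forall x, `|T u x - wavg s u x| <= e.

Lemma wavg_le (delta c : R) s u x : weights delta s ->
  (forall y, norm1 y <= delta -> u (x + y) <= c) -> wavg s u x <= c.
Proof.
move=> [ws s1] uc; rewrite -[leRHS]mul1r -s1 mulr_suml /wavg.
rewrite big_seq [leRHS]big_seq; apply: ler_sum => p /ws[p0 pd].
by rewrite ler_wpM2l // uc.
Qed.

Lemma wavgN s u x : wavg s (- u) x = - wavg s u x.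
Proof.
by rewrite /wavg -sumrN; apply: eq_bigr => p _; rewrite fctE mulrN.
Qed.

Lemma wavg_norm (delta c : R) s u x : weights delta s ->
  (forall y, norm1 y <= delta -> `|u (x + y)| <= c) -> `|wavg s u x| <= c.
Proof.
move=> ws uc; rewrite ler_norml lerNl -wavgN; apply/andP; split;
  apply: wavg_le ws _ => y /uc; rewrite ler_norml => /andP[] //.
by rewrite fctE [in X in X -> _]lerNl.
Qed.

Lemma wavg_translate s u x y : wavg s (translate y u) x = wavg s u (y + x).
Proof. by apply: eq_bigr => p _; rewrite /translate addrA. Qed.

Lemma wavg_comp s s' u x : wavg s (wavg s' u) x =
  wavg [seq (p.1 * q.1, p.2 + q.2) | p <- s, q <- s'] u x.
Proof.
rewrite /wavg big_allpairs_dep /=; apply: eq_bigr => p _.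
by rewrite mulr_sumr; apply: eq_bigr => q _; rewrite mulrA addrA.
Qed.

Lemma wavg_weights_comp (a b : R) s s' : weights a s -> weights b s' ->
  weights (a + b) [seq (p.1 * q.1, p.2 + q.2) | p <- s, q <- s'].
Proof.
move=> [ws s1] [ws' s1']; split.
  move=> _ /allpairsP[[p q] /= [/ws[p0 pa] /ws'[q0 qb] ->]] /=.
  by rewrite mulr_ge0 // (le_trans (norm1D _ _)) // lerD.
rewrite big_allpairs_dep /= -[RHS]s1; apply: eq_bigr => p _.
by rewrite -mulr_sumr s1' mulr1.
Qed.

Lemma lipschitz_translate (r : R) u y :
  lipschitz_fun r u -> lipschitz_fun r (translate y u).
Proof.
by move=> lu x z; rewrite /translate (le_trans (lu _ _)) // opprD addrACA subrr add0r.
Qed.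

Lemma lipschitzW (r r' : R) u : r <= r' -> lipschitz_fun r u ->
  lipschitz_fun r' u.
Proof.
by move=> rr lu x y; rewrite (le_trans (lu x y)) // ler_wpM2r // enorm_ge0.
Qed.

Lemma lipschitzD (r r' : R) u v : lipschitz_fun r u -> lipschitz_fun r' v ->
  lipschitz_fun (r + r') (u + v).
Proof.
move=> lu lv x y; rewrite !fctE opprD addrACA mulrDl.
by rewrite (le_trans (ler_normD _ _)) // lerD.
Qed.

Lemma lipschitzZ (r a : R) u : lipschitz_fun r u ->
  lipschitz_fun (`|a| * r) (a *: u).
Proof.
move=> lu x y; rewrite !fctE -[_ - _]/(a * u x - a * u y) -mulrBr normrM.
by rewrite -mulrA ler_wpM2l.
Qed.

Lemma averaging_le (delta r c : R) T u x : averaging delta T ->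
  lipschitz_fun r u -> (forall y, norm1 y <= delta -> u (x + y) <= c) ->
  T u x <= c.
Proof.
move=> aT lu uc; apply/ler_addgt0Pr => e e0.
have [s [ws Ts]] := aT r e e0.
have := Ts u lu x; rewrite ler_distl => /andP[_ h].
by rewrite (le_trans h) // lerD2r (wavg_le ws).
Qed.

Lemma averaging_ge (delta r c : R) T u x : averaging delta T ->
  lipschitz_fun r u -> (forall y, norm1 y <= delta -> c <= u (x + y)) ->
  c <= T u x.
Proof.
move=> aT lu uc; apply/ler_addgt0Pr => e e0.
have [s [ws Ts]] := aT r e e0.
have := Ts u lu x; rewrite ler_distlC => /andP[_ h].
rewrite (le_trans _ h) // -lerN2 -wavgN.
by apply: wavg_le ws _ => y /uc; rewrite fctE lerN2.
Qed.

Lemma averaging_norm (delta r c : R) T u x : averaging delta T ->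
  lipschitz_fun r u -> (forall y, norm1 y <= delta -> `|u (x + y)| <= c) ->
  `|T u x| <= c.
Proof.
move=> aT lu uc; rewrite ler_norml; apply/andP; split.
  by apply: (averaging_ge aT lu) => y /uc; rewrite ler_norml => /andP[].
by apply: (averaging_le aT lu) => y /uc; rewrite ler_norml => /andP[].
Qed.

Lemma averaging_near (delta r : R) T u x : 0 <= r -> averaging delta T ->
  lipschitz_fun r u -> `|T u x - u x| <= r * delta.
Proof.
move=> r0 aT lu; rewrite ler_distl.
have uxy y : norm1 y <= delta -> `|u (x + y) - u x| <= r * delta.
  move=> yd; rewrite (le_trans (lu _ _)) // addrC addKr ler_wpM2l //.
  exact: le_trans (enorm_le_norm1 _) yd.
apply/andP; split.
  by apply: (averaging_ge aT lu) => y /uxy; rewrite ler_distl => /andP[].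
by apply: (averaging_le aT lu) => y /uxy; rewrite ler_distl => /andP[].
Qed.

Lemma averaging_translate (delta r : R) T u y x : averaging delta T ->
  lipschitz_fun r u -> T (translate y u) x = T u (y + x).
Proof.
move=> aT lu; apply/eqP; rewrite -subr_eq0 -normr_le0.
apply/ler_addgt0Pr => e e0; rewrite add0r.
have e2 : 0 < e / 2 by rewrite divr_gt0.
have [s [ws Ts]] := aT r (e / 2) e2.
have h1 := Ts _ (lipschitz_translate y lu) x.
have h2 := Ts _ lu (y + x); rewrite wavg_translate in h1.
rewrite (le_trans (ler_distD (wavg s u (y + x)) _ _)) //.
by rewrite [leRHS]splitr lerD // distrC.
Qed.

Lemma wavg_lipschitz (delta r : R) s u : weights delta s ->
  lipschitz_fun r u -> lipschitz_fun r (wavg s u).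
Proof.
move=> ws lu x y.
have -> : wavg s u x - wavg s u y = wavg s (fun z => u (x + z) - u (y + z)) 0.
  by rewrite /wavg -sumrB; apply: eq_bigr => p _; rewrite -mulrBr add0r.
apply: (wavg_norm ws) => z _.
by rewrite add0r (le_trans (lu _ _)) // opprD addrACA subrr addr0.
Qed.

Lemma averaging_lipschitz (delta r : R) T u : averaging delta T ->
  lipschitz_fun r u -> lipschitz_fun r (T u).
Proof.
move=> aT lu x y; apply/ler_addgt0Pr => e e0.
have e2 : 0 < e / 2 by rewrite divr_gt0.
have [s [ws Ts]] := aT r (e / 2) e2.
have h1 := Ts _ lu x; have h2 := Ts _ lu y.
have h3 := wavg_lipschitz ws lu x y.
move: h1 h2 h3; rewrite !ler_norml => /andP[? ?] /andP[? ?] /andP[? ?].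
apply/andP; split; lra.
Qed.

(** Linearity is inherited from finite averages. *)
Lemma averaging_linear (delta r r' a : R) T u v x : averaging delta T ->
  lipschitz_fun r u -> lipschitz_fun r' v ->
  T (a *: u + v) x = a * T u x + T v x.
Proof.
move=> aT lu lv; apply/eqP; rewrite -subr_eq0 -normr_le0.
apply/ler_addgt0Pr => e e0; rewrite add0r.
(* The constant [m] serves [u], [v] and [a *: u + v] at once, so that a single
   finite average approximates [T] on all three. *)
pose c := `|a| + 2; have c0 : 0 < c by rewrite ltr_wpDl.
have ec : 0 < e / c by rewrite divr_gt0.
pose m := `|r| + `|r'| + `|a| * `|r|.
have [s [ws Ts]] := aT m (e / c) ec.
have lum : lipschitz_fun m u.
  apply: lipschitzW lu; rewrite /m -addrA (le_trans (ler_norm r)) // lerDl.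
  by rewrite addr_ge0 // mulr_ge0.
have lvm : lipschitz_fun m v.
  apply: lipschitzW lv; rewrite /m addrAC (le_trans (ler_norm r')) // lerDr.
  by rewrite addr_ge0 // mulr_ge0.
have lum' : lipschitz_fun m (a *: u + v).
  apply: lipschitzW (lipschitzD (lipschitzZ a lu) lv).
  rewrite addrC /m lerD //.
    by rewrite (le_trans (ler_norm r')) // lerDr.
  by rewrite ler_wpM2l // ler_norm.
have h1 := Ts _ lum x; have h2 := Ts _ lvm x; have h3 := Ts _ lum' x.
have h4 : wavg s (a *: u + v) x = a * wavg s u x + wavg s v x.
  rewrite /wavg mulr_sumr -big_split /=; apply: eq_bigr => p _.
  have -> : (a *: u + v) (x + p.2) = a * u (x + p.2) + v (x + p.2) by [].
  ring.
have -> : T (a *: u + v) x - (a * T u x + T v x) =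
   (T (a *: u + v) x - wavg s (a *: u + v) x) - a * (T u x - wavg s u x)
     - (T v x - wavg s v x) by rewrite h4; ring.
have -> : e = e / c + `|a| * (e / c) + e / c.
  by rewrite /c; field; rewrite -/c gt_eqF.
rewrite (le_trans (ler_normB _ _)) // lerD // (le_trans (ler_normB _ _)) //.
by rewrite lerD // normrM ler_wpM2l.
Qed.

Lemma averaging_comp (a b : R) S T : averaging a S -> averaging b T ->
  averaging (a + b) (S \o T).
Proof.
move=> aS aT r e e0; have e2 : 0 < e / 2 by rewrite divr_gt0.
have [s [ws Ss]] := aS r (e / 2) e2.
have [t [wt Tt]] := aT r (e / 2) e2.
exists [seq (p.1 * q.1, p.2 + q.2) | p <- s, q <- t].
split; first exact: wavg_weights_comp.
move=> u lu x /=; rewrite -wavg_comp.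
have h1 := Ss _ (averaging_lipschitz aT lu) x.
have h2 : `|wavg s (T u) x - wavg s (wavg t u) x| <= e / 2.
  have := @wavg_norm a (e / 2) s (T u - wavg t u) x ws.
  have -> : wavg s (T u - wavg t u) x = wavg s (T u) x - wavg s (wavg t u) x.
    rewrite /wavg -sumrB; apply: eq_bigr => p _; by rewrite !fctE mulrBr.
  by apply => y _; exact: Tt.
by rewrite (le_trans (ler_distD (wavg s (T u) x) _ _)) // [leRHS]splitr lerD.
Qed.

Lemma averaging_wavg (a b r : R) T s u x : averaging a T -> weights b s ->
  lipschitz_fun r u -> T (wavg s u) x = wavg s (T u) x.
Proof.
move=> aT ws lu; apply/eqP; rewrite -subr_eq0 -normr_le0.
apply/ler_addgt0Pr => e e0; rewrite add0r.
have e2 : 0 < e / 2 by rewrite divr_gt0.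
have [t [wt Tt]] := aT r (e / 2) e2.
have h1 := Tt _ (wavg_lipschitz ws lu) x.
have h2 : `|wavg s (T u) x - wavg s (wavg t u) x| <= e / 2.
  have := @wavg_norm b (e / 2) s (T u - wavg t u) x ws.
  have -> : wavg s (T u - wavg t u) x = wavg s (T u) x - wavg s (wavg t u) x.
    rewrite /wavg -sumrB; apply: eq_bigr => p _; by rewrite !fctE mulrBr.
  by apply => y _; exact: Tt.
have h3 : wavg s (wavg t u) x = wavg t (wavg s u) x.
  rewrite /wavg; under eq_bigr => p _ do rewrite mulr_sumr.
  rewrite exchange_big /=; apply: eq_bigr => q _; rewrite mulr_sumr.
  apply: eq_bigr => p _; rewrite mulrCA -!addrA (addrC p.2); ring.
rewrite (le_trans (ler_distD (wavg t (wavg s u) x) _ _)) // [leRHS]splitr.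
by rewrite lerD // -h3 distrC.
Qed.

(** Finite averages of translations commute with every averaging operator,
    which is linear and commutes with translations. *)
Lemma averaging_comm (a b r : R) S T u x : averaging a S -> averaging b T ->
  lipschitz_fun r u -> S (T u) x = T (S u) x.
Proof.
move=> aS aT lu; apply/eqP; rewrite -subr_eq0 -normr_le0.
apply/ler_addgt0Pr => e e0; rewrite add0r.
have e2 : 0 < e / 2 by rewrite divr_gt0.
have [s [ws Ss]] := aS r (e / 2) e2.
have h1 := Ss _ (averaging_lipschitz aT lu) x.
rewrite -(averaging_wavg x aT ws lu) in h1.
have l1 := averaging_lipschitz aS lu; have l2 := wavg_lipschitz ws lu.
have l3 : lipschitz_fun (`|-1| * r + r) (-1 *: wavg s u + S u).
  exact: lipschitzD (lipschitzZ _ l2) l1.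
have h2 : `|T (-1 *: wavg s u + S u) x| <= e / 2.
  apply: (averaging_norm aT l3) => y _.
  have -> : (-1 *: wavg s u + S u) (x + y) = -1 * wavg s u (x + y) + S u (x + y).
    by [].
  rewrite mulN1r addrC.
  exact: Ss.
move: h2; rewrite (averaging_linear _ _ aT l2 l1) mulN1r => h2.
rewrite (le_trans (ler_distD (T (wavg s u) x) _ _)) // [leRHS]splitr lerD //.
by rewrite distrC -[X in `|X|]addrC.
Qed.

Lemma averaging_id : averaging 0 (fun u => u).
Proof.
move=> r e e0; exists [:: (1, 0)]; split.
  split; last by rewrite big_seq1.
  by move=> p; rewrite inE => /eqP -> /=; rewrite norm10.
move=> u _ x; rewrite /wavg big_seq1 /= addr0 mul1r subrr normr0.
exact: ltW.
Qed.

Lemma averagingW (a b : R) T : a <= b -> averaging a T -> averaging b T.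
Proof.
move=> ab aT r e e0; have [s [[ws s1] Ts]] := aT r e e0; exists s.
split=> //; split=> // p /ws[p0 pa]; split => //; exact: le_trans ab.
Qed.

(** The finite averages are Riemann sums; their error is controlled by the
    Lipschitz constant and the common length of the cells. *)
Lemma box_averaging (i : 'I_d) (a : R) : 0 < a -> averaging a (box i a).
Proof.
move=> a0 r e e0.
have [N Nr] : exists N : nat, `|r| * (2 * a) <= e * N.+1%:R.
  pose N := Num.trunc (`|r| * (2 * a) / e); exists N.
  rewrite [leRHS]mulrC -ler_pdivrMr //; apply: ltW; exact: truncnS_gt.
have [c cE] : exists c : R, N.+1%:R = c by exists N.+1%:R.
have N0 : 0 < c by rewrite -cE ltr0n.
pose t (j : nat) : R := - a + 2 * a * j%:R / c.
have tS j : t j.+1 - t j = 2 * a / c.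
  by rewrite /t -natr1; field; rewrite gt_eqF.
have t0 : t 0%N = - a by rewrite /t mulr0 mul0r addr0.
have tN : t N.+1 = a.
  by rewrite /t cE; field; rewrite gt_eqF.
have ta (j : nat) : (j <= N.+1)%N -> - a <= t j <= a.
  move=> jN; have j0 : 0 <= 2 * a * j%:R / c.
    by rewrite divr_ge0 ?mulr_ge0 // ltW.
  have jc : 2 * a * j%:R / c <= 2 * a.
    by rewrite ler_pdivrMr // ler_wpM2l -?cE ?ler_nat // mulr_ge0 // ltW.
  rewrite /t; lra.
exists [seq (c^-1, t j *: axis i) | j <- iota 0 N.+1]; split.
  split.
    move=> p /mapP[j]; rewrite mem_iota add0n => /andP[_ jN] -> /=.
    split; first by rewrite invr_ge0 ltW.
    rewrite norm1_axis ler_norml; apply: ta; exact: ltnW.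
  rewrite big_map big_const_seq count_predT size_iota iter_addr_0.
  by rewrite -[LHS]mulr_natl cE mulfV // gt_eqF.
move=> u lu x.
have cg := @line_continuous R d u x (axis i) (lipschitz_continuous lu).
have [G dG] := antiderivative (3 * a) cg.
have := @box_antiderivative R d i a (3 * a) 0 u x G
   (lipschitz_continuous lu) a0 dG.
rewrite scale0r addr0 normr0 !add0r => ->; last by lra.
have -> : wavg [seq (c^-1, t j *: axis i) | j <- iota 0 N.+1] u x =
    c^-1 * \sum_(0 <= j < N.+1) u (x + t j *: axis i).
  by rewrite /wavg big_map mulr_sumr.
rewrite -[X in G X - _]tN -t0 -(@telescope_sumr _ 0 N.+1 (fun j => G (t j))) //.
have hc j : (j < N.+1)%N ->
  `|(2 * a)^-1 * (G (t j.+1) - G (t j))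
    - c^-1 * u (x + t j *: axis i)| <= c^-1 * e.
  move=> jN.
  have jt : t j < t j.+1 by rewrite -subr_gt0 tS divr_gt0 // mulr_gt0.
  have /andP[ta1 _] := ta j (ltnW jN); have /andP[_ ta2] := ta j.+1 jN.
  have [||z /andP[z1 z2] ->] := antiderivative_MVT jt dG; [lra|lra|].
  rewrite tS.
  have -> : (2 * a)^-1 * (u (x + z *: axis i) * (2 * a / c)) =
     c^-1 * u (x + z *: axis i).
    by field; rewrite !gt_eqF.
  rewrite -mulrBr normrM gtr0_norm ?invr_gt0 // ler_pM2l ?invr_gt0 //.
  rewrite (le_trans (lu _ _)) // opprD addrACA subrr add0r -scalerBl.
  apply: (@le_trans _ _ (`|r| * (2 * a / c))).
    rewrite (le_trans (ler_wpM2r (enorm_ge0 _) (ler_norm r))) // ler_wpM2l //.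
    rewrite (le_trans (enorm_axis _ _)) //.
    by rewrite gtr0_norm ?subr_gt0 // -(tS j) lerD2r ltW.
  by rewrite mulrA ler_pdivrMr // -cE.
rewrite !mulr_sumr -sumrB (le_trans (ler_norm_sum _ _ _)) //.
apply: (@le_trans _ _ (\sum_(0 <= j < N.+1) c^-1 * e)).
  by rewrite !big_nat; apply: ler_sum => j /andP[_ jN]; exact: hc.
rewrite big_const_nat subn0 iter_addr_0 -[X in X <= _]mulr_natl cE.
by rewrite mulrA mulfV ?mul1r // gt_eqF.
Qed.

End Averaging.

(** * Differentiability from Lipschitz partial derivatives *)

Section Frechet.
Context {R : realType} {d : nat}.
Local Notation E := 'rV[R]_d.
Implicit Types (x y h : E) (v : E -> R) (g : 'I_d -> E -> R).

Definition dotp (c : 'I_d -> R) h : R := \sum_(i < d) h ord0 i * c i.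

Lemma dotp_is_linear c : linear (dotp c).
Proof.
move=> a x y; rewrite /dotp scaler_sumr -big_split; apply: eq_bigr => i _.
by rewrite !mxE mulrDl -mulrA.
Qed.

HB.instance Definition _ c :=
  GRing.isLinear.Build R E R _ (dotp c) (dotp_is_linear c).

Lemma is_derive_along v y w (t l : R) : is_derive (y + t *: w) w v l ->
  is_derive t 1 (fun s : R => v (y + s *: w)) l.
Proof.
move=> [dl <-].
have e : (fun h : R => h^-1 *: (((fun s : R => v (y + s *: w)) \o shift t) (h *: 1)
             - (fun s : R => v (y + s *: w)) t)) =
         (fun h : R => h^-1 *: ((v \o shift (y + t *: w)) (h *: w) - v (y + t *: w))).
  apply: funext => h /=.
  by rewrite [h *: 1]mulr1 scalerDl addrCA.
by split; rewrite /derivable /derive e.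
Qed.

Lemma increment_along v g i y (t : R) :
  (forall x, is_derive x (axis i) v (g i x)) ->
  exists2 z, `|z| <= `|t| & v (y + t *: axis i) - v y = t * g i (y + z *: axis i).
Proof.
move=> dv.
have dl (s : R) : `|s| < `|t| + 1 -> is_derive s 1 (fun s : R => v (y + s *: axis i))
    (g i (y + s *: axis i)).
  by move=> _; exact: is_derive_along.
have [t0|t0|->] := ltgtP t 0.
- have [||z /andP[z1 z2]] := antiderivative_MVT t0 dl.
  + by rewrite ltr0_norm // opprD opprK; lra.
  + by rewrite ltr_wpDl.
  rewrite scale0r addr0 sub0r mulrN mulrC => /eqP; rewrite -eqr_opp opprK opprB.
  by move=> /eqP e; exists z => //; rewrite !ltr0_norm //; lra.
- have [||z /andP[z1 z2]] := antiderivative_MVT t0 dl.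
  + by rewrite oppr_lt0 ltr_wpDl.
  + by rewrite gtr0_norm //; lra.
  rewrite scale0r addr0 subr0 mulrC => e.
  by exists z => //; rewrite !gtr0_norm //; lra.
by exists 0; rewrite ?normr0 // scale0r addr0 subrr mul0r.
Qed.

(** Moving along one coordinate at a time, each increment is a partial
    derivative at some point within distance [D] of [x]. *)
Lemma first_order_bound v g (r : R) x h y (s : seq 'I_d) (D : R) : 0 <= r ->
  (forall i x, is_derive x (axis i) v (g i x)) ->
  (forall i, lipschitz_fun r (g i)) ->
  norm1 (y - x) + \sum_(i <- s) `|h ord0 i| <= D ->
  `|v (y + \sum_(i <- s) h ord0 i *: axis i) - v y
      - \sum_(i <- s) h ord0 i * g i x| <= r * D * \sum_(i <- s) `|h ord0 i|.
Proof.
move=> r0 dv lg; elim: s y => [|i s IH] y.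
  by move=> _; rewrite !big_nil addr0 subrr subr0 normr0 mulr0.
rewrite !big_cons => hD; set t := h ord0 i.
have yD : norm1 (y + t *: axis i - x) + \sum_(j <- s) `|h ord0 j| <= D.
  rewrite (le_trans _ hD) // addrA lerD2r addrAC.
  by rewrite (le_trans (norm1D _ _)) // lerD2l norm1_axis.
have {IH} := IH _ yD; rewrite (addrA y).
have [z zt e] := @increment_along v g i y t (dv i).
set w := v _; set S1 := \sum_(j <- s) _; set S2 := \sum_(j <- s) _ => IH.
have -> : w - v y - (t * g i x + S1) =
   (w - v (y + t *: axis i) - S1) + t * (g i (y + z *: axis i) - g i x).
  by rewrite mulrBr -e; ring.
rewrite (le_trans (ler_normD _ _)) // [leLHS]addrC [leRHS]mulrDr lerD //.
rewrite normrM mulrC ler_wpM2r // (le_trans (lg _ _ _)) // ler_wpM2l //.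
rewrite (le_trans (enorm_le_norm1 _)) // addrAC (le_trans (norm1D _ _)) //.
rewrite norm1_axis (le_trans _ hD) // lerD2l (le_trans zt) // lerDl.
by apply: sumr_ge0.
Qed.

Lemma sum_axis h : \sum_(i < d) h ord0 i *: axis i = h.
Proof. by rewrite [RHS]row_sum_delta. Qed.

(** Telescoping the increment over the coordinates, the remainder is
    quadratic. *)
Lemma lipschitz_partials_differentiable v g (r : R) x :
  (forall i x, is_derive x (axis i) v (g i x)) ->
  (forall i, lipschitz_fun r (g i)) ->
  differentiable v x.
Proof.
move=> dv lg'.
have lg i : lipschitz_fun `|r| (g i) := lipschitzW (ler_norm r) (lg' i).
have bound h : `|v (h + x) - v x - dotp (g^~ x) h| <= `|r| * d%:R ^+ 2 * `|h| ^+ 2.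
  have := @first_order_bound v g `|r| x h x (index_enum 'I_d) (norm1 h)
    (normr_ge0 _) dv lg.
  rewrite subrr norm10 add0r lexx => /(_ isT); rewrite sum_axis (addrC x).
  move=> /le_trans; apply; rewrite -mulrA -expr2 -mulrA -exprMn.
  rewrite ler_wpM2l // ler_pXn2r ?nnegrE ?mulr_ge0 ?norm1_ge0 //.
  exact: norm1_le_norm.
have dc : continuous (dotp (g^~ x)).
  pose C := \sum_(i < d) `|g i x|.
  apply: (@lipschitz_continuous _ _ C) => y z.
  rewrite -(linearB (dotp (g^~ x))) /dotp mulr_suml (le_trans (ler_norm_sum _ _ _)) //.
  apply: ler_sum => i _; rewrite normrM mulrC ler_wpM2l //.
  exact: coord_le_enorm.
have dE := @diff_unique _ _ _ v (dotp (g^~ x)) x dc.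
suff e : v \o shift x = ((cst (v x) : E -> R) + (dotp (g^~ x) : E -> R))%R +o_ (0%R : E) id.
  by apply/diff_locallyP; rewrite (dE e).
  apply/eqaddoP => e e0.
  pose k := `|r| * d%:R ^+ 2 + 1.
  have k0 : 0 < k by rewrite ltr_wpDl // mulr_ge0 // exprn_ge0.
  have : \forall h \near (0 : E), `|0 - h| < e / k.
    have /cvgrPdist_lt : h @[h --> (0 : E)] --> (0 : E) by exact: cvg_id.
    by apply; rewrite divr_gt0.
  apply: filterS => h; rewrite sub0r normrN => he.
  have -> : (v \o shift x - (cst (v x) + dotp (g^~ x))) h =
     v (h + x) - v x - dotp (g^~ x) h by rewrite !fctE /= opprD addrA.
  rewrite (le_trans (bound h)) // (expr2 `|h|) mulrA ler_wpM2r //.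
  move: he; rewrite ltr_pdivlMr // => /ltW; apply: le_trans.
  by rewrite mulrC ler_wpM2l // lerDl.
Qed.

End Frechet.

(** * A smoothing averaging operator *)

Lemma bounded_funP {R : realType} {T : Type} (u : T -> R) :
  bounded_fun u <-> exists c : R, forall x, `|u x| <= c.
Proof.
split.
  move=> [M [_ /(_ (M + 1))]]; rewrite ltrDl => /(_ ltr01) h.
  by exists (M + 1) => x; exact: h.
move=> [c uc]; exists c; split; first exact: num_real.
by move=> c' cc' x _; exact: le_trans (uc x) (ltW cc').
Qed.

Section Mollifier.
Context {R : realType} {d : nat}.
Local Notation E := 'rV[R]_d.
Implicit Types (x y : E) (u v : E -> R).

Definition boxes (a : R) (s : seq 'I_d) u : E -> R :=
  foldr (fun i v => box i a v) u s.

Lemma boxes_averaging (a : R) s : 0 < a ->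
  averaging ((size s)%:R * a) (boxes a s).
Proof.
move=> a0; elim: s => [|i s IH].
  by rewrite mul0r; exact: averaging_id.
rewrite /= -natr1 mulrDl mul1r addrC.
exact: averaging_comp (box_averaging i a0) IH.
Qed.

(** Since the factors commute, any direction occurring in [s] can be brought to
    the front. *)
Lemma boxes_factor (a : R) s i : 0 < a -> i \in s ->
  exists2 C, averaging ((size s)%:R * a) C &
    forall r u, lipschitz_fun r u -> boxes a s u = box i a (C u).
Proof.
move=> a0; elim: s => // j s IH; rewrite inE.
have [-> _|ij /= /IH[C aC HC]] := eqVneq i j.
  exists (boxes a s) => //; apply: averagingW (boxes_averaging s a0).
  by rewrite ler_wpM2r ?ler_nat // ltW.
exists (box j a \o C).
  rewrite -natr1 mulrDl mul1r addrC.
  exact: averaging_comp (box_averaging j a0) aC.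
move=> r u lu; rewrite (HC r u lu); apply: funext => x; rewrite -[in RHS]/(box j a (C u)).
have lC := averaging_lipschitz aC lu.
exact: (averaging_comm x (box_averaging j a0) (box_averaging i a0) lC).
Qed.

Lemma averaging_dist (delta r r' c : R) (T : (E -> R) -> E -> R) u v x :
  averaging delta T -> lipschitz_fun r u -> lipschitz_fun r' v ->
  (forall y, `|u y - v y| <= c) -> `|T u x - T v x| <= c.
Proof.
move=> aT lu lv uv.
have := @averaging_linear R d delta r' r (-1) T v u x aT lv lu.
rewrite mulN1r (addrC (- T v x)) => <-.
apply: averaging_norm aT (lipschitzD (lipschitzZ (-1) lv) lu) _ => y _.
have -> : (-1 *: v + u) (x + y) = -1 * v (x + y) + u (x + y) by [].
by rewrite mulN1r addrC.
Qed.

Variable a0 : R.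
Hypothesis a0_gt0 : 0 < a0.

Definition width (j : nat) : R := a0 / 2 ^+ j.

Lemma width_gt0 j : 0 < width j.
Proof. by rewrite divr_gt0 // exprn_gt0. Qed.

Lemma widthS j : width j = 2 * width j.+1.
Proof.
rewrite /width exprS; field; by rewrite expf_neq0.
Qed.

Definition level (j : nat) u := boxes (width j) (enum 'I_d) u.

Definition levels (m N : nat) u := foldr level u (iota m N).

Lemma level_averaging j : averaging (d%:R * width j) (level j).
Proof.
by have := boxes_averaging (enum 'I_d) (width_gt0 j); rewrite size_enum_ord.
Qed.

(** The radii of all levels from [m] on add up to at most this number. *)
Definition radius (m : nat) : R := 2 * d%:R * width m.

Lemma radius_ge0 m : 0 <= radius m.
Proof. by rewrite !mulr_ge0 // ltW // width_gt0. Qed.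

(** As [width m = 2 * (width m - width m.+1)], the radii of the levels
    telescope. *)
Lemma levels_averaging_sharp m N : averaging (radius m - radius (m + N)) (levels m N).
Proof.
elim: N m => [|N IH] m.
  by rewrite addn0 subrr; exact: averaging_id.
have -> : radius m - radius (m + N.+1) =
    d%:R * width m + (radius m.+1 - radius (m.+1 + N)).
  by rewrite /radius addSnnS (widthS m); ring.
exact: averaging_comp (level_averaging m) (IH m.+1).
Qed.

Lemma levels_averaging m N : averaging (radius m) (levels m N).
Proof.
apply: averagingW (levels_averaging_sharp m N).
by rewrite gerBl radius_ge0.
Qed.

Lemma levelsD m N k u : levels m (N + k) u = levels m N (levels (m + N) k u).
Proof. by rewrite /levels iotaD foldr_cat. Qed.

Lemma levels_cauchy m N k (r : R) u x : 0 <= r -> lipschitz_fun r u ->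
  `|levels m (N + k) u x - levels m N u x| <= r * radius (m + N).
Proof.
move=> r0 lu; rewrite levelsD; have ak := levels_averaging (m + N) k.
apply: (averaging_dist x (levels_averaging m N) (averaging_lipschitz ak lu) lu).
move=> y; exact: averaging_near r0 ak lu.
Qed.

Lemma radius_small (e c : R) m : 0 < e ->
  \forall N \near \oo, c * radius (m + N) < e.
Proof.
move=> e0; pose K := Num.trunc (`|c| * radius m / e).
near=> N.
have KN : (K < N)%N by near: N; exact: nbhs_infty_gt.
apply: le_lt_trans (ler_wpM2r (radius_ge0 _) (ler_norm c)) _.
have h1 : `|c| * radius m < e * N%:R.
  rewrite mulrC [ltRHS]mulrC -ltr_pdivrMr // mulrC.
  by rewrite (lt_le_trans (truncnS_gt _)) // ler_nat.
have h2 : N%:R <= 2 ^+ N :> R.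
  by rewrite -natrX ler_nat ltnW // ltn_expl.
have h3 : radius m = 2 ^+ N * radius (m + N).
  rewrite /radius /width exprD; field; by rewrite !expf_neq0.
have p0 : 0 < 2 ^+ N :> R by rewrite exprn_gt0.
rewrite -(ltr_pM2l p0) mulrCA -h3 (lt_le_trans h1) // mulrC ler_wpM2r //.
exact: ltW.
Unshelve. all: by end_near. Qed.

(** The composition of all levels from [m] on: in each coordinate, convolution
    with a rescaled Rvachev up function, that is, with the law of an infinite
    sum of independent uniform variables of widths [width j]. *)
Definition mollify (m : nat) u : E -> R := fun x => lim (levels m N u x @[N --> \oo]).

Lemma levels_is_cvg m (r : R) u x : lipschitz_fun r u ->
  cvgn (fun N => levels m N u x).
Proof.
move=> lu'; have lu := lipschitzW (ler_norm r) lu'.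
apply: cauchy_cvg; apply/cauchy_exP => e e0.
have [N _ HN] := @radius_small e `|r| m e0.
exists (levels m N u x); exists N => // n /= Nn.
rewrite /ball /= distrC -(subnKC Nn).
apply: le_lt_trans (levels_cauchy _ _ _ _ _ lu) _ => //.
by apply: HN; rewrite /=.
Qed.

Lemma mollify_approx m N (r : R) u x : 0 <= r -> lipschitz_fun r u ->
  `|mollify m u x - levels m N u x| <= r * radius (m + N).
Proof.
move=> r0 lu; apply/ler_addgt0Pr => e e0.
have /cvgrPdist_le/(_ e e0) := @levels_is_cvg m r u x lu.
move=> [n0 _ /(_ (maxn n0 N))] /=; rewrite leq_maxl => /(_ isT) h.
have h' := @levels_cauchy m N (maxn n0 N - N)%N r u x r0 lu.
rewrite subnKC ?leq_maxr // in h'.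
rewrite (le_trans (ler_distD (levels m (maxn n0 N) u x) _ _)) //.
by rewrite addrC lerD.
Qed.

Lemma mollify_averaging m : averaging (radius m) (mollify m).
Proof.
move=> r e e0; have e2 : 0 < e / 2 by rewrite divr_gt0.
have [N _ HN] := @radius_small (e / 2) `|r| m e2.
have [s [ws Hs]] := levels_averaging m N `|r| e2.
exists s; split=> // u lu' x; have lu := lipschitzW (ler_norm r) lu'.
rewrite (le_trans (ler_distD (levels m N u x) _ _)) // [leRHS]splitr.
rewrite lerD ?Hs // (le_trans (mollify_approx _ _ _ _ lu)) //.
by rewrite ltW // HN /=.
Qed.

(** Applying a level is continuous for uniform convergence, so it may be taken
    out of the limit. *)
Lemma mollify_level m (r : R) u : lipschitz_fun r u ->
  mollify m u = level m (mollify m.+1 u).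
Proof.
move=> lu'; have lu := lipschitzW (ler_norm r) lu'.
apply: funext => x; apply/eqP; rewrite -subr_eq0 -normr_le0.
apply/ler_addgt0Pr => e e0; rewrite add0r.
have e2 : 0 < e / 2 by rewrite divr_gt0.
have [N _ HN] := @radius_small (e / 2) `|r| m e2.
have h1 := mollify_approx m N.+1 x (normr_ge0 r) lu.
have h2 : `|level m (mollify m.+1 u) x - levels m N.+1 u x|
    <= `|r| * radius (m.+1 + N).
  apply: (averaging_dist x (level_averaging m)
    (averaging_lipschitz (mollify_averaging m.+1) lu)
    (averaging_lipschitz (levels_averaging m.+1 N) lu)) => y.
  exact: mollify_approx.
have h3 : `|r| * radius (m + N.+1) <= e / 2 by rewrite ltW // HN /=.
rewrite (le_trans (ler_distD (levels m N.+1 u x) _ _)) // [leRHS]splitr.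
rewrite lerD //; first exact: le_trans h1 _.
by rewrite distrC (le_trans h2) // addSnnS.
Qed.

Definition lip_bounded u : Prop :=
  (exists r, lipschitz_fun r u) /\ exists c : R, forall x, `|u x| <= c.

(** Pulling the box of direction [i] out of the first level turns the partial
    derivative into a difference quotient of fixed width, which commutes with
    the remaining levels. *)
Lemma mollify_partial m i u : lip_bounded u ->
  exists2 u', lip_bounded u' &
    forall x, is_derive x (axis i) (mollify m u) (mollify m.+1 u' x).
Proof.
move=> [[r lu] [c uc]]; set b := width m.
have b0 : 0 < b := width_gt0 m.
have [C aC HC] := boxes_factor b0 (mem_enum 'I_d i).
have am := mollify_averaging m.+1.
have lC := averaging_lipschitz aC lu.
have lp := lipschitz_translate (b *: axis i) lC.
have lq := lipschitz_translate (- b *: axis i) lC.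
pose u' := (2 * b)^-1 *: translate (b *: axis i) (C u)
  + (- (2 * b)^-1) *: translate (- b *: axis i) (C u).
have lu' := lipschitzD (lipschitzZ (2 * b)^-1 lp) (lipschitzZ (- (2 * b)^-1) lq).
have Cc x : `|C u x| <= c by apply: (averaging_norm aC lu) => y _.
exists u'.
  split; first by eexists; exact: lu'.
  exists (`|(2 * b)^-1| * c + `|- (2 * b)^-1| * c) => x.
  rewrite (le_trans (ler_normD _ _)) // lerD //;
    by rewrite normrM ler_wpM2l // Cc.
move=> x; rewrite (mollify_level m lu) /level (HC r); last first.
  exact: averaging_lipschitz am lu.
have lM := averaging_lipschitz am lu.
have := box_is_derive i x (lipschitz_continuous (averaging_lipschitz aC lM)) b0.
rewrite !(averaging_comm _ aC am lu).
have -> : (2 * b)^-1 * (mollify m.+1 (C u) (x + b *: axis i) -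
   mollify m.+1 (C u) (x - b *: axis i)) = mollify m.+1 u' x; last by [].
have -> : mollify m.+1 u' x = (2 * b)^-1 * mollify m.+1 (translate (b *: axis i) (C u)) x
   + mollify m.+1 ((- (2 * b)^-1) *: translate (- b *: axis i) (C u)) x.
  exact: averaging_linear am lp (lipschitzZ (- (2 * b)^-1) lq).
have l0 : lipschitz_fun 0 (0 : E -> R).
  by move=> y z; rewrite subrr normr0 mul0r.
have M0 : mollify m.+1 (0 : E -> R) x = 0.
  apply/eqP; rewrite -normr_le0.
  by apply: (averaging_norm am l0) => y _; rewrite normr0.
have := averaging_linear (- (2 * b)^-1) x am lq l0.
rewrite addr0 M0 addr0 => ->.
rewrite !(averaging_translate _ _ am lC).
by rewrite !(addrC _ x) scaleNr mulNr mulrBr.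
Qed.

Lemma mollify_differentiable m u x : lip_bounded u ->
  differentiable (mollify m u) x.
Proof.
move=> lu.
have /choice[w Hw] : forall i, exists u', lip_bounded u' /\
    forall x, is_derive x (axis i) (mollify m u) (mollify m.+1 u' x).
  by move=> i; have [u' ? ?] := mollify_partial m i lu; exists u'.
have /choice[r Hr] : forall i, exists r, lipschitz_fun r (mollify m.+1 (w i)).
  move=> i; have [[[r lr] _] _] := Hw i; exists r.
  exact: averaging_lipschitz (mollify_averaging m.+1) lr.
apply: (@lipschitz_partials_differentiable _ _ _
  (fun i => mollify m.+1 (w i)) (\sum_i `|r i|)) => i; first by case: (Hw i).
apply: lipschitzW (Hr i); rewrite (bigD1 i) //= (le_trans (ler_norm _)) //.
by rewrite lerDl sumr_ge0.
Qed.

Lemma mollify_partials m u (s : seq 'I_d) : lip_bounded u ->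
  exists m' u', lip_bounded u' /\ foldr partial (mollify m u) s = mollify m' u'.
Proof.
move=> lu; elim: s => [|i s [m' [u' [lu' /= ->]]]]; first by exists m, u.
have [u'' lu'' du] := mollify_partial m' i lu'.
exists m'.+1, u''; split => //; apply: funext => x.
exact: (@derive_val _ _ _ _ _ _ _ (du x)).
Qed.

Lemma mollify_Cb_infty m u : lip_bounded u -> Cb_infty (mollify m u).
Proof.
move=> lu s; have [m' [u' [lu' ->]]] := mollify_partials m s lu.
split; first by move=> x; exact: mollify_differentiable.
apply/bounded_funP; have [[r lr] [c uc]] := lu'; exists c => x.
by apply: (averaging_norm (mollify_averaging m') lr).
Qed.

End Mollifier.

(** An infinite product of box averages of geometrically decreasing widths is
    smooth, since each differentiation uses up one level only. *)
Lemma smoothing_averaging_exists {R : realType} {d : nat} (delta : R) :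
  0 < delta ->
  exists2 M : ('rV[R]_d -> R) -> 'rV[R]_d -> R, averaging delta M &
    forall u, Lipb u -> Cb_infty (M u).
Proof.
move=> d0; pose a := delta / (2 * d%:R + 1).
have k0 : 0 < 2 * d%:R + 1 :> R by rewrite ltr_wpDl // mulr_ge0.
have a_gt0 : 0 < a by rewrite divr_gt0.
exists (mollify a 0%N).
  apply: averagingW (mollify_averaging a_gt0 0).
  rewrite /radius /width expr0 divr1 /a mulrA ler_pdivrMr // mulrC.
  by rewrite ler_wpM2l ?lerDl // ltW.
by move=> u [/bounded_funP bu lu]; apply: mollify_Cb_infty.
Qed.

(** * Weighted spaces and density of smooth functions *)

Section Weight.
Context {R : realType} {d : nat}.
Local Notation E := 'rV[R]_d.
Implicit Types (x y : E) (f g u v : E -> R) (K : set E).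

Definition cube x (rho : R) : set E :=
  [set y | forall i, `[x ord0 i - rho, x ord0 i + rho]%classic (y ord0 i)].

Lemma cube_compact x rho : compact (cube x rho).
Proof.
by apply: (@rV_compact _ _ (fun i => `[x ord0 i - rho, x ord0 i + rho]%classic));
  move=> i; exact: segment_compact.
Qed.

Lemma cubeP x y rho : `|y - x| <= rho -> cube x rho y.
Proof.
move=> yx i; rewrite /= in_itv /= -ler_distl.
by have := coord_le_norm (y - x) i; rewrite !mxE => /le_trans; apply.
Qed.

Lemma cube_norm1 x y rho : norm1 y <= rho -> cube x rho (x + y).
Proof.
move=> yr; apply: cubeP; rewrite addrC addKr.
exact: le_trans (norm_le_enorm _) (le_trans (enorm_le_norm1 _) yr).
Qed.

Lemma near_norm x (e : R) : 0 < e -> \forall y \near x, `|y - x| < e.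
Proof.
move=> e0; have /cvgrPdist_lt : y @[y --> x] --> x by exact: cvg_id.
by move=> /(_ e e0); apply: filterS => y; rewrite distrC.
Qed.

Lemma continuousP_dist f : continuous f <->
  forall x e, 0 < e -> \forall y \near x, `|f y - f x| <= e.
Proof.
split=> cf x.
  move=> e e0; have /(@cvgrPdist_le _ _ _ (nbhs x) (nbhs_filter x)) := cf x.
  by move=> /(_ e e0); apply: filterS => y; rewrite distrC.
apply/(@cvgrPdist_le _ _ _ (nbhs x) (nbhs_filter x)) => e e0.
by have := cf x e e0; apply: filterS => y; rewrite distrC.
Qed.

Lemma compact_cover_near K (P : nat -> E -> Prop) (F : set_system nat) :
  Filter F -> compact K ->
  (forall x, K x -> \forall y \near x & n \near F, P n y) ->
  \forall n \near F, forall x, K x -> P n x.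
Proof. by move=> FF /compact_near_coveringP; apply. Qed.

Lemma compact_norm_bounded K : compact K ->
  exists2 rho : R, 0 <= rho & forall x, K x -> `|x| <= rho.
Proof.
move=> /compact_bounded[M [_ /(_ (`|M| + 1))]].
rewrite (le_lt_trans (ler_norm M)) ?ltrDl // => /(_ isT) h.
by exists (`|M| + 1) => //; rewrite addr_ge0.
Qed.

Lemma compact_continuous_bounded K f : compact K -> continuous f ->
  exists2 N : R, 0 <= N & forall x, K x -> `|f x| <= N.
Proof.
move=> cK cf.
have : \forall n \near \oo, forall x, K x -> `|f x| <= n%:R.
  apply: compact_cover_near => // x _.
  have /continuousP_dist/(_ x 1 ltr01) h := cf.
  pose A := [set y | `|f y - f x| <= 1].
  pose B := [set n : nat | `|f x| + 1 <= n%:R].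
  exists (A, B) => /=.
    split; first exact: h.
    exists (Num.trunc (`|f x| + 1)).+1 => // n /= hn.
    by rewrite /B /= (le_trans (ltW (truncnS_gt _))) // ler_nat.
  move=> [y n] [/= Ay Bn]; apply: le_trans Bn.
  by rewrite -(subrK (f x) (f y)) addrC (le_trans (ler_normD _ _)) // lerD2l.
by move=> [n _ /(_ n (leqnn n)) h]; exists n%:R.
Qed.

Lemma wnorm_leP (p : E -> R) (c : R) f : (forall x, 0 < p x) ->
  (wnorm p f <= c%:E)%E <-> forall x, `|f x| <= c / p x.
Proof.
move=> p0; split=> h.
  move=> x; rewrite ler_pdivlMr // -lee_fin (le_trans _ h) //.
  by apply: ereal_sup_ubound; exists x.
by apply: ge_ereal_sup => _ [x _ <-]; rewrite lee_fin -ler_pdivlMr.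
Qed.

Variable kappa : E -> R.
Hypothesis hkappa : weight kappa.

Definition kle (c : R) f : Prop := forall x, `|f x| <= c / kappa x.

Lemma kappa_gt0 x : 0 < kappa x.
Proof. by have [[_ _ h] _] := hkappa. Qed.

Lemma kappaV_gt0 x : 0 < (kappa x)^-1.
Proof. by rewrite invr_gt0 kappa_gt0. Qed.

Lemma kappa_continuous : continuous kappa.
Proof. by have [[]] := hkappa. Qed.

Lemma kappaV_continuous : continuous (fun x => (kappa x)^-1).
Proof.
move=> x; apply: (@continuous_comp _ _ _ kappa (fun y : R => y^-1)).
  exact: kappa_continuous.
by apply: inv_continuous; rewrite gt_eqF // kappa_gt0.
Qed.

Lemma kappa_bounded : exists2 B, 0 < B & forall x, kappa x <= B.
Proof.
have [[_ /bounded_funP[B hB] _] _] := hkappa.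
exists B => [|x]; last by rewrite (le_trans (ler_norm _)).
exact: lt_le_trans (kappa_gt0 0) (le_trans (ler_norm _) (hB 0)).
Qed.

Lemma kappa_shift : exists2 M, 1 <= M &
  forall x y, enorm y <= 1 -> (kappa (x + y))^-1 <= M / kappa x.
Proof.
have [_ [M hM]] := hkappa; exists M.
  have := hM 0 0; rewrite enorm0 ler01 subr0 => /(_ isT).
  by rewrite divff // gt_eqF // kappa_gt0.
move=> x y y1; rewrite ler_pdivlMr ?kappa_gt0 // mulrC.
by have := hM x (- y); rewrite enormN opprK => /(_ y1).
Qed.

Lemma wnorm_kleP c f : (wnorm kappa f <= c%:E)%E <-> kle c f.
Proof. exact: wnorm_leP kappa_gt0. Qed.

Lemma kle_ge0 c f : kle c f -> 0 <= c.
Proof.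
move=> /(_ 0) h; have := le_trans (normr_ge0 _) h.
by rewrite pmulr_lge0 // kappaV_gt0.
Qed.

Lemma wnorm_ge0 f : (0 <= wnorm kappa f)%E.
Proof.
apply: (@le_trans _ _ (`|f 0| * kappa 0)%:E).
  by rewrite lee_fin mulr_ge0 // ltW // kappa_gt0.
by apply: ereal_sup_ubound; exists 0.
Qed.

Lemma wnorm_lty f : (wnorm kappa f < +oo)%E <-> exists c, kle c f.
Proof.
split=> [fy|[c /wnorm_kleP/le_lt_trans]]; last by apply; exact: ltry.
exists (fine (wnorm kappa f)); apply/wnorm_kleP.
by rewrite fineK // ge0_fin_numE // wnorm_ge0.
Qed.

Lemma CkappaP f : Ckappa kappa f <-> continuous f /\ exists c, kle c f.
Proof. by rewrite -wnorm_lty. Qed.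

Lemma kleW c c' f : c <= c' -> kle c f -> kle c' f.
Proof.
by move=> cc h x; rewrite (le_trans (h x)) // ler_wpM2r // ltW // kappaV_gt0.
Qed.

Lemma kleD c c' f g : kle c f -> kle c' g -> kle (c + c') (f + g).
Proof.
by move=> hf hg x; rewrite mulrDl (le_trans (ler_normD _ _)) // lerD.
Qed.

Lemma kleN c f : kle c f -> kle c (- f).
Proof. by move=> hf x; rewrite fctE normrN. Qed.

Lemma kleB c c' f g : kle c f -> kle c' g -> kle (c + c') (f - g).
Proof. by move=> hf hg; apply: kleD => //; exact: kleN. Qed.

Lemma kleZ a c f : kle c f -> kle (`|a| * c) (a *: f).
Proof.
by move=> hf x; rewrite normrM -mulrA ler_wpM2l.
Qed.

Lemma CkappaD f g : Ckappa kappa f -> Ckappa kappa g -> Ckappa kappa (f + g).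
Proof.
move=> /CkappaP[cf [c hf]] /CkappaP[cg [c' hg]]; apply/CkappaP; split.
  by move=> x; apply: (@cvgD _ _ _ (nbhs x)); [exact: cf|exact: cg].
by exists (c + c'); exact: kleD.
Qed.

Lemma CkappaZ a f : Ckappa kappa f -> Ckappa kappa (a *: f).
Proof.
move=> /CkappaP[cf [c hf]]; apply/CkappaP; split.
  move=> x; apply: (@cvgM _ _ (nbhs x) _ (fun=> a) f); last exact: cf.
  exact: cst_continuous.
by exists (`|a| * c); exact: kleZ.
Qed.

Lemma CkappaN f : Ckappa kappa f -> Ckappa kappa (- f).
Proof. by rewrite -scaleN1r; exact: CkappaZ. Qed.

Lemma CkappaB f g : Ckappa kappa f -> Ckappa kappa g -> Ckappa kappa (f - g).
Proof. by move=> Cf Cg; apply: CkappaD => //; exact: CkappaN. Qed.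

Lemma bounded_kle N f : 0 <= N -> (forall x, `|f x| <= N) -> exists c, kle c f.
Proof.
move=> N0 hN; have [B B0 hB] := kappa_bounded; exists (N * B) => x.
rewrite ler_pdivlMr ?kappa_gt0 // ler_pM // ltW //; exact: kappa_gt0.
Qed.

Lemma Ckappa_cst (a : R) : Ckappa kappa (cst a : E -> R).
Proof.
apply/CkappaP; split; first by move=> x; exact: cst_continuous.
by apply: (@bounded_kle `|a|).
Qed.

Lemma Ckappa0 : Ckappa kappa (0 : E -> R).
Proof. exact: (Ckappa_cst 0). Qed.

Definition lipbr r f : Prop := lipschitz_fun r f /\ forall x, `|f x| <= r.

Lemma lipbr_ge0 r f : lipbr r f -> 0 <= r.
Proof. by move=> [_ /(_ 0)]; exact: le_trans. Qed.

Lemma lipbr_Ckappa r f : lipbr r f -> Ckappa kappa f.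
Proof.
move=> lf; apply/CkappaP; split; first exact: lipschitz_continuous lf.1.
exact: bounded_kle (lipbr_ge0 lf) lf.2.
Qed.

Lemma lipbr_Lipb r f : lipbr r f -> Lipb f.
Proof.
by move=> [lf bf]; split; [apply/bounded_funP; exists r|exists r].
Qed.

Lemma Cb_infty_Ckappa f : Cb_infty f -> Ckappa kappa f.
Proof.
move=> /(_ [::])[/= df /bounded_funP[c hc]]; apply/CkappaP; split.
  by move=> x; exact: differentiable_continuous.
exact: bounded_kle (le_trans (normr_ge0 _) (hc 0)) hc.
Qed.

(** Truncation by a cutoff makes [f] bounded; the infimal convolution with a
    steep cone is Lipschitz, and since points at distance more than one
    contribute only nonnegative values to the infimum, its weighted bound does
    not depend on the truncation. It matters that [c'] is chosen before [K] and
    [e]: tightness provides a compact set depending on such a bound, and the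
    approximation has to be good on that compact set. *)
Lemma lipschitz_dense (c : R) f : Ckappa kappa f -> kle c f ->
  exists c', forall K (e : R), compact K -> 0 < e ->
    exists g, [/\ exists r, lipbr r g, kle c' g &
      forall x, K x -> `|f x - g x| <= e].
Proof.
move=> /CkappaP[cf _] hc; have c0 := kle_ge0 hc.
have [M M1 hM] := kappa_shift; exists (c * M) => K e cK e0.
have [rho rho0 hrho] := compact_norm_bounded cK.
pose chi (y : E) : R := Num.max 0 (Num.min 1 (rho + 1 - `|y|)).
have chi01 y : 0 <= chi y <= 1.
  by rewrite /chi le_max lexx /= ge_max ler01 ge_min lexx.
have cchi : continuous chi.
  move=> y; apply: (@continuous_max _ _ (fun=> 0) _ y); first exact: cst_continuous.
  apply: (@continuous_min _ _ (fun=> 1) _ y); first exact: cst_continuous.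
  apply: (@cvgB _ _ _ (nbhs y)); first exact: cst_continuous.
  exact: norm_continuous.
pose g0 y := f y * chi y.
have cg0 : continuous g0.
  by move=> y; apply: (@cvgM _ _ (nbhs y)); [exact: cf|exact: cchi].
have g0K x : K x -> g0 x = f x.
  move=> /hrho xr; rewrite /g0 /chi (_ : Num.min _ _ = 1) ?(max_r ler01) ?mulr1 //.
  by apply: min_l; rewrite -addrA addrC -addrA lerDl addrC subr_ge0.
have g0f x : `|g0 x| <= `|f x|.
  have /andP[h0 h1] := chi01 x.
  by rewrite normrM (ger0_norm h0) ler_piMr.
have [N N0 hN] : exists2 N : R, 0 <= N & forall x, `|g0 x| <= N.
  have [N N0 hN] := compact_continuous_bounded (@cube_compact 0 (rho + 1)) cf.
  exists N => // x; have [xr|xr] := leP `|x| (rho + 1).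
    by rewrite (le_trans (g0f x)) // hN //; apply: cubeP; rewrite subr0.
  rewrite /g0 /chi (_ : Num.max _ _ = 0) ?mulr0 ?normr0 //.
  by apply: max_l; rewrite ge_min subr_le0 (ltW xr) orbT.
pose S (n : nat) (x : E) : set R := range (fun y => g0 y + n%:R * `|x - y|).
have S0 n x : S n x !=set0 by exists (g0 x + n%:R * `|x - x|); exists x.
have Slb n x : lbound (S n x) (- N).
  move=> _ [y _ <-]; have := hN y; rewrite ler_norml => /andP[h _].
  by rewrite ler_wpDr // mulr_ge0.
have Slb' n x : has_lbound (S n x) by exists (- N); exact: Slb.
pose g n x := inf (S n x).
have g_le n x y : g n x <= g0 y + n%:R * `|x - y| by apply: ge_inf => //; exists y.
have g_ge n x (a : R) : (forall y, a <= g0 y + n%:R * `|x - y|) -> a <= g n x.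
  by move=> h; apply: lb_le_inf => // _ [y _ <-].
have gg0 n x : g n x <= g0 x.
  by have := g_le n x x; rewrite subrr normr0 mulr0 addr0.
have glip n : lipschitz_fun n%:R (g n).
  have h x y : g n x <= g n y + n%:R * enorm (x - y).
    rewrite -lerBlDr; apply: g_ge => z; rewrite lerBlDr -addrA.
    rewrite (le_trans (g_le n x z)) // lerD2l -mulrDr ler_wpM2l //.
    rewrite -(subrK y x) -addrA addrC (le_trans (ler_normD _ _)) //.
    by rewrite subrK lerD2l norm_le_enorm.
  move=> x y; rewrite ler_distl; have := h x y; have := h y x.
  rewrite -opprB enormN => h1 h2; apply/andP; split => //.
  by rewrite lerBlDr.
have gbd n x : `|g n x| <= N.
  have := hN x; rewrite !ler_norml => /andP[_ h]; apply/andP; split.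
    by apply: lb_le_inf => //; exact: Slb.
  exact: le_trans (gg0 n x) h.
have : \forall n \near \oo, forall x, K x -> g0 x - e <= g n x.
  apply: compact_cover_near => // x _.
  have e2 : 0 < e / 2 by rewrite divr_gt0.
  have /continuousP_dist/(_ x _ e2) := cg0.
  move=> /nbhs_normP[eta /= eta0 heta].
  have h2 : 0 < eta / 2 by rewrite divr_gt0.
  exists ([set y : E | `|y - x| < eta / 2], [set n : nat | 2 * N / (eta / 2) <= n%:R]) => /=.
    split; first exact: near_norm.
    exists (Num.trunc (2 * N / (eta / 2))).+1 => // n /= hn.
    by rewrite (le_trans (ltW (truncnS_gt _))) // ler_nat.
  move=> [y n] [/= yx]; rewrite ler_pdivrMr // => Nn; apply: g_ge => z.
  have [zy|zy] := ltP `|y - z| (eta / 2).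
    have h3 : `|g0 z - g0 x| <= e / 2.
      apply: heta; rewrite /ball_ /= distrC.
      rewrite -(subrK y z) -addrA (le_lt_trans (ler_normD _ _)) //.
      by rewrite [ltRHS]splitr ltrD // distrC.
    have h4 : `|g0 y - g0 x| <= e / 2.
      by apply: heta; rewrite /ball_ /= distrC (lt_le_trans yx) // ler_pdivrMr //
        ler_peMr ?ltW // ltr1n.
    move: h3 h4; rewrite !ler_distl => /andP[h3 _] /andP[_ h4].
    have h5 : 0 <= n%:R * `|y - z| by rewrite mulr_ge0.
    lra.
  have := hN y; have := hN z; rewrite !ler_norml => /andP[h3 _] /andP[_ h4].
  have h5 : n%:R * (eta / 2) <= n%:R * `|y - z| by rewrite ler_wpM2l.
  lra.
move=> [n1 _ hn1]; pose n := maxn n1 (Num.trunc (N * d%:R)).+1.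
exists (g n); split.
- exists (n%:R + N); split.
    by apply: lipschitzW (glip n); rewrite lerDl.
  by move=> x; rewrite (le_trans (gbd n x)) // lerDr.
- move=> x; rewrite ler_norml; apply/andP; split; last first.
    apply: le_trans (gg0 n x) (le_trans (ler_norm _) _).
    rewrite (le_trans (g0f x)) // (le_trans (hc x)) //.
    by rewrite ler_wpM2r ?ler_peMr // ltW // kappaV_gt0.
  apply: g_ge => y; have [xy|xy] := leP (enorm (y - x)) 1.
    have := hM x (y - x) xy; rewrite addrC subrK => hxy.
    have : `|g0 y| <= c * M / kappa x.
      rewrite (le_trans (g0f y)) // (le_trans (hc y)) // -mulrA.
      by rewrite ler_wpM2l.
    rewrite ler_norml => /andP[h _].
    by rewrite ler_wpDr // mulr_ge0.
  have h1 : 1 <= d%:R * `|x - y|.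
    by rewrite distrC (le_trans (ltW xy)) // enorm_le_norm.
  have h2 : N <= n%:R * `|x - y|.
    apply: (@le_trans _ _ (N * d%:R * `|x - y|)).
      by rewrite -mulrA ler_peMr.
    rewrite ler_wpM2r // (le_trans (ltW (truncnS_gt _))) // ler_nat.
    by rewrite leq_maxr.
  have := hN y; rewrite ler_norml => /andP[h3 _].
  apply: (@le_trans _ _ 0); last by lra.
  rewrite oppr_le0 mulr_ge0 ?mulr_ge0 ?(le_trans ler01 M1) //.
  exact: ltW (kappaV_gt0 x).
- move=> x Kx; rewrite -g0K // ler_distl.
  have := hn1 n (leq_maxl _ _) x Kx; have := gg0 n x.
  by move=> ? ?; apply/andP; split; lra.
Qed.

(** Smoothing at a scale of at most one multiplies the weighted bound by no more
    than the constant of [kappa_shift]. *)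
Lemma smooth_dense (c : R) f : Ckappa kappa f -> kle c f ->
  exists c', forall K (e : R), compact K -> 0 < e ->
    exists g, [/\ Cb_infty g, exists r, lipbr r g, kle c' g &
      forall x, K x -> `|f x - g x| <= e].
Proof.
move=> Cf hc; have [c' hc'] := lipschitz_dense Cf hc.
have [M M1 hM] := kappa_shift; exists (c' * M) => K e cK e0.
have e2 : 0 < e / 2 by rewrite divr_gt0.
have [g [[r lg] gc gf]] := hc' K (e / 2) cK e2.
have r0 := lipbr_ge0 lg.
pose delta := Num.min 1 (e / 2 / (r + 1)).
have r1 : 0 < r + 1 by rewrite ltr_wpDl.
have d0 : 0 < delta by rewrite /delta lt_min ltr01 divr_gt0.
have [T aT sT] := @smoothing_averaging_exists R d delta d0.
have d1 : delta <= 1 by rewrite /delta ge_min lexx.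
exists (T g); split.
- exact/sT/(lipbr_Lipb lg).
- exists r; split; first exact: averaging_lipschitz aT lg.1.
  by move=> x; apply: (averaging_norm aT lg.1) => y _; exact: lg.2.
- move=> x; apply: (averaging_norm aT lg.1) => y yd.
  rewrite (le_trans (gc _)) // -mulrA ler_wpM2l ?(kle_ge0 gc) // hM //.
  exact: le_trans (enorm_le_norm1 y) (le_trans yd d1).
- move=> x Kx; rewrite (le_trans (ler_distD (g x) _ _)) // [leRHS]splitr.
  rewrite lerD ?gf // distrC (le_trans (averaging_near x r0 aT lg.1)) //.
  apply: (@le_trans _ _ ((r + 1) * delta)); first by rewrite ler_wpM2r ?lerDl // ltW.
  by rewrite mulrC -ler_pdivlMr // /delta ge_min lexx orbT.
Qed.

End Weight.

(** * Sublinear schemes *)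

Lemma expR_step {R : realType} (a b c : R) k :
  expR (a * (k.+1%:R * b)) * c = expR (a * b) * (expR (a * (k%:R * b)) * c).
Proof.
by rewrite [RHS]mulrA -expRD -mulrDr -natr1 mulrDl mul1r (addrC b).
Qed.

Section Scheme.
Context {R : realType} {d : nat}.
Local Notation E := 'rV[R]_d.
Implicit Types (x y : E) (f g u v : E -> R) (K : set E) (n k l : nat).

(** What is used of the one-step operators [I n], with time step [h n]: growth
    at rate [w], a commutator with translations of order [L * h n], and a
    derivative [G] on smooth functions. The field [sc_tight] stands for the
    continuity of all iterates in the mixed topology, uniformly in [n] and over
    bounded times: an error that is positive only far away hardly reaches
    a given compact set. *)
Record scheme (kappa : E -> R) (I : nat -> (E -> R) -> (E -> R)) (h : nat -> R)
  (w L : R) (G : (E -> R) -> (E -> R)) : Prop := Scheme {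
  sc_h_gt0 : forall n, 0 < h n;
  sc_h_cvg : h n @[n --> \oo] --> (0 : R);
  sc_w_ge0 : 0 <= w;
  sc_L_ge0 : 0 <= L;
  sc_Ckappa : forall n f, Ckappa kappa f -> Ckappa kappa (I n f);
  sc_mono : forall n f g, Ckappa kappa f -> Ckappa kappa g -> fle f g ->
    fle (I n f) (I n g);
  sc_subadd : forall n f g, Ckappa kappa f -> Ckappa kappa g ->
    fle (I n (f + g)) (I n f + I n g);
  sc_hom : forall n (a : R) f, Ckappa kappa f -> 0 <= a ->
    I n (a *: f) = a *: I n f;
  sc_kle : forall n (c : R) f, Ckappa kappa f -> kle kappa c f ->
    kle kappa (expR (w * h n) * c) (I n f);
  sc_cst : forall n (c : R) x, 0 <= c -> I n (cst c) x <= expR (w * h n) * c;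
  sc_translate : forall n (r : R) f x y, lipbr r f ->
    `|I n f (x + y) - I n (translate x f) y| <= L * r * enorm x * h n;
  sc_tight : forall (T c e : R) K, compact K -> 0 < e ->
    exists2 K', compact K' & forall n k f, k%:R * h n <= T ->
      Ckappa kappa f -> kle kappa c f -> (forall x, K' x -> f x <= 0) ->
      forall x, K x -> iter k (I n) f x <= e;
  sc_smooth : forall f, Cb_infty f -> exists2 C : R, 0 <= C &
    forall n, kle kappa (C * h n) (I n f - f);
  sc_generator : forall f K (e : R), Cb_infty f -> compact K -> 0 < e ->
    \forall n \near \oo, forall x, K x ->
      `|(h n)^-1 * (I n f x - f x) - G f x| <= e }.

Variables (kappa : E -> R) (I : nat -> (E -> R) -> (E -> R)) (h : nat -> R).
Variables (w L : R) (G : (E -> R) -> (E -> R)).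
Hypothesis hkappa : weight kappa.
Hypothesis sc : scheme kappa I h w L G.

Local Notation C := (Ckappa kappa).
Local Notation kle := (kle kappa).
Local Notation J n k f := (iter k (I n) f).

Let h0 n : 0 < h n := sc_h_gt0 sc n.
Let w0 : 0 <= w := sc_w_ge0 sc.
Let L0 : 0 <= L := sc_L_ge0 sc.

Lemma translate_lipbr (r : R) f x : lipbr r f -> lipbr r (translate x f).
Proof.
move=> [lf bf]; have lt := lipschitz_translate x lf; split; first exact: lt.
by move=> y; exact: bf. Qed.

Lemma iterate_Ckappa n k f : C f -> C (J n k f).
Proof. by move=> Cf; elim: k => //= k IH; exact: (sc_Ckappa sc). Qed.

Lemma iterate_mono n k f g : C f -> C g -> fle f g -> fle (J n k f) (J n k g).
Proof.
move=> Cf Cg fg; elim: k => //= k IH; apply: (sc_mono sc) => //; exact: iterate_Ckappa.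
Qed.

Lemma iterate_subadd n k f g : C f -> C g -> fle (J n k (f + g)) (J n k f + J n k g).
Proof.
move=> Cf Cg; elim: k => //= k IH x.
have Cfk := iterate_Ckappa n k Cf; have Cgk := iterate_Ckappa n k Cg.
apply: (le_trans _ (sc_subadd sc n Cfk Cgk x)).
by apply: (sc_mono sc) => //; [apply/iterate_Ckappa/CkappaD|exact: CkappaD].
Qed.

Lemma iterate_hom n k (a : R) f : C f -> 0 <= a -> J n k (a *: f) = a *: J n k f.
Proof.
move=> Cf a0; elim: k => //= k ->; apply: (sc_hom sc) => //; exact: iterate_Ckappa.
Qed.

Lemma iterate0 n k : J n k (0 : E -> R) = 0.
Proof.
have := @iterate_hom n k 0 0 (Ckappa0 hkappa) (lexx 0).
by rewrite !scale0r.
Qed.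

Lemma le_add_diff f g y : f y <= g y + (f - g) y.
Proof. by have -> : (f - g) y = f y - g y by []; rewrite addrC subrK. Qed.

(** All comparisons of iterates go through this inequality: an error [u] in the
    data costs no more than the iterate of [u]. *)
Lemma iterate_le_add n k f g u : C f -> C g -> C u -> (forall x, f x <= g x + u x) ->
  forall x, J n k f x <= J n k g x + J n k u x.
Proof.
move=> Cf Cg Cu fgu x; apply: (le_trans _ (iterate_subadd n k Cg Cu x)).
by apply: iterate_mono => //; exact: CkappaD.
Qed.

Lemma iterate_kle n k (c : R) f : C f -> kle c f ->
  kle (expR (w * (k%:R * h n)) * c) (J n k f).
Proof.
move=> Cf hc; elim: k => [|k IH]; first by rewrite mul0r mulr0 expR0 mul1r.
rewrite expR_step; exact: (sc_kle sc) (iterate_Ckappa n k Cf) IH.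
Qed.

Lemma iterate_le_cst n k (c : R) f : C f -> 0 <= c -> (forall x, f x <= c) ->
  forall x, J n k f x <= expR (w * (k%:R * h n)) * c.
Proof.
move=> Cf c0 fc; elim: k => [|k IH] x; first by rewrite mul0r mulr0 expR0 mul1r.
have c0' : 0 <= expR (w * (k%:R * h n)) * c by rewrite mulr_ge0 // expR_ge0.
rewrite expR_step; apply: (le_trans _ (sc_cst sc n x c0')).
by apply: (sc_mono sc) => //; [exact: iterate_Ckappa|exact: Ckappa_cst].
Qed.

Lemma iterate_dist_cst n k (c : R) f g : C f -> C g -> (forall x, `|f x - g x| <= c) ->
  forall x, `|J n k f x - J n k g x| <= expR (w * (k%:R * h n)) * c.
Proof.
move=> Cf Cg fgc x; have c0 : 0 <= c := le_trans (normr_ge0 _) (fgc 0).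
have half f1 g1 : C f1 -> C g1 -> (forall x, `|f1 x - g1 x| <= c) ->
    J n k f1 x <= J n k g1 x + expR (w * (k%:R * h n)) * c.
  move=> Cf1 Cg1 fg1; have Cd := CkappaB hkappa Cf1 Cg1.
  have Jle := @iterate_le_add n k f1 g1 (f1 - g1) Cf1 Cg1 Cd.
  apply: (le_trans (Jle (le_add_diff f1 g1) x)).
  rewrite lerD2l; apply: iterate_le_cst => // y.
  exact: le_trans (ler_norm _) (fg1 y).
rewrite ler_distl lerBlDr half //=; last by move=> y; rewrite distrC.
exact: half.
Qed.

Lemma iterate_dist_kle n k (c : R) f g : C f -> C g -> kle c (f - g) ->
  kle (expR (w * (k%:R * h n)) * c) (J n k f - J n k g).
Proof.
move=> Cf Cg fgc x.
have half f1 g1 : C f1 -> C g1 -> kle c (f1 - g1) ->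
    J n k f1 x <= J n k g1 x + expR (w * (k%:R * h n)) * c / kappa x.
  move=> Cf1 Cg1 fg1; have Cd := CkappaB hkappa Cf1 Cg1.
  have Jle := @iterate_le_add n k f1 g1 (f1 - g1) Cf1 Cg1 Cd.
  apply: (le_trans (Jle (le_add_diff f1 g1) x)).
  by rewrite lerD2l (le_trans (ler_norm _)) // iterate_kle.
rewrite !fctE ler_distl lerBlDr half //=; first exact: half.
by rewrite -opprB; exact: kleN.
Qed.

Lemma step_lipbr n (r : R) f : lipbr r f ->
  lipbr (expR ((w + L) * h n) * r) (I n f).
Proof.
move=> lf; have r0 := lipbr_ge0 lf; have Cf := lipbr_Ckappa hkappa lf.
have eL : expR (w * h n) <= expR ((w + L) * h n).
  by rewrite ler_expR ler_wpM2r ?lerDl // ltW.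
split=> [x y|x]; last first.
  have := @iterate_dist_cst n 1 r f 0 Cf (Ckappa0 hkappa).
  rewrite iterate0 mul1r; move=> /(_ _ x); rewrite subr0 => J1.
  apply: le_trans (J1 _) _; last by rewrite ler_wpM2r.
  by move=> z; rewrite subr0; exact: lf.2.
have h1 := sc_translate sc n (x - y) y lf; rewrite subrK in h1.
have h2 := @iterate_dist_cst n 1 (r * enorm (x - y)) (translate (x - y) f) f
  (lipbr_Ckappa hkappa (translate_lipbr (x - y) lf)) Cf.
rewrite mul1r in h2; have {}h2 := h2 _ y.
rewrite (le_trans (ler_distD (I n (translate (x - y) f) y) _ _)) //.
apply: le_trans (lerD h1 (h2 _)) _.
  by move=> z; rewrite /translate (le_trans (lf.1 _ _)) // addrK.
have rn : 0 <= r * enorm (x - y) by rewrite mulr_ge0 ?enorm_ge0.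
have -> : L * r * enorm (x - y) * h n + expR (w * h n) * (r * enorm (x - y)) =
  (expR (w * h n) + L * h n) * (r * enorm (x - y)) by ring.
rewrite -[leRHS]mulrA ler_wpM2r // mulrDl expRD.
have e1 : 1 <= expR (w * h n) by rewrite -expR0 ler_expR mulr_ge0 // ltW.
have e2 := expR_ge1Dx (L * h n).
have Lh : 0 <= L * h n by rewrite mulr_ge0 // ltW.
nra.
Qed.

Lemma iterate_lipbr n k (r : R) f : lipbr r f ->
  lipbr (expR ((w + L) * (k%:R * h n)) * r) (J n k f).
Proof.
move=> lf; elim: k => [|k IH]; first by rewrite mul0r mulr0 expR0 mul1r.
by rewrite expR_step; exact: step_lipbr.
Qed.

Lemma lipbrW (r r' : R) f : r <= r' -> lipbr r f -> lipbr r' f.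
Proof.
move=> rr [lf bf]; split; first exact: lipschitzW lf.
by move=> x; exact: le_trans (bf x) rr.
Qed.

(** Sublinearity gives Jensen's inequality for finite averages, up to the
    commutators of [I n] with the translations involved. *)
Lemma step_wavg n (b r : R) s f x : weights b s -> lipbr r f ->
  I n (wavg s f) x <= wavg s (I n f) x + L * r * b * h n.
Proof.
move=> [ws s1] lf; have r0 := lipbr_ge0 lf.
have Ct y := lipbr_Ckappa hkappa (translate_lipbr y lf).
have [Cs sub] : C (wavg s f) /\ I n (wavg s f) x <=
    \sum_(p <- s) p.1 * I n (translate p.2 f) x.
  have wE s' : wavg s' f = \sum_(p <- s') p.1 *: translate p.2 f.
    apply: funext => y; rewrite fct_sumE; apply: eq_bigr => p _.
    by rewrite /translate addrC.
  rewrite wE; elim: s {s1} ws => [|p s IH] ws.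
    rewrite !big_nil; split; first exact: Ckappa0.
    by have := iterate0 n 1 => /= ->.
  have [] := IH; first by move=> q qs; apply: ws; rewrite inE qs orbT.
  rewrite !big_cons => Cs hs; have [p0 _] := ws p (mem_head _ _).
  have Cp := CkappaZ hkappa p.1 (Ct p.2).
  split; first exact: CkappaD.
  apply: le_trans (sc_subadd sc n Cp Cs x) _.
  by rewrite !fctE (sc_hom sc n (Ct p.2) p0) lerD.
apply: le_trans sub _; rewrite -[X in _ + X]mul1r -s1 mulr_suml.
rewrite /wavg -big_split big_seq [leRHS]big_seq /=.
apply: ler_sum => p /ws[p0 pb]; rewrite -mulrDr ler_wpM2l //.
have := sc_translate sc n p.2 x lf; rewrite ler_distlC => /andP[_].
rewrite (addrC p.2) => /le_trans; apply; rewrite lerD2l.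
rewrite ler_pM2r // ler_wpM2l ?mulr_ge0 //.
exact: le_trans (enorm_le_norm1 _) pb.
Qed.

(** Jensen's inequality passes from finite averages to averaging operators. *)
Lemma step_averaging n (b r : R) M f x : averaging b M -> lipbr r f ->
  I n (M f) x <= M (I n f) x + L * r * b * h n.
Proof.
move=> aM lf; apply/ler_addgt0Pr => e e0.
(* A single finite average approximates [M] on both [f] and [I n f]; its error
   is multiplied by at most [expR (w * h n)] in the first case. *)
pose c := expR (w * h n) + 1.
have c0 : 0 < c by rewrite addr_gt0 // expR_gt0.
pose m := Num.max r (expR ((w + L) * h n) * r).
have ec : 0 < e / c by rewrite divr_gt0.
have [s [ws Hs]] := aM m (e / c) ec.
have lf1 : lipschitz_fun m f.
  by apply: lipschitzW lf.1; rewrite /m le_max lexx.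
have lf2 : lipschitz_fun m (I n f).
  by apply: lipschitzW (step_lipbr n lf).1; rewrite /m le_max lexx orbT.
have lMf : lipbr r (M f).
  split; first exact: averaging_lipschitz aM lf.1.
  by move=> y; apply: (averaging_norm aM lf.1) => z _; exact: lf.2.
have lwf : lipbr r (wavg s f).
  split; first exact: wavg_lipschitz ws lf.1.
  by move=> y; apply: (wavg_norm ws) => z _; exact: lf.2.
have h1 := @iterate_dist_cst n 1 (e / c) (M f) (wavg s f)
  (lipbr_Ckappa hkappa lMf) (lipbr_Ckappa hkappa lwf) (Hs _ lf1) x.
rewrite mul1r /= in h1.
have h2 := step_wavg n x ws lf.
have h3 := Hs _ lf2 x.
have ee : expR (w * h n) * (e / c) + e / c = e.
  by rewrite -[X in _ + X]mul1r -mulrDl mulrC divfK // gt_eqF.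
move: h1 h3; rewrite !ler_norml => /andP[_ h1] /andP[h3 _]; lra.
Qed.

(** The Lipschitz constants of the iterates grow at most exponentially, so the
    defects of the single steps add up to a multiple of the elapsed time. *)
Lemma iterate_averaging n k (b r : R) M f x : 0 <= b -> averaging b M -> lipbr r f ->
  J n k (M f) x <= M (J n k f) x
    + L * r * b * expR ((w + L) * (k%:R * h n)) * (k%:R * h n).
Proof.
move=> b0 aM lf; have r0 := lipbr_ge0 lf.
elim: k x => [|k IH] x; first by rewrite mul0r mulr0 addr0.
set e := L * r * b * expR ((w + L) * (k%:R * h n)) * (k%:R * h n) in IH.
have kh0 : 0 <= k%:R * h n by rewrite mulr_ge0 // ltW.
have e0 : 0 <= e by rewrite /e mulr_ge0 // mulr_ge0 ?expR_ge0 // !mulr_ge0.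
have lfk := iterate_lipbr n k lf; set rk := expR _ * r in lfk.
have lMf : lipbr r (M f).
  split; first exact: averaging_lipschitz aM lf.1.
  by move=> y; apply: (averaging_norm aM lf.1) => z _; exact: lf.2.
have lMfk : lipbr rk (M (J n k f)).
  split; first exact: averaging_lipschitz aM lfk.1.
  by move=> y; apply: (averaging_norm aM lfk.1) => z _; exact: lfk.2.
have CM := iterate_Ckappa n k (lipbr_Ckappa hkappa lMf).
have CMk := lipbr_Ckappa hkappa lMfk.
have h1 := @iterate_le_add n 1 (J n k (M f)) (M (J n k f)) (cst e) CM CMk
  (Ckappa_cst hkappa e) IH x.
have h2 := sc_cst sc n x e0.
have h3 := step_averaging n x aM lfk.
rewrite /= in h1; apply: le_trans h1 (le_trans (lerD h3 h2) _).
rewrite -addrA lerD2l /e /rk -natr1.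
set a := expR ((w + L) * (k%:R * h n)).
have a0 : 0 <= a by exact: expR_ge0.
have ea : expR ((w + L) * ((k%:R + 1) * h n)) = expR ((w + L) * h n) * a.
  by rewrite -expRD; congr expR; ring.
rewrite ea.
have g1 : 1 <= expR ((w + L) * h n).
  by rewrite -expR0 ler_expR mulr_ge0 ?addr_ge0 // ltW.
have g2 : expR (w * h n) <= expR ((w + L) * h n).
  by rewrite ler_expR ler_wpM2r ?lerDl // ltW.
have P0 : 0 <= L * r * b * a by rewrite !mulr_ge0.
have -> : L * (a * r) * b * h n + expR (w * h n) * (L * r * b * a * (k%:R * h n)) =
  (L * r * b * a) * (h n + expR (w * h n) * (k%:R * h n)) by ring.
have -> : L * r * b * (expR ((w + L) * h n) * a) * ((k%:R + 1) * h n) =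
  (L * r * b * a) * (expR ((w + L) * h n) * (k%:R * h n) + expR ((w + L) * h n) * h n).
  by ring.
rewrite ler_wpM2l // addrC lerD //; first by rewrite ler_wpM2r.
by rewrite ler_peMl // ltW.
Qed.

(** Every further step moves the iterate by what the first one moves the datum,
    up to growth. *)
Lemma iterate_time_smooth n k (c : R) f : C f -> 0 <= c -> kle (c * h n) (I n f - f) ->
  kle (c * (k%:R * h n) * expR (w * (k%:R * h n))) (J n k f - f).
Proof.
move=> Cf c0 hc; elim: k => [|k IH].
  by rewrite mul0r mulr0 mul0r subrr => x; rewrite normr0 mul0r.
have h1 := iterate_dist_kle n 1 (iterate_Ckappa n k Cf) Cf IH.
have -> : J n k.+1 f - f = (J n 1 (J n k f) - J n 1 f) + (I n f - f).
  by rewrite /= addrA subrK.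
apply: (kleW hkappa _ (kleD h1 hc)).
rewrite mul1r -natr1 [(_ + 1) * h n]mulrDl mul1r.
rewrite [w * (_ + _)]mulrDr expRD.
set a := expR (w * (k%:R * h n)); set b := expR (w * h n).
have a1 : 1 <= a by rewrite -expR0 ler_expR !mulr_ge0 // ltW.
have b1 : 1 <= b by rewrite -expR0 ler_expR mulr_ge0 // ltW.
have ch : 0 <= c * h n by rewrite mulr_ge0 // ltW.
have ab : 1 <= a * b by rewrite -[1]mulr1 ler_pM.
have -> : b * (c * (k%:R * h n) * a) = c * (k%:R * h n) * (a * b) by ring.
by rewrite (mulrDr c) mulrDl lerD2l ler_peMr.
Qed.

(** The constant [delta] is split off and controlled by [sc_cst]; what remains
    is nonpositive on [K']. *)
Lemma iterate_tight (T c e : R) K : compact K -> 0 < e ->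
  exists K' (delta : R), [/\ compact K', 0 < delta &
    forall n k f, k%:R * h n <= T -> C f -> kle c f ->
      (forall x, K' x -> f x <= delta) -> forall x, K x -> J n k f x <= e].
Proof.
move=> cK e0; have e2 : 0 < e / 2 by rewrite divr_gt0.
have [B B0 hB] := kappa_bounded hkappa.
have [K' cK' hK'] := sc_tight sc T (c + B) cK e2.
pose a := expR (w * `|T|).
have a0 : 0 < a by exact: expR_gt0.
exists K', (Num.min 1 (e / 2 / a)).
have d0 : 0 < Num.min 1 (e / 2 / a) by rewrite lt_min ltr01 divr_gt0.
split=> // n k f kT Cf hc fd x Kx.
set delta := Num.min _ _ in d0 fd.
have Cd := Ckappa_cst hkappa delta.
have Cfd := CkappaB hkappa Cf Cd.
have -> : e = e / 2 + e / 2 by exact: splitr.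
apply: (le_trans (@iterate_le_add n k f (f - cst delta) (cst delta) Cf Cfd Cd _ x)).
  by move=> y; rewrite !fctE subrK.
apply: lerD.
  apply: hK' => //; last by move=> y K'y; rewrite !fctE subr_le0 fd.
  apply: kleB => // y; have -> : cst delta y = delta by [].
  rewrite (gtr0_norm d0).
  rewrite ler_pdivlMr ?kappa_gt0 // -[leRHS]mul1r.
  apply: ler_pM => //; [exact: ltW|exact/ltW/kappa_gt0|].
  by rewrite /delta ge_min lexx.
apply: le_trans (iterate_le_cst n k Cd (ltW d0) (fun y => lexx _) x) _.
apply: (@le_trans _ _ (a * delta)).
  rewrite ler_wpM2r ?(ltW d0) // ler_expR ler_wpM2l //.
  exact: le_trans kT (ler_norm T).
by rewrite mulrC -ler_pdivlMr // /delta ge_min lexx orbT.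
Qed.

Lemma iterate_equicontinuous (T c e : R) K : compact K -> 0 < e ->
  exists K' (delta : R), [/\ compact K', 0 < delta &
    forall n k f g, k%:R * h n <= T -> C f -> C g -> kle c (f - g) ->
      (forall x, K' x -> `|f x - g x| <= delta) ->
      forall x, K x -> `|J n k f x - J n k g x| <= e].
Proof.
move=> cK e0; have [K' [delta [cK' d0 H]]] := iterate_tight T c cK e0.
exists K', delta; split=> // n k f g kT Cf Cg hc fg x Kx.
have half f1 g1 : C f1 -> C g1 -> kle c (f1 - g1) ->
    (forall x, K' x -> `|f1 x - g1 x| <= delta) ->
    J n k f1 x <= J n k g1 x + e.
  move=> Cf1 Cg1 hc1 fg1; have Cd := CkappaB hkappa Cf1 Cg1.
  have Jle := @iterate_le_add n k f1 g1 (f1 - g1) Cf1 Cg1 Cd.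
  apply: (le_trans (Jle (le_add_diff f1 g1) x)).
  rewrite lerD2l; apply: H => // y K'y.
  exact: le_trans (ler_norm _) (fg1 y K'y).
rewrite ler_distl lerBlDr half //=; first exact: half.
  by rewrite -opprB; exact: kleN.
by move=> y K'y; rewrite distrC fg.
Qed.

Lemma kappaV_bounded K : compact K ->
  exists2 m, 0 < m & forall x, K x -> (kappa x)^-1 <= m.
Proof.
move=> cK; have [N N0 hN] := compact_continuous_bounded cK (kappaV_continuous hkappa).
exists (N + 1); first by rewrite ltr_wpDl.
move=> x Kx; rewrite (le_trans (ler_norm _)) // (le_trans (hN x Kx)) //.
by rewrite lerDl.
Qed.

(** For smooth data this is [iterate_time_smooth]; in general a smooth
    approximation is propagated by [iterate_equicontinuous]. *)
Lemma iterate_time_continuous f K (T e : R) : C f -> compact K -> 0 < e ->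
  exists2 delta : R, 0 < delta & forall n k l, (k + l)%:R * h n <= T ->
    l%:R * h n <= delta -> forall x, K x -> `|J n (k + l) f x - J n k f x| <= e.
Proof.
move=> Cf cK e0; have [_ [c hc]] := (CkappaP hkappa f).1 Cf.
have [c' hd] := smooth_dense hkappa Cf hc.
have e3 : 0 < e / 3 by rewrite divr_gt0.
have [K' [eta [cK' eta0 Jn]]] := iterate_equicontinuous T (c + c') cK e3.
have [g [sg _ gc fg]] := hd K' eta cK' eta0.
have Cg := Cb_infty_Ckappa hkappa sg.
have [D D0 hD] := sc_smooth sc sg.
have [m m0 hm] := kappaV_bounded cK.
pose a := expR (w * `|T|); have a0 : 0 < a by exact: expR_gt0.
pose Q := D * a * a * m + 1.
have Q0 : 0 < Q by rewrite ltr_wpDl // !mulr_ge0 // ltW.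
exists (e / 3 / Q); first by rewrite divr_gt0.
move=> n k l klT lQ x Kx.
have kT : k%:R * h n <= T.
  by rewrite (le_trans _ klT) // ler_pM2r // ler_nat leq_addr.
have lT : l%:R * h n <= T.
  by rewrite (le_trans _ klT) // ler_pM2r // ler_nat leq_addl.
have h1 : `|J n (k + l) f x - J n (k + l) g x| <= e / 3.
  by apply: Jn => //; exact: kleB.
have h2 : `|J n k f x - J n k g x| <= e / 3.
  by apply: Jn => //; exact: kleB.
have h3 := iterate_time_smooth l Cg D0 (hD n).
have {h3} := iterate_dist_kle n k (iterate_Ckappa n l Cg) Cg h3 x.
rewrite -iterD !fctE => h3.
have h4 : `|J n (k + l) g x - J n k g x| <= e / 3.
  apply: le_trans h3 _.
  have ek : expR (w * (k%:R * h n)) <= a.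
    by rewrite ler_expR ler_wpM2l // (le_trans kT) // ler_norm.
  have el : expR (w * (l%:R * h n)) <= a.
    by rewrite ler_expR ler_wpM2l // (le_trans lT) // ler_norm.
  have lh0 : 0 <= l%:R * h n by rewrite mulr_ge0 // ltW.
  have i1 : expR (w * (k%:R * h n)) * (D * (l%:R * h n) * expR (w * (l%:R * h n)))
      <= a * (D * (l%:R * h n) * a).
    have Dl : 0 <= D * (l%:R * h n) by rewrite mulr_ge0.
    have Dle : 0 <= D * (l%:R * h n) * expR (w * (l%:R * h n)).
      by rewrite mulr_ge0 ?expR_ge0.
    apply: (ler_pM (expR_ge0 _) Dle ek).
    exact: ler_wpM2l Dl _ _ el.
  apply: le_trans (ler_pM _ _ i1 (hm x Kx)) _.
  - by rewrite mulr_ge0 ?expR_ge0 // mulr_ge0 ?expR_ge0 // mulr_ge0.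
  - exact: ltW (kappaV_gt0 hkappa x).
  have -> : a * (D * (l%:R * h n) * a) * m = (D * a * a * m) * (l%:R * h n) by ring.
  apply: (@le_trans _ _ (Q * (l%:R * h n))).
    by rewrite ler_wpM2r // lerDl.
  by rewrite mulrC -ler_pdivlMr.
move: h1 h2 h4; rewrite !ler_norml => /andP[? ?] /andP[? ?] /andP[? ?].
apply/andP; split; lra.
Qed.

(** For Lipschitz data this is [iterate_lipbr]; in general a Lipschitz
    approximation is propagated by [iterate_equicontinuous]. *)
Lemma iterate_space_equicontinuous f (T e : R) x : C f -> 0 < e ->
  \forall y \near x, forall n k, k%:R * h n <= T -> `|J n k f y - J n k f x| <= e.
Proof.
move=> Cf e0; have [_ [c hc]] := (CkappaP hkappa f).1 Cf.
have [c' hd] := smooth_dense hkappa Cf hc.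
have e3 : 0 < e / 3 by rewrite divr_gt0.
have [K' [eta [cK' eta0 Jn]]] := iterate_equicontinuous T (c + c') (@cube_compact _ _ x 1) e3.
have [g [sg [r lg] gc fg]] := hd K' eta cK' eta0.
have Cg := Cb_infty_Ckappa hkappa sg; have r0 := lipbr_ge0 lg.
pose rT := expR ((w + L) * `|T|) * r.
pose Q := rT * d%:R + 1.
have Q0 : 0 < Q by rewrite ltr_wpDl // !mulr_ge0 // expR_ge0.
have q0 : 0 < Num.min 1 (e / 3 / Q) by rewrite lt_min ltr01 divr_gt0.
have := near_norm x q0; apply: filterS => y; rewrite lt_min => /andP[y1 yQ] n k kT.
have h1 : `|J n k f y - J n k g y| <= e / 3.
  by apply: Jn => //; [exact: kleB|apply: cubeP; exact: ltW].
have h2 : `|J n k f x - J n k g x| <= e / 3.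
  by apply: Jn => //; [exact: kleB|apply: cubeP; rewrite subrr normr0].
have h3 : `|J n k g y - J n k g x| <= e / 3.
  have lk : lipbr rT (J n k g).
    apply: lipbrW (iterate_lipbr n k lg).
    rewrite ler_wpM2r // ler_expR ler_wpM2l ?addr_ge0 //.
    exact: le_trans kT (ler_norm T).
  have rT0 := lipbr_ge0 lk.
  rewrite (le_trans (lk.1 _ _)) //.
  apply: (@le_trans _ _ (rT * (d%:R * `|y - x|))).
    by rewrite ler_wpM2l // enorm_le_norm.
  rewrite mulrA; apply: (@le_trans _ _ (Q * `|y - x|)).
    by rewrite ler_wpM2r // lerDl.
  by rewrite mulrC -ler_pdivlMr // ltW.
move: h1 h2 h3; rewrite !ler_norml => /andP[? ?] /andP[? ?] /andP[? ?].
apply/andP; split; lra.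
Qed.

End Scheme.

(** * Limits along ultrafilters *)

Section Limit.
Context {R : realType} {d : nat}.
Local Notation E := 'rV[R]_d.
Implicit Types (x y : E) (f g u v : E -> R) (K : set E) (n k l : nat).

Lemma ultra_bounded_cvg (F : set_system nat) (a : nat -> R) (b : R) :
  UltraFilter F -> (forall n, `|a n| <= b) -> cvg (a n @[n --> F]).
Proof.
move=> FU ab.
have [|p [_ cp]] := @segment_compact R (- b) b (fmap a F) (fmap_proper_filter _ _).
  have FA : F (a @^-1` `[- b, b]%classic).
    by apply: filterE => n; rewrite /= in_itv /= -ler_norml; exact: ab.
  exact: FA.
apply/cvg_ex; exists p => B Bp.
have [//|FB] := in_ultra_setVsetC (a @^-1` B) FU.
have [y [By nBy]] := cp (~` B) B FB Bp.
by [].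
Qed.

Variables (kappa : E -> R) (I : nat -> (E -> R) -> (E -> R)) (h : nat -> R).
Variables (w L : R) (G : (E -> R) -> (E -> R)).
Hypothesis hkappa : weight kappa.
Hypothesis sc : scheme kappa I h w L G.

Local Notation C := (Ckappa kappa).
Local Notation kle := (kle kappa).
Local Notation J n k f := (iter k (I n) f).

Let h0 n : 0 < h n := sc_h_gt0 sc n.
Let w0 : 0 <= w := sc_w_ge0 sc.
Let L0 : 0 <= L := sc_L_ge0 sc.

Definition steps (t : R) n : nat := Num.trunc (t / h n).

Lemma steps_le (t : R) n : 0 <= t -> (steps t n)%:R * h n <= t.
Proof.
move=> t0; rewrite -ler_pdivlMr // truncn_le divr_ge0 //; exact: ltW.
Qed.

Lemma steps_gt (t : R) n : t < (steps t n)%:R * h n + h n.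
Proof.
rewrite -[X in _ + X]mul1r -mulrDl -ltr_pdivrMr // natr1; exact: truncnS_gt.
Qed.

Lemma steps0 n : steps 0 n = 0%N.
Proof. by rewrite /steps mul0r truncn0. Qed.

Lemma h_small (e : R) : 0 < e -> \forall n \near \oo, h n <= e.
Proof.
move=> e0; have /cvgrPdist_le/(_ e e0) := sc_h_cvg sc.
by apply: filterS => n; rewrite sub0r normrN (gtr0_norm (h0 n)).
Qed.

(** The functions are locally equicontinuous, so pointwise convergence is
    locally uniform. *)
Lemma steps_uniform (F : set_system nat) (t : R) f u K (e : R) :
  Filter F -> 0 <= t -> C f -> continuous u ->
  (forall x, J n (steps t n) f x @[n --> F] --> u x) -> compact K -> 0 < e ->
  \forall n \near F, forall x, K x -> `|J n (steps t n) f x - u x| <= e.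
Proof.
move=> FF t0 Cf cu lu cK e0; apply: compact_cover_near => // x _.
have e3 : 0 < e / 3 by rewrite divr_gt0.
have h1 := iterate_space_equicontinuous hkappa sc t x Cf e3.
have /continuousP_dist/(_ x _ e3) h2 := cu.
have /cvgrPdist_le/(_ _ e3) h3 := lu x.
exists ([set y | (forall n k, k%:R * h n <= t -> `|J n k f y - J n k f x| <= e / 3)
      /\ `|u y - u x| <= e / 3],
   [set n | `|u x - J n (steps t n) f x| <= e / 3]) => /=.
  by split => //; exact: filterI.
move=> [y n] [/= [hy1 hy2]].
move: hy2 (hy1 _ _ (steps_le n t0)); rewrite !ler_norml.
move=> /andP[? ?] /andP[? ?] /andP[? ?]; apply/andP; split; lra.
Qed.

Variable F : set_system nat.
Hypothesis FU : UltraFilter F.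
Hypothesis Foo : \oo `<=` F.

Let FP : ProperFilter F := ultra_proper.
Let FF : Filter F := @filter_filter _ _ FP.

Lemma steps_cvg (t : R) : 0 <= t -> (steps t n)%:R * h n @[n --> F] --> t.
Proof.
move=> t0; apply/cvgrPdist_le => e e0.
have := Foo (h_small e0); apply: filterS => n hn.
have := steps_le n t0; have := steps_gt t n => h1 h2.
by rewrite ger0_norm ?subr_ge0 // lerBlDr addrC (le_trans (ltW h1)) // lerD2l.
Qed.

(** The limit exists because the values are bounded; that it is the same for
    all ultrafilters is [ulim_unique_le]. *)
Definition ulim (t : R) f : E -> R := fun x => lim (J n (steps t n) f x @[n --> F]).

Local Notation S := ulim.

Lemma expR_steps_le (a t c : R) n : 0 <= a -> 0 <= t -> 0 <= c ->
  expR (a * ((steps t n)%:R * h n)) * c <= expR (a * t) * c.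
Proof.
by move=> a0 t0 c0; rewrite ler_wpM2r // ler_expR ler_wpM2l // steps_le.
Qed.

Lemma iterate_steps_kle (t c : R) n f : 0 <= t -> C f -> kle c f ->
  kle (expR (w * t) * c) (J n (steps t n) f).
Proof.
move=> t0 Cf hc; apply: (kleW hkappa _ (iterate_kle sc n (steps t n) Cf hc)).
by apply: expR_steps_le => //; exact: kle_ge0 hc.
Qed.

Lemma ulim_cvg (t : R) f x : 0 <= t -> C f ->
  J n (steps t n) f x @[n --> F] --> S t f x.
Proof.
move=> t0 Cf; have [_ [c hc]] := (CkappaP hkappa f).1 Cf.
apply: (@ultra_bounded_cvg F _ (expR (w * t) * c / kappa x)) => // n.
exact: iterate_steps_kle.
Qed.

Arguments ulim_cvg [t f] x _ _.

Lemma ulim_le (t : R) f x (b : R) : 0 <= t -> C f ->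
  (\forall n \near F, J n (steps t n) f x <= b) -> S t f x <= b.
Proof.
move=> t0 Cf; apply: (ler_cvg_to (ulim_cvg x t0 Cf)); exact: cvg_cst.
Qed.

Lemma ulim_ge (t : R) f x (b : R) : 0 <= t -> C f ->
  (\forall n \near F, b <= J n (steps t n) f x) -> b <= S t f x.
Proof.
move=> t0 Cf; apply: ler_cvg_to (ulim_cvg x t0 Cf); exact: cvg_cst.
Qed.

Lemma ulim_kle (t c : R) f : 0 <= t -> C f -> kle c f -> kle (expR (w * t) * c) (S t f).
Proof.
move=> t0 Cf hc x; rewrite ler_norml; apply/andP; split.
  apply: ulim_ge => //; apply: nearW => n.
  by have := iterate_steps_kle n t0 Cf hc x; rewrite ler_norml => /andP[].
apply: ulim_le => //; apply: nearW => n.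
by have := iterate_steps_kle n t0 Cf hc x; rewrite ler_norml => /andP[].
Qed.

Lemma ulim_continuous (t : R) f : 0 <= t -> C f -> continuous (S t f).
Proof.
move=> t0 Cf; apply/continuousP_dist => x e e0.
have := iterate_space_equicontinuous hkappa sc t x Cf e0; apply: filterS => y hy.
have := hy _ _ (steps_le _ t0) => {}hy.
rewrite ler_distl; apply/andP; split.
  apply: (ler_cvg_to (cvgB (ulim_cvg x t0 Cf) (cvg_cst e)) (ulim_cvg y t0 Cf)).
  by apply: nearW => n /=; have := hy n; rewrite ler_distl => /andP[].
apply: (ler_cvg_to (ulim_cvg y t0 Cf) (cvgD (ulim_cvg x t0 Cf) (cvg_cst e))).
by apply: nearW => n /=; have := hy n; rewrite ler_distl => /andP[].
Qed.

Lemma ulim_Ckappa (t : R) f : 0 <= t -> C f -> C (S t f).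
Proof.
move=> t0 Cf; have [_ [c hc]] := (CkappaP hkappa f).1 Cf.
apply/(CkappaP hkappa); split; first exact: ulim_continuous.
by exists (expR (w * t) * c); exact: ulim_kle.
Qed.

Lemma ulim_uniform (t : R) f K (e : R) : 0 <= t -> C f -> compact K -> 0 < e ->
  \forall n \near F, forall x, K x -> `|J n (steps t n) f x - S t f x| <= e.
Proof.
move=> t0 Cf cK e0; apply: steps_uniform => //; first exact: ulim_continuous.
by move=> x; exact: ulim_cvg.
Qed.

Lemma ulim_mono (t : R) f g : 0 <= t -> C f -> C g -> fle f g -> fle (S t f) (S t g).
Proof.
move=> t0 Cf Cg fg x; apply: (ler_cvg_to (ulim_cvg x t0 Cf) (ulim_cvg x t0 Cg)).
by apply: nearW => n; exact: (iterate_mono sc n _ Cf Cg fg).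
Qed.

Lemma ulim_le_add (t : R) f g u : 0 <= t -> C f -> C g -> C u ->
  (forall x, f x <= g x + u x) -> forall x, S t f x <= S t g x + S t u x.
Proof.
move=> t0 Cf Cg Cu fgu x.
apply: (ler_cvg_to (ulim_cvg x t0 Cf) (cvgD (ulim_cvg x t0 Cg) (ulim_cvg x t0 Cu))).
by apply: nearW => n; exact: (iterate_le_add hkappa sc).
Qed.

Lemma ulim_hom (t a : R) f : 0 <= t -> C f -> 0 <= a -> S t (a *: f) = a *: S t f.
Proof.
move=> t0 Cf a0; apply: funext => x.
have Caf := CkappaZ hkappa a Cf.
apply: (@cvg_unique _ _ (J n (steps t n) (a *: f) x @[n --> F])).
- exact: Rhausdorff.
- exact: ulim_cvg.
have -> : (fun n => J n (steps t n) (a *: f) x) =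
    (fun n => a * J n (steps t n) f x).
  by apply: funext => n; rewrite (iterate_hom sc).
by apply: cvgM; [exact: cvg_cst|exact: ulim_cvg].
Qed.

Lemma ulim_le_cst (t c : R) f : 0 <= t -> C f -> 0 <= c -> (forall x, f x <= c) ->
  forall x, S t f x <= expR (w * t) * c.
Proof.
move=> t0 Cf c0 fc x; apply: ulim_le => //; apply: nearW => n.
apply: le_trans (iterate_le_cst hkappa sc n (steps t n) Cf c0 fc x) _.
exact: expR_steps_le.
Qed.

Lemma ulim_dist_kle (t c : R) f g : 0 <= t -> C f -> C g -> kle c (f - g) ->
  kle (expR (w * t) * c) (S t f - S t g).
Proof.
move=> t0 Cf Cg fgc x; rewrite ler_norml; apply/andP; split.
  apply: (ler_cvg_to (cvg_cst _) (cvgB (ulim_cvg x t0 Cf) (ulim_cvg x t0 Cg))).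
  apply: nearW => n.
  have := kleW hkappa (expR_steps_le n w0 t0 (kle_ge0 hkappa fgc))
    (iterate_dist_kle hkappa sc n (steps t n) Cf Cg fgc).
  by move=> /(_ x); rewrite ler_norml => /andP[].
apply: (ler_cvg_to (cvgB (ulim_cvg x t0 Cf) (ulim_cvg x t0 Cg)) (cvg_cst _)).
apply: nearW => n.
have := kleW hkappa (expR_steps_le n w0 t0 (kle_ge0 hkappa fgc))
  (iterate_dist_kle hkappa sc n (steps t n) Cf Cg fgc).
by move=> /(_ x); rewrite ler_norml => /andP[].
Qed.

Lemma ulim_lipbr (t r : R) f : 0 <= t -> lipbr r f ->
  lipbr (expR ((w + L) * t) * r) (S t f).
Proof.
move=> t0 lf; have Cf := lipbr_Ckappa hkappa lf; have r0 := lipbr_ge0 lf.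
have lk n : lipbr (expR ((w + L) * t) * r) (J n (steps t n) f).
  apply: lipbrW (iterate_lipbr hkappa sc n (steps t n) lf).
  by apply: expR_steps_le; rewrite ?addr_ge0.
split=> [x y|x]; rewrite ler_norml; apply/andP; split.
- apply: (ler_cvg_to (cvg_cst _) (cvgB (ulim_cvg x t0 Cf) (ulim_cvg y t0 Cf))).
  by apply: nearW => n; have := (lk n).1 x y; rewrite ler_norml => /andP[].
- apply: (ler_cvg_to (cvgB (ulim_cvg x t0 Cf) (ulim_cvg y t0 Cf)) (cvg_cst _)).
  by apply: nearW => n; have := (lk n).1 x y; rewrite ler_norml => /andP[].
- apply: ulim_ge => //.
  by apply: nearW => n; have := (lk n).2 x; rewrite ler_norml => /andP[].
- apply: ulim_le => //.
  by apply: nearW => n; have := (lk n).2 x; rewrite ler_norml => /andP[].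
Qed.

Lemma ulim_tight (T c e : R) K : compact K -> 0 < e ->
  exists K' (delta : R), [/\ compact K', 0 < delta &
    forall t f, 0 <= t <= T -> C f -> kle c f ->
      (forall x, K' x -> f x <= delta) -> forall x, K x -> S t f x <= e].
Proof.
move=> cK e0; have [K' [delta [cK' d0 H]]] := iterate_tight hkappa sc T c cK e0.
exists K', delta; split=> // t f /andP[t0 tT] Cf hc fd x Kx.
apply: ulim_le => //; apply: nearW => n; apply: H => //.
exact: le_trans (steps_le n t0) tT.
Qed.

Lemma ulim0 f : S 0 f = f.
Proof.
apply: funext => x; rewrite /ulim.
have -> : (fun n => J n (steps 0 n) f x) = (fun=> f x).
  by apply: funext => n; rewrite steps0.
by apply: cvg_lim; [exact: Rhausdorff|exact: cvg_cst].
Qed.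

Lemma stepsD (s t : R) n : 0 <= s -> 0 <= t ->
  steps (s + t) n = (steps s n + steps t n)%N \/
  steps (s + t) n = (steps s n + steps t n + 1)%N.
Proof.
move=> s0 t0; have s1 := steps_le n s0; have s2 := steps_gt s n.
have t1 := steps_le n t0; have t2 := steps_gt t n.
have u1 := steps_le n (addr_ge0 s0 t0); have u2 := steps_gt (s + t) n.
have lo : (steps s n + steps t n < (steps (s + t) n).+1)%N.
  rewrite -(ltr_nat R) -(ltr_pM2r (h0 n)) natrD -natr1 !mulrDl mul1r; lra.
have hi : (steps (s + t) n < steps s n + steps t n + 2)%N.
  rewrite -(ltr_nat R) -(ltr_pM2r (h0 n)) !natrD !mulrDl; lra.
lia.
Qed.

(** Rounding loses at most one step ([stepsD]), which is negligible by
    [iterate_time_continuous]; and the inner iterate may be replaced by its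
    locally uniform limit because the outer ones are equicontinuous. *)
Lemma ulim_add (s t : R) f : 0 <= s -> 0 <= t -> C f -> S (s + t) f = S s (S t f).
Proof.
move=> s0 t0 Cf; apply: funext => x.
have CS := ulim_Ckappa t0 Cf.
apply: (@cvg_unique _ _ (J n (steps (s + t) n) f x @[n --> F])).
- exact: Rhausdorff.
- by apply: ulim_cvg => //; exact: addr_ge0.
apply/cvgrPdist_le => e e0; have e3 : 0 < e / 3 by rewrite divr_gt0.
have [_ [c hc]] := (CkappaP hkappa f).1 Cf.
have cK : compact [set x] by exact: compact_set1.
have [K' [delta [cK' d0 Jn]]] := iterate_equicontinuous hkappa sc s
  (expR (w * t) * c + expR (w * t) * c) cK e3.
have [eta eta0 Jt] := iterate_time_continuous hkappa sc (s + t) Cf cK e3.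
have n1 := ulim_uniform t0 Cf cK' d0.
have /cvgrPdist_le/(_ _ e3) n2 := ulim_cvg x s0 CS.
have n3 := Foo (h_small eta0).
apply: filterS3 n1 n2 n3 => n H1 H2 H3.
have a1 : `|J n (steps s n) (J n (steps t n) f) x - J n (steps s n) (S t f) x| <= e / 3.
  apply: Jn => //; [exact: steps_le|exact: iterate_Ckappa sc _ _ _ _|].
  by apply: kleB; [exact: iterate_steps_kle|exact: ulim_kle].
have a2 : `|J n (steps (s + t) n) f x - J n (steps s n + steps t n) f x| <= e / 3.
  have := steps_le n (addr_ge0 s0 t0).
  have [->|->] := stepsD n s0 t0; first by move=> _; rewrite subrr normr0 ltW.
  by move=> st; apply: Jt => //; rewrite mul1r.
rewrite iterD in a2; move: a1 a2 H2; rewrite !ler_norml.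
move=> /andP[? ?] /andP[? ?] /andP[? ?]; apply/andP; split; lra.
Qed.

Lemma ulim_averaging (t b r : R) M f x : 0 <= t -> 0 <= b -> averaging b M ->
  lipbr r f ->
  S t (M f) x <= M (S t f) x + L * r * b * expR ((w + L) * t) * t.
Proof.
move=> t0 b0 aM lf; have r0 := lipbr_ge0 lf; have Cf := lipbr_Ckappa hkappa lf.
have lMf : lipbr r (M f).
  split; first exact: averaging_lipschitz aM lf.1.
  by move=> y; apply: (averaging_norm aM lf.1) => z _; exact: lf.2.
apply/ler_addgt0Pr => e e0; apply: ulim_le => //.
  exact: lipbr_Ckappa lMf.
have := ulim_uniform t0 Cf (@cube_compact _ _ x b) e0.
apply: filterS => n hn.
apply: le_trans (iterate_averaging hkappa sc n (steps t n) x b0 aM lf) _.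
rewrite addrAC lerD //.
  have lk := iterate_lipbr hkappa sc n (steps t n) lf.
  have lS := ulim_lipbr t0 lf.
  rewrite -lerBlDl.
  have := averaging_linear (-1) x aM lS.1 lk.1; rewrite mulN1r (addrC (- M (S t f) x)) => <-.
  apply: (averaging_le aM (lipschitzD (lipschitzZ _ lS.1) lk.1)) => y yb.
  have -> : (-1 *: S t f + J n (steps t n) f) (x + y) =
     -1 * S t f (x + y) + J n (steps t n) f (x + y) by [].
  rewrite mulN1r addrC; apply: le_trans (ler_norm _) (hn _ _).
  exact: cube_norm1.
rewrite -!mulrA; do 3 (apply: ler_wpM2l => //).
have st0 : 0 <= (steps t n)%:R * h n by rewrite mulr_ge0 // ltW.
apply: (ler_pM (expR_ge0 _) st0); last exact: steps_le.
by rewrite ler_expR ler_wpM2l ?addr_ge0 // steps_le.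
Qed.

Lemma ulim_time_smooth (t c : R) f : 0 <= t -> C f -> 0 <= c ->
  (forall n, kle (c * h n) (I n f - f)) -> kle (c * t * expR (w * t)) (S t f - f).
Proof.
move=> t0 Cf c0 hc x.
have bnd n : `|J n (steps t n) f x - f x| <= c * t * expR (w * t) / kappa x.
  apply: le_trans (iterate_time_smooth hkappa sc (steps t n) Cf c0 (hc n) x) _.
  have st0 : 0 <= (steps t n)%:R * h n by rewrite mulr_ge0 // ltW.
  rewrite ler_wpM2r //; first exact/ltW/kappaV_gt0.
  apply: ler_pM; [by rewrite mulr_ge0|exact: expR_ge0| |].
    by rewrite ler_wpM2l // steps_le.
  by rewrite ler_expR ler_wpM2l // steps_le.
rewrite ler_norml; apply/andP; split.
  apply: (ler_cvg_to (cvg_cst _) (cvgB (ulim_cvg x t0 Cf) (cvg_cst (f x)))).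
  by apply: nearW => n; have := bnd n; rewrite ler_norml => /andP[].
apply: (ler_cvg_to (cvgB (ulim_cvg x t0 Cf) (cvg_cst (f x))) (cvg_cst _)).
by apply: nearW => n; have := bnd n; rewrite ler_norml => /andP[].
Qed.

Lemma ulim_right_continuous f K (e : R) : C f -> compact K -> 0 < e ->
  exists2 delta : R, 0 < delta & forall t, 0 <= t <= delta ->
    forall x, K x -> `|S t f x - f x| <= e.
Proof.
move=> Cf cK e0; have [delta d0 H] := iterate_time_continuous hkappa sc 1 Cf cK e0.
exists (Num.min 1 delta); first by rewrite lt_min ltr01.
move=> t /andP[t0]; rewrite le_min => /andP[t1 td] x Kx.
have bnd n : `|J n (steps t n) f x - f x| <= e.
  apply: (H n 0%N (steps t n)) => //; rewrite ?add0n.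
    exact: le_trans (steps_le n t0) t1.
  exact: le_trans (steps_le n t0) td.
rewrite ler_norml; apply/andP; split.
  apply: (ler_cvg_to (cvg_cst _) (cvgB (ulim_cvg x t0 Cf) (cvg_cst (f x)))).
  by apply: nearW => n; have := bnd n; rewrite ler_norml => /andP[].
apply: (ler_cvg_to (cvgB (ulim_cvg x t0 Cf) (cvg_cst (f x))) (cvg_cst _)).
by apply: nearW => n; have := bnd n; rewrite ler_norml => /andP[].
Qed.

End Limit.

Arguments ulim_cvg {R d kappa I h w L G} hkappa sc {F} FU [t f] x _ _.

(** * First-order expansion on smooth functions *)

Section Expansion.
Context {R : realType} {d : nat}.
Local Notation E := 'rV[R]_d.
Implicit Types (x y : E) (f g u v : E -> R) (K : set E) (n k l : nat).

Variables (kappa : E -> R) (I : nat -> (E -> R) -> (E -> R)) (h : nat -> R).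
Variables (w L : R) (G : (E -> R) -> (E -> R)).
Hypothesis hkappa : weight kappa.
Hypothesis sc : scheme kappa I h w L G.

Local Notation C := (Ckappa kappa).
Local Notation kle := (kle kappa).
Local Notation J n k f := (iter k (I n) f).

Let h0 n : 0 < h n := sc_h_gt0 sc n.
Let w0 : 0 <= w := sc_w_ge0 sc.
Let L0 : 0 <= L := sc_L_ge0 sc.

Definition diff_quotient n v : E -> R := (h n)^-1 *: (I n v - v).

Lemma diff_quotientE n v x : diff_quotient n v x = (h n)^-1 * (I n v x - v x).
Proof. by []. Qed.

Lemma diff_quotientK n v x : I n v x = v x + h n * diff_quotient n v x.
Proof.
by rewrite diff_quotientE mulrA mulfV ?gt_eqF // mul1r addrC subrK.
Qed.

Lemma diff_quotient_Ckappa n v : C v -> C (diff_quotient n v).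
Proof.
by move=> Cv; apply: CkappaZ => //; apply: CkappaB => //; exact: (sc_Ckappa sc).
Qed.

Lemma diff_quotient_kle n v (D : R) : kle (D * h n) (I n v - v) -> kle D (diff_quotient n v).
Proof.
move=> hD x; rewrite diff_quotientE normrM gtr0_norm ?invr_gt0 //.
rewrite mulrC ler_pdivrMr // mulrAC; exact: hD.
Qed.

Lemma generator_kle v (D : R) : Cb_infty v ->
  (forall n, kle (D * h n) (I n v - v)) -> kle D (G v).
Proof.
move=> sv hD x; apply/ler_addgt0Pr => e e0.
have := sc_generator sc sv (@compact_set1 _ x) e0.
move=> [n _ /(_ n (leqnn n) x erefl)]; rewrite -diff_quotientE => hn.
have := diff_quotient_kle (hD n) x => hq.
rewrite -(subrK (diff_quotient n v x) (G v x)) addrC (le_trans (ler_normD _ _)) //.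
by rewrite lerD // distrC.
Qed.

Lemma generator_Ckappa v : Cb_infty v -> C (G v).
Proof.
move=> sv; have [D D0 hD] := sc_smooth sc sv; apply/(CkappaP hkappa).
split; last by exists D; exact: generator_kle.
apply/continuousP_dist => x e e0; have e3 : 0 < e / 3 by rewrite divr_gt0.
have := sc_generator sc sv (@cube_compact _ _ x 1) e3.
move=> [n _ /(_ n (leqnn n))] hn.
have [cq _] := diff_quotient_Ckappa n (Cb_infty_Ckappa hkappa sv).
have /continuousP_dist/(_ x _ e3) := cq.
have := near_norm x ltr01; apply: filterS2 => y y1 hy.
have := hn y (cubeP (ltW y1)).
have : cube x 1 x by apply: cubeP; rewrite subrr normr0.
move=> /hn; rewrite -!diff_quotientE; move: hy; rewrite !ler_norml.
move=> /andP[? ?] /andP[? ?] /andP[? ?]; apply/andP; split; lra.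
Qed.

(** Consecutive iterates differ by [h n] times an iterate of the difference
    quotient, from above and, after a change of sign, from below. The quotient
    is locally uniformly close to [G v], and few steps hardly move [G v]. *)
Lemma iterate_expand v K (e : R) : Cb_infty v -> compact K -> 0 < e ->
  exists2 delta : R, 0 < delta & \forall n \near \oo, forall k,
    k%:R * h n <= delta -> forall x, K x ->
    `|J n k v x - v x - k%:R * h n * G v x| <= e * (k%:R * h n).
Proof.
move=> sv cK e0; have e2 : 0 < e / 2 by rewrite divr_gt0.
have Cv := Cb_infty_Ckappa hkappa sv; have CG := generator_Ckappa sv.
have CNG := CkappaN hkappa CG.
have [D D0 hD] := sc_smooth sc sv.
have [K' [d1 [cK' d10 Jn]]] := iterate_equicontinuous hkappa sc 1 (D + D) cK e2.
have [d2 d20 Jt] := iterate_time_continuous hkappa sc 1 CG cK e2.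
have [d3 d30 JtN] := iterate_time_continuous hkappa sc 1 CNG cK e2.
exists (Num.min 1 (Num.min d2 d3)); first by rewrite !lt_min ltr01 d20.
have := sc_generator sc sv cK' d10; apply: filterS => n hn.
have Cq := diff_quotient_Ckappa n Cv; have CNq := CkappaN hkappa Cq.
have kq := diff_quotient_kle (hD n); have kG := generator_kle sv hD.
elim=> [|k IH] kd x Kx.
  by rewrite mul0r mul0r mulr0 /= subrr subr0 normr0.
have kd' : k%:R * h n <= Num.min 1 (Num.min d2 d3).
  by rewrite (le_trans _ kd) // ler_pM2r // ler_nat.
have {}IH := IH kd' x Kx; move: kd'; rewrite !le_min => /and3P[k1 k2 k3].
have up : J n k (diff_quotient n v) x <= G v x + e.
  have a1 : `|J n k (diff_quotient n v) x - J n k (G v) x| <= e / 2.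
    by apply: Jn => //; exact: kleB.
  have a2 : `|J n k (G v) x - G v x| <= e / 2 by apply: (Jt n 0%N k).
  move: a1 a2; rewrite !ler_norml => /andP[_ ?] /andP[_ ?]; lra.
have dn : J n k (- diff_quotient n v) x <= - G v x + e.
  have a1 : `|J n k (- diff_quotient n v) x - J n k (- G v) x| <= e / 2.
    apply: Jn => //; first by apply: kleB; exact: kleN.
    move=> y K'y; have -> : (- diff_quotient n v) y - (- G v) y = - (diff_quotient n v y - G v y).
      by rewrite opprB opprK addrC.
    by rewrite normrN; exact: hn.
  have a2 : `|J n k (- G v) x - (- G v) x| <= e / 2 by apply: (JtN n 0%N k).
  move: a1 a2; rewrite !ler_norml -![(- G v) x]/(- (G v x)).
  move=> /andP[_ ?] /andP[_ ?]; lra.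
have CI := sc_Ckappa sc n Cv.
have s1 : J n k (I n v) x <= J n k v x + h n * J n k (diff_quotient n v) x.
  have := iterate_le_add hkappa sc n k CI Cv (CkappaZ hkappa (h n) Cq).
  rewrite (iterate_hom sc n k Cq (ltW (h0 n))); apply => y.
  by rewrite diff_quotientK.
have s2 : J n k v x <= J n k (I n v) x + h n * J n k (- diff_quotient n v) x.
  have := iterate_le_add hkappa sc n k Cv CI (CkappaZ hkappa (h n) CNq).
  rewrite (iterate_hom sc n k CNq (ltW (h0 n))); apply => y.
  have -> : (h n *: - diff_quotient n v) y = - (h n * diff_quotient n v y) 
    by rewrite -[LHS]/(h n * - diff_quotient n v y) mulrN.
  by rewrite diff_quotientK addrK.
rewrite iterSr.
have m1 : h n * J n k (diff_quotient n v) x <= h n * (G v x + e) by rewrite ler_pM2l.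
have m2 : h n * J n k (- diff_quotient n v) x <= h n * (- G v x + e) by rewrite ler_pM2l.
move: IH; rewrite -natr1 !ler_norml => /andP[i1 i2]; apply/andP; split; nra.
Qed.

Variable F : set_system nat.
Hypothesis FU : UltraFilter F.
Hypothesis Foo : \oo `<=` F.
Local Notation S := (ulim I h F).

Lemma ulim_expand v K (e : R) : Cb_infty v -> compact K -> 0 < e ->
  exists2 delta : R, 0 < delta & forall t, 0 <= t <= delta -> forall x, K x ->
    `|S t v x - v x - t * G v x| <= e * t.
Proof.
move=> sv cK e0; have [delta d0 H] := iterate_expand sv cK e0.
have Cv := Cb_infty_Ckappa hkappa sv.
exists delta => // t /andP[t0 td] x Kx.
have st := steps_cvg sc FU Foo t0.
have Sc := ulim_cvg hkappa sc FU x t0 Cv.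
have bnd : \forall n \near F, `|J n (steps h t n) v x - v x
    - (steps h t n)%:R * h n * G v x| <= e * ((steps h t n)%:R * h n).
  apply: filterS (Foo H) => n hn; apply: hn => //.
  exact: le_trans (steps_le sc n t0) td.
have c1 : J n (steps h t n) v x - v x - (steps h t n)%:R * h n * G v x @[n --> F]
   --> S t v x - v x - t * G v x.
  apply: cvgB; first by apply: cvgB Sc (cvg_cst _).
  by apply: cvgM st (cvg_cst _).
have c2 : e * ((steps h t n)%:R * h n) @[n --> F] --> e * t.
  by apply: cvgM (cvg_cst _) st.
exact: (ler_cvg_to (cvg_norm c1) c2 bnd).
Qed.

Lemma ulim_time_lipschitz (t D s r : R) f : C f -> 0 <= D ->
  (forall n, kle (D * h n) (I n f - f)) -> 0 <= s <= t -> 0 <= r <= t ->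
  kle (D * expR (w * t) * expR (w * t) * `|s - r|) (S s f - S r f).
Proof.
move=> Cf D0 hD.
have key s1 r1 : 0 <= r1 -> r1 <= s1 -> s1 <= t ->
    kle (D * expR (w * t) * expR (w * t) * (s1 - r1)) (S s1 f - S r1 f).
  move=> r0 rs st; have sr0 : 0 <= s1 - r1 by rewrite subr_ge0.
  have Cs := ulim_Ckappa hkappa sc FU sr0 Cf.
  have h1 := ulim_time_smooth hkappa sc FU sr0 Cf D0 hD.
  have h2 := ulim_dist_kle hkappa sc FU r0 Cs Cf h1.
  rewrite -(ulim_add hkappa sc FU Foo r0 sr0 Cf) [r1 + _]addrC subrK in h2.
  apply: (kleW hkappa _ h2).
  have e1 : expR (w * r1) <= expR (w * t).
    by rewrite ler_expR ler_wpM2l // (le_trans rs).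
  have e2 : expR (w * (s1 - r1)) <= expR (w * t).
    by rewrite ler_expR ler_wpM2l // lerBlDr ler_wpDr.
  have Ds : 0 <= D * (s1 - r1) by rewrite mulr_ge0.
  have -> : D * expR (w * t) * expR (w * t) * (s1 - r1) =
    expR (w * t) * (D * (s1 - r1) * expR (w * t)) by ring.
  apply: (ler_pM (expR_ge0 _) _ e1); first by rewrite mulr_ge0 ?expR_ge0.
  by rewrite ler_wpM2l.
move=> /andP[s0 st] /andP[r0 rt]; have [rs|/ltW sr] := leP r s.
  by rewrite ger0_norm ?subr_ge0 //; exact: key.
rewrite distrC ger0_norm ?subr_ge0 // -[S s f - _]opprB.
by apply: kleN; exact: key.
Qed.

End Expansion.

(** By continuity the supremum of the times at which the inequality holds is
    one of them; the right increments allow to pass beyond it unless it is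
    [t]. *)
Lemma right_increase_le (R : realType) (phi : R -> R) (t b : R) : 0 <= t ->
  (forall s, 0 <= s < t -> exists2 eta, 0 < eta & forall r, 0 < r <= eta ->
     s + r <= t -> phi s <= phi (s + r) + b * r) ->
  (forall s e, 0 <= s <= t -> 0 < e -> exists2 eta, 0 < eta & forall r,
     0 <= r <= t -> `|r - s| <= eta -> `|phi r - phi s| <= e) ->
  phi 0 <= phi t + b * t.
Proof.
move=> t0 inc cont.
pose A := [set s | 0 <= s <= t /\ phi 0 <= phi s + b * s].
have A0 : A 0 by split; rewrite ?lexx ?mulr0 ?addr0.
have hA : has_sup A by split; [exists 0|exists t => s [/andP[]]].
pose s := sup A.
have s0 : 0 <= s by exact: (ub_le_sup hA.2).
have st : s <= t by apply: (ge_sup (ex_intro _ _ A0)) => r [/andP[]].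
have st' : 0 <= s <= t by rewrite s0.
have As : phi 0 <= phi s + b * s.
  apply/ler_addgt0Pr => e e0; have e2 : 0 < e / 2 by rewrite divr_gt0.
  have [eta eta0 heta] := cont s _ st' e2.
  pose z := Num.min eta (e / 2 / (`|b| + 1)).
  have b1 : 0 < `|b| + 1 by rewrite ltr_wpDl.
  have z0 : 0 < z by rewrite /z lt_min eta0 divr_gt0.
  have [r [/andP[r0 rt] Ar] sr] := sup_adherent z0 hA.
  have rs : r <= s by apply: (ub_le_sup hA.2); split; rewrite ?r0.
  have srz : s - r <= z by rewrite lerBlDr addrC -lerBlDr ltW.
  have rd : `|r - s| <= eta.
    rewrite distrC ger0_norm ?subr_ge0 // (le_trans srz) //.
    by rewrite /z ge_min lexx.
  have := heta r _ rd; rewrite r0 rt => /(_ isT).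
  rewrite ler_norml => /andP[_ h1].
  have h2 : b * r <= b * s + e / 2.
    have : `|b| * (s - r) <= e / 2.
      apply: (@le_trans _ _ ((`|b| + 1) * z)).
        by rewrite ler_pM ?subr_ge0 // lerDl.
      by rewrite mulrC -ler_pdivlMr // /z ge_min lexx orbT.
    have : - b * (s - r) <= `|b| * (s - r).
      by rewrite ler_wpM2r ?subr_ge0 // -normrN ler_norm.
    lra.
  lra.
have [->//|st1] := eqVneq t s.
have {st1}lst : s < t by rewrite lt_neqAle eq_sym st1.
have [|eta eta0 heta] := inc s; first by rewrite s0.
pose r := Num.min eta (t - s).
have r0 : 0 < r by rewrite /r lt_min eta0 subr_gt0.
have rt : s + r <= t by rewrite addrC -lerBrDr /r ge_min lexx orbT.
have re : 0 < r <= eta by rewrite r0 /r ge_min lexx.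
have := heta r re rt => h1.
have : A (s + r).
  split; first by rewrite rt addr_ge0 // ltW.
  by rewrite mulrDr; lra.
by move=> /(ub_le_sup hA.2); rewrite -/s gerDl leNgt r0.
Qed.

(** * Uniqueness of the limit *)

Section Comparison.
Context {R : realType} {d : nat}.
Local Notation E := 'rV[R]_d.
Implicit Types (x y : E) (f g u v : E -> R) (K : set E) (n k l : nat).

Variables (kappa : E -> R) (I : nat -> (E -> R) -> (E -> R)) (h : nat -> R).
Variables (w L : R) (G : (E -> R) -> (E -> R)).
Hypothesis hkappa : weight kappa.
Hypothesis sc : scheme kappa I h w L G.

Local Notation C := (Ckappa kappa).
Local Notation kle := (kle kappa).
Local Notation J n k f := (iter k (I n) f).

Let h0 n : 0 < h n := sc_h_gt0 sc n.
Let w0 : 0 <= w := sc_w_ge0 sc.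
Let L0 : 0 <= L := sc_L_ge0 sc.

Variables F1 F2 : set_system nat.
Hypothesis FU1 : UltraFilter F1.
Hypothesis Foo1 : \oo `<=` F1.
Hypothesis FU2 : UltraFilter F2.
Hypothesis Foo2 : \oo `<=` F2.
Local Notation S1 := (ulim I h F1).
Local Notation S2 := (ulim I h F2).

Lemma averaging_lipbr (b r : R) M f : averaging b M -> lipbr r f -> lipbr r (M f).
Proof.
move=> aM lf; split; first exact: averaging_lipschitz aM lf.1.
by move=> y; apply: (averaging_norm aM lf.1) => z _; exact: lf.2.
Qed.

(** The cost per unit of time of commuting an averaging operator of radius [b]
    with the semigroup. *)
Definition rate (t r b : R) : R :=
  expR (w * t) * (L * (expR ((w + L) * t) * r) * b * expR ((w + L) * t)).

(** The smooth function [v] is moved by both limits along the same generator;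
    exchanging one for the other costs [o(z)], and commuting [M] with the
    second limit costs a multiple of [b * z]. *)
Lemma exchange_step (b r t s : R) M f x (e : R) : 0 <= b ->
  averaging b M -> (forall u, Lipb u -> Cb_infty (M u)) -> lipbr r f ->
  0 <= s < t -> 0 < e ->
  exists2 eta, 0 < eta & forall z, 0 < z <= eta -> s + z <= t ->
    S1 (t - s) (M (S2 s f)) x <=
    S1 (t - (s + z)) (M (S2 (s + z) f)) x + (rate t r b + e) * z.
Proof.
move=> b0 aM sM lf /andP[s0 st] e0; have t0 : 0 <= t := le_trans s0 (ltW st).
have r0 := lipbr_ge0 lf; have Cf := lipbr_Ckappa hkappa lf.
set r' := expR ((w + L) * t) * r.
have lu (q : R) : 0 <= q <= t -> lipbr r' (S2 q f).
  move=> /andP[q0 qt]; apply: lipbrW (ulim_lipbr hkappa sc FU2 q0 lf).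
  by rewrite ler_wpM2r // ler_expR ler_wpM2l ?addr_ge0.
have lus : lipbr r' (S2 s f) by apply: lu; rewrite s0 ltW.
have r'0 := lipbr_ge0 lus.
set v := M (S2 s f).
have sv : Cb_infty v by exact/sM/(lipbr_Lipb lus).
have lv : lipbr r' v := averaging_lipbr aM lus.
have Cv := lipbr_Ckappa hkappa lv.
have [D D0 hD] := sc_smooth sc sv.
pose c := 2 * (D * expR (w * t)).
have [K' [delta [cK' d0 He]]] :=
  ulim_tight hkappa sc FU1 t c (@compact_set1 _ x) e0.
have d2 : 0 < delta / 2 by rewrite divr_gt0.
have [eta1 eta10 ex1] := ulim_expand hkappa sc FU1 Foo1 sv cK' d2.
have [eta2 eta20 ex2] := ulim_expand hkappa sc FU2 Foo2 sv cK' d2.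
exists (Num.min eta1 eta2); first by rewrite lt_min eta10.
move=> z /andP[z0]; rewrite le_min => /andP[z1 z2] szt.
have zt : z <= t by rewrite (le_trans _ szt) // lerDr.
have z0' := ltW z0.
have C1 := ulim_Ckappa hkappa sc FU1 z0' Cv.
have C2 := ulim_Ckappa hkappa sc FU2 z0' Cv.
pose W : E -> R := z^-1 *: (S1 z v - S2 z v).
have CW : C W by apply: CkappaZ => //; exact: CkappaB.
have WE y : S1 z v y = S2 z v y + z * W y.
  have -> : W y = z^-1 * (S1 z v y - S2 z v y) by [].
  by rewrite mulrA mulfV ?gt_eqF // mul1r addrC subrK.
have kW : kle c W.
  move=> y; have k1 := ulim_time_smooth hkappa sc FU1 z0' Cv D0 hD y.
  have k2 := ulim_time_smooth hkappa sc FU2 z0' Cv D0 hD y.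
  have -> : W y = z^-1 * (S1 z v y - S2 z v y) by [].
  rewrite normrM gtr0_norm ?invr_gt0 // mulrC ler_pdivrMr //.
  have -> : S1 z v y - S2 z v y = (S1 z v - v) y - (S2 z v - v) y.
    by rewrite !fctE; lra.
  rewrite (le_trans (ler_normB _ _)) // (le_trans (lerD k1 k2)) //.
  have -> : c / kappa y * z = 2 * (D * z * expR (w * t) / kappa y).
    by rewrite /c; ring.
  have ew : D * z * expR (w * z) / kappa y <= D * z * expR (w * t) / kappa y.
    rewrite ler_pM2r ?(kappaV_gt0 hkappa) // ler_wpM2l ?mulr_ge0 //.
    by rewrite ler_expR ler_wpM2l.
  lra.
have Wd y : K' y -> W y <= delta.
  move=> K'y; have := ex1 z _ y K'y; have := ex2 z _ y K'y.
  rewrite z0' z1 z2 => /(_ isT) i2 /(_ isT) i1.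
  have -> : W y = z^-1 * (S1 z v y - S2 z v y) by [].
  rewrite mulrC ler_pdivrMr //.
  move: i1 i2; rewrite !ler_norml => /andP[_ ?] /andP[? _]; lra.
set q := t - (s + z).
have q0 : 0 <= q by rewrite subr_ge0.
have qt : q <= t by rewrite lerBlDr lerDl addr_ge0.
have -> : t - s = q + z by rewrite /q; lra.
rewrite (ulim_add hkappa sc FU1 Foo1 q0 z0' Cv).
have szt' : 0 <= s + z <= t by rewrite addr_ge0.
have lsz := lu _ szt'; have lMsz := averaging_lipbr aM lsz.
have CM := lipbr_Ckappa hkappa lMsz.
pose c1 := L * r' * b * expR ((w + L) * t) * z.
have c10 : 0 <= c1.
  by rewrite /c1 mulr_ge0 // mulr_ge0 ?expR_ge0 // !mulr_ge0.
have Cc1 : C (cst c1) := Ckappa_cst hkappa c1.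
have CzW : C (z *: W) := CkappaZ hkappa z CW.
have Cu : C (cst c1 + z *: W) := CkappaD hkappa Cc1 CzW.
have s2v y : S2 z v y <= M (S2 (s + z) f) y + c1.
  have := ulim_averaging hkappa sc FU2 y z0' b0 aM lus.
  rewrite -(ulim_add hkappa sc FU2 Foo2 z0' s0 Cf) (addrC z s) => /le_trans; apply.
  rewrite lerD2l /c1 ler_wpM2r // ler_wpM2l ?mulr_ge0 //.
  by rewrite ler_expR ler_wpM2l ?addr_ge0.
have b1 := ulim_le_add hkappa sc FU1 q0 C1 CM Cu _ x.
have b2 := ulim_le_add hkappa sc FU1 q0 Cu Cc1 CzW (fun y => lexx _) x.
have b3 := ulim_le_cst hkappa sc FU1 q0 Cc1 c10 (fun y => lexx _) x.
have b4 : S1 q (z *: W) x <= z * e.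
  rewrite (ulim_hom hkappa sc FU1 q0 CW z0') -[X in X <= _]/(z * S1 q W x).
  by rewrite ler_pM2l //; apply: (He q W) => //; rewrite q0.
apply: le_trans (b1 _) _.
  move=> y; rewrite WE -[(cst c1 + z *: W) y]/(c1 + z * W y) addrA lerD2r.
  exact: s2v.
rewrite lerD2l (le_trans b2) // mulrDl lerD //; last by rewrite mulrC.
rewrite (le_trans b3) // (@le_trans _ _ (expR (w * t) * c1)) //.
  by rewrite ler_wpM2r // ler_expR ler_wpM2l.
by rewrite /c1 /rate -/r' !mulrA.
Qed.

Lemma averaging_dist_kle (b c r r' : R) M u v : b <= 1 -> averaging b M ->
  lipschitz_fun r u -> lipschitz_fun r' v -> kle c (u - v) ->
  forall m, (forall x y, enorm y <= 1 -> (kappa (x + y))^-1 <= m / kappa x) ->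
  kle (c * m) (M u - M v).
Proof.
move=> b1 aM lu lv kuv m hm x.
have := averaging_linear (-1) x aM lv lu; rewrite mulN1r (addrC (- M v x)) => e.
rewrite -[(M u - M v) x]/(M u x - M v x) -e.
apply: (averaging_norm aM (lipschitzD (lipschitzZ _ lv) lu)) => y yb.
have -> : (-1 *: v + u) (x + y) = (u - v) (x + y).
  by rewrite -[LHS]/(-1 * v (x + y) + u (x + y)) mulN1r addrC.
rewrite (le_trans (kuv _)) // -mulrA ler_wpM2l ?(kle_ge0 hkappa kuv) // hm //.
exact: le_trans (enorm_le_norm1 y) (le_trans yb b1).
Qed.

(** The first term of the difference is a change of the datum, uniformly small
    in the weighted norm because [M] preserves weighted bounds
    ([averaging_dist_kle]); the second is a change of time at the fixed smooth
    function [v]. *)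
Lemma exchange_continuous (b r t s : R) M f x (e : R) : 0 <= b <= 1 ->
  averaging b M -> (forall u, Lipb u -> Cb_infty (M u)) ->
  Cb_infty f -> lipbr r f -> 0 <= s <= t -> 0 < e ->
  exists2 eta, 0 < eta & forall z, 0 <= z <= t -> `|z - s| <= eta ->
    `|S1 (t - z) (M (S2 z f)) x - S1 (t - s) (M (S2 s f)) x| <= e.
Proof.
move=> /andP[b0 b1] aM sM sf lf /andP[s0 st] e0.
have Cf := lipbr_Ckappa hkappa lf.
have lus := ulim_lipbr hkappa sc FU2 s0 lf.
set v := M (S2 s f).
have sv : Cb_infty v by exact/sM/(lipbr_Lipb lus).
have lv := averaging_lipbr aM lus.
have Cv := lipbr_Ckappa hkappa lv.
have [D D0 hD] := sc_smooth sc sf.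
have [D' D'0 hD'] := sc_smooth sc sv.
have [m m1 hm] := kappa_shift hkappa.
pose a := expR (w * t).
have a0 : 0 < a by exact: expR_gt0.
have m0 : 0 < m := lt_le_trans ltr01 m1.
pose Q := (a * (D * a * a * m) + D' * a * a) / kappa x + 1.
have Q0 : 0 < Q.
  rewrite ltr_wpDl // mulr_ge0 //; last exact/ltW/kappaV_gt0.
  by rewrite addr_ge0 // !mulr_ge0 // ltW.
exists (e / Q); first by rewrite divr_gt0.
move=> z /andP[z0 zt] zs.
have luz := ulim_lipbr hkappa sc FU2 z0 lf.
have zst : 0 <= s <= t by rewrite s0.
have zzt : 0 <= z <= t by rewrite z0.
have k1 := ulim_time_lipschitz hkappa sc FU2 Foo2 Cf D0 hD zzt zst.
have k2 := averaging_dist_kle b1 aM luz.1 lus.1 k1 hm.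
have tz0 : 0 <= t - z by rewrite subr_ge0.
have ts0 : 0 <= t - s by rewrite subr_ge0.
have CMz := lipbr_Ckappa hkappa (averaging_lipbr aM luz).
have k3 := ulim_dist_kle hkappa sc FU1 tz0 CMz Cv k2.
have tzt : 0 <= t - z <= t by rewrite tz0 lerBlDr lerDl.
have tst : 0 <= t - s <= t by rewrite ts0 lerBlDr lerDl.
have k4 := ulim_time_lipschitz hkappa sc FU1 Foo1 Cv D'0 hD' tzt tst.
have E1 : `|t - z - (t - s)| = `|z - s|.
  by rewrite -normrN; congr `|_|; lra.
rewrite E1 in k4.
rewrite (le_trans (ler_distD (S1 (t - z) v x) _ _)) //.
apply: le_trans (lerD (k3 x) (k4 x)) _.
have az : expR (w * (t - z)) <= a.
  by rewrite ler_expR ler_wpM2l //; case/andP: tzt.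
rewrite -mulrDl.
have P0 : 0 <= D * a * a * `|z - s| * m.
  by rewrite !mulr_ge0 // ltW.
apply: (@le_trans _ _ (Q * `|z - s|)); last by rewrite mulrC -ler_pdivlMr.
apply: (@le_trans _ _ ((a * (D * a * a * `|z - s| * m) + D' * a * a * `|z - s|) / kappa x)).
  by rewrite ler_pM2r ?(kappaV_gt0 hkappa) // lerD2r ler_wpM2r.
have -> : (a * (D * a * a * `|z - s| * m) + D' * a * a * `|z - s|) / kappa x =
  (a * (D * a * a * m) + D' * a * a) / kappa x * `|z - s| by ring.
by rewrite ler_wpM2r // lerDl.
Qed.

(** By [exchange_step] the function [s |-> S1 (t - s) (M (S2 s f)) x] increases
    from [S1 t (M f) x] to [M (S2 t f) x] up to an error of order [b], the
    radius of [M], which is arbitrary. *)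
Lemma ulim_unique_le_smooth (t r : R) f x : 0 <= t -> Cb_infty f -> lipbr r f ->
  S1 t f x <= S2 t f x.
Proof.
move=> t0 sf lf; have r0 := lipbr_ge0 lf; have Cf := lipbr_Ckappa hkappa lf.
pose a := expR ((w + L) * t).
have a0 : 0 <= a by exact: expR_ge0.
pose Q := expR (w * t) * (L * (a * r) * a) * t + expR (w * t) * r + a * r + 1.
have Q0 : 0 < Q by rewrite ltr_wpDl // !addr_ge0 // !mulr_ge0 // expR_ge0.
apply/ler_addgt0Pr => e e0.
pose b := Num.min 1 (e / Q).
have b0 : 0 < b by rewrite /b lt_min ltr01 divr_gt0.
have b1 : b <= 1 by rewrite /b ge_min lexx.
have b01 : 0 <= b <= 1 by rewrite ltW.
have [M aM sM] := @smoothing_averaging_exists R d b b0.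
have main : S1 t (M f) x <= M (S2 t f) x + rate t r b * t.
  apply/ler_addgt0Pr => e1 e10.
  have t1 : 0 < t + 1 by rewrite ltr_wpDl.
  have e1t : 0 < e1 / (t + 1) by rewrite divr_gt0.
  have := @right_increase_le R (fun s => S1 (t - s) (M (S2 s f)) x) t
    (rate t r b + e1 / (t + 1)) t0.
  rewrite subr0 subrr !ulim0 => H; apply: le_trans (H _ _) _.
  - by move=> s s0t; apply: exchange_step => //; exact: ltW.
  - by move=> s e2 s0t e20; exact: (exchange_continuous x b01 aM sM sf lf s0t e20).
  rewrite mulrDl addrA lerD2l mulrAC ler_pdivrMr // ler_wpM2l ?ltW //.
  by rewrite ltrDl.
have lS := ulim_lipbr hkappa sc FU2 t0 lf.
have n1 := averaging_near x (lipbr_ge0 lS) aM lS.1.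
have n2 : S1 t f x <= S1 t (M f) x + expR (w * t) * (r * b).
  have CM := lipbr_Ckappa hkappa (averaging_lipbr aM lf).
  have Cc := Ckappa_cst hkappa (r * b).
  have rb : 0 <= r * b by rewrite mulr_ge0 // ltW.
  apply: le_trans (ulim_le_add hkappa sc FU1 t0 Cf CM Cc _ x) _.
    move=> y; have := averaging_near y r0 aM lf.1.
    by rewrite ler_distlC => /andP[_].
  by rewrite lerD2l; apply: (ulim_le_cst hkappa sc FU1 t0 Cc rb) => y.
move: n1; rewrite ler_norml => /andP[_ n1].
have bQ : Q * b <= e by rewrite mulrC -ler_pdivlMr // /b ge_min lexx orbT.
move: main n2 n1 bQ; rewrite /rate -/a /Q => main n2 n1 bQ.
have b0' := ltW b0.
lra.
Qed.

Lemma ulim_unique_le (t : R) f : 0 <= t -> C f -> fle (S1 t f) (S2 t f).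
Proof.
move=> t0 Cf x; apply/ler_addgt0Pr => e e0.
have [_ [c hc]] := (CkappaP hkappa f).1 Cf.
have [c' hd] := smooth_dense hkappa Cf hc.
have e2 : 0 < e / 2 by rewrite divr_gt0.
have [K1 [d1 [cK1 d10 H1]]] :=
  ulim_tight hkappa sc FU1 t (c + c') (@compact_set1 _ x) e2.
have [K2 [d2 [cK2 d20 H2]]] :=
  ulim_tight hkappa sc FU2 t (c + c') (@compact_set1 _ x) e2.
have cK : compact (K1 `|` K2) by exact: compactU.
have d0 : 0 < Num.min d1 d2 by rewrite lt_min d10.
have [g [sg [r lg] gc fg]] := hd _ _ cK d0.
have Cg := Cb_infty_Ckappa hkappa sg.
have tt : 0 <= t <= t by rewrite t0 lexx.
have a1 : S1 t f x <= S1 t g x + e / 2.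
  apply: le_trans (ulim_le_add hkappa sc FU1 t0 Cf Cg (CkappaB hkappa Cf Cg)
    (le_add_diff f g) x) _.
  rewrite lerD2l; apply: (H1 t) => //; [exact: CkappaB|exact: kleB|].
  move=> y K1y; have := fg y (or_introl K1y); rewrite le_min => /andP[+ _].
  by apply: le_trans; rewrite ler_norm.
have a2 : S2 t g x <= S2 t f x + e / 2.
  apply: le_trans (ulim_le_add hkappa sc FU2 t0 Cg Cf (CkappaB hkappa Cg Cf)
    (le_add_diff g f) x) _.
  rewrite lerD2l; apply: (H2 t) => //; [exact: CkappaB| |].
    by rewrite addrC; exact: kleB.
  move=> y K2y; have := fg y (or_intror K2y); rewrite le_min => /andP[_].
  by rewrite distrC; apply: le_trans; rewrite ler_norm.
have a3 := ulim_unique_le_smooth x t0 sg lg; lra.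
Qed.

End Comparison.

(** * Convergence in the mixed topology *)

Section MixedConvergence.
Context {R : realType} {d : nat}.
Local Notation E := 'rV[R]_d.
Implicit Types (x y : E) (f g : E -> R) (u : nat -> E -> R) (K : set E).

Lemma ereal_cvg0 (a : nat -> \bar R) :
  (forall e : R, 0 < e -> \forall n \near \oo, (0 <= a n <= e%:E)%E) ->
  a n @[n --> \oo] --> 0%E.
Proof.
move=> H; apply/fine_cvgP; split.
  apply: filterS (H 1 ltr01) => n /andP[a0 a1].
  by rewrite ge0_fin_numE // (le_lt_trans a1) // ltry.
apply/cvgrPdist_le => e e0; apply: filterS (H e e0) => n /andP[an0 ane].
have fan : a n \is a fin_num by rewrite ge0_fin_numE // (le_lt_trans ane) // ltry.
rewrite sub0r normrN ger0_norm ?fine_ge0 //.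
by rewrite -lee_fin fineK.
Qed.

Lemma ereal_cvg0P (a : nat -> \bar R) : a n @[n --> \oo] --> 0%E ->
  forall e : R, 0 < e -> \forall n \near \oo, (a n <= e%:E)%E.
Proof.
move=> /fine_cvgP[fa ca] e e0.
have /cvgrPdist_le/(_ e e0) := ca; apply: filterS2 fa => n fan.
rewrite /= sub0r normrN => h.
by rewrite -(fineK fan) lee_fin (le_trans (ler_norm _)).
Qed.

Lemma supnorm_ge0 K f : (0 <= supnorm K f)%E.
Proof. by apply: ereal_sup_ubound; left. Qed.

Lemma supnorm_le K f (e : R) : 0 <= e ->
  (forall x, K x -> `|f x| <= e) -> (supnorm K f <= e%:E)%E.
Proof.
move=> e0 fe; apply: ge_ereal_sup => _ [->|[x Kx <-]]; rewrite lee_fin //.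
exact: fe.
Qed.

Lemma supnorm_ge K f x : K x -> (`|f x|%:E <= supnorm K f)%E.
Proof. by move=> Kx; apply: ereal_sup_ubound; right; exists x. Qed.

Lemma supnorm_leP K f (e : R) : (supnorm K f <= e%:E)%E ->
  forall x, K x -> `|f x| <= e.
Proof.
by move=> fe x Kx; rewrite -lee_fin (le_trans (supnorm_ge f Kx)).
Qed.

Variable kappa : E -> R.
Hypothesis hkappa : weight kappa.
Local Notation C := (Ckappa kappa).
Local Notation kle := (kle kappa).

Lemma mixed_cvg_intro u f (c : R) : (forall n, C (u n)) -> C f ->
  (forall n, kle c (u n)) ->
  (forall K e, compact K -> 0 < e ->
    \forall n \near \oo, forall x, K x -> `|u n x - f x| <= e) ->
  mixed_cvg kappa u f.
Proof.
move=> Cu Cf cu H; split=> //.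
  apply: (@le_lt_trans _ _ c%:E); last exact: ltry.
  by apply: ge_ereal_sup => _ [n _ <-]; exact/(wnorm_kleP hkappa).
move=> K cK; apply: ereal_cvg0 => e e0; apply: filterS (H K e cK e0) => n hn.
rewrite supnorm_ge0 /= supnorm_le ?(ltW e0) // => x Kx.
by rewrite !fctE distrC hn.
Qed.

Lemma mixed_cvg_pointwise u f x : mixed_cvg kappa u f ->
  u n x @[n --> \oo] --> f x.
Proof.
move=> [_ _ _ /(_ [set x] (@compact_set1 _ x)) h].
apply/cvgrPdist_le => e e0; apply: filterS (ereal_cvg0P h e0) => n hn.
exact: (supnorm_leP hn).
Qed.

Lemma mixed_cvg_kle u f : mixed_cvg kappa u f -> exists c, forall n, kle c (u n).
Proof.
move=> [_ _ + _]; set s := ereal_sup _ => sy.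
have s0 : (0 <= s)%E.
  apply: (le_trans (wnorm_ge0 hkappa (u 0%N))).
  by apply: ereal_sup_ubound; exists 0%N.
exists (fine s) => n; apply/(wnorm_kleP hkappa).
rewrite fineK ?ge0_fin_numE //; apply: ereal_sup_ubound; by exists n.
Qed.

Lemma mixed_cvg_eventually u u' f : (forall n, C (u' n)) ->
  (\forall n \near \oo, u' n = u n) -> mixed_cvg kappa u f -> mixed_cvg kappa u' f.
Proof.
move=> Cu' [N _ eN] uf; have [c hc] := mixed_cvg_kle uf.
have /choice[b hb] : forall n, exists b, kle b (u' n).
  by move=> n; have [_ ?] := (CkappaP hkappa (u' n)).1 (Cu' n).
have c0 := kle_ge0 hkappa (hc 0%N).
have b0 n := kle_ge0 hkappa (hb n).
have [_ Cf _ uK] := uf.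
split=> //; last first.
  move=> K cK; apply: cvg_trans (uK K cK); apply: near_eq_cvg.
  by exists N => // n Nn; rewrite eN.
apply: (@le_lt_trans _ _ (c + \sum_(i < N) b i)%:E); last exact: ltry.
apply: ge_ereal_sup => _ [n _ <-]; apply/(wnorm_kleP hkappa).
have [nN|Nn] := ltnP n N.
  apply: (kleW hkappa _ (hb n)); rewrite (bigD1 (Ordinal nN)) //= addrCA.
  by rewrite lerDl addr_ge0 // sumr_ge0.
rewrite eN //; apply: (kleW hkappa _ (hc n)); rewrite lerDl.
by apply: sumr_ge0.
Qed.

End MixedConvergence.

(** * Convergence of schemes *)

Section SchemeLimit.
Context {R : realType} {d : nat}.
Local Notation E := 'rV[R]_d.
Implicit Types (x y : E) (f g u v : E -> R) (K : set E) (n k l : nat).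

Variables (kappa : E -> R) (I : nat -> (E -> R) -> (E -> R)) (h : nat -> R).
Variables (w L : R) (G : (E -> R) -> (E -> R)).
Hypothesis hkappa : weight kappa.
Hypothesis sc : scheme kappa I h w L G.

Local Notation C := (Ckappa kappa).
Local Notation kle := (kle kappa).
Local Notation J n k f := (iter k (I n) f).

Let h0 n : 0 < h n := sc_h_gt0 sc n.
Let w0 : 0 <= w := sc_w_ge0 sc.

Variable F : set_system nat.
Hypothesis FU : UltraFilter F.
Hypothesis Foo : \oo `<=` F.
Local Notation S := (ulim I h F).

(** A sequence that does not converge to the limit along [F] stays away from it
    along some other ultrafilter, which [ulim_unique_le] excludes. *)
Lemma steps_limit (t : R) f x : 0 <= t -> C f ->
  J n (steps h t n) f x @[n --> \oo] --> S t f x.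
Proof.
move=> t0 Cf; apply/cvgrPdist_le => e e0; apply: contrapT => nA.
pose A := [set n | `|S t f x - J n (steps h t n) f x| <= e].
have PF : ProperFilter (within (~` A) \oo).
  apply: Build_ProperFilter_ex => B; rewrite /within /= => hB.
  apply: contrapT => nB; apply: nA; apply: filterS hB => n hn.
  by apply: contrapT => nAn; apply: nB; exists n; exact: hn.
have [H [HU sH]] := ultraFilterLemma PF.
have Hoo : \oo `<=` H.
  by move=> B hB; apply: sH; apply: filterS hB => n Bn _.
have ST : S t f = ulim I h H t f.
  apply: funext => y; apply/eqP; rewrite eq_le.
  rewrite (ulim_unique_le hkappa sc FU Foo HU Hoo t0 Cf).
  exact: (ulim_unique_le hkappa sc HU Hoo FU Foo t0 Cf).
have HP : ProperFilter H := @ultra_proper _ H HU.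
have /cvgrPdist_le/(_ e e0) := ulim_cvg hkappa sc HU x t0 Cf.
rewrite -ST => HA.
have HnA : H (~` A) by apply: sH; apply: nearW.
by have [n [An nAn]] := filter_ex (filterI HA HnA).
Qed.

Arguments steps_limit [t f] x _ _.

Lemma steps_limit_uniform (t : R) f K (e : R) : 0 <= t -> C f -> compact K ->
  0 < e -> \forall n \near \oo, forall x, K x ->
    `|J n (steps h t n) f x - S t f x| <= e.
Proof.
move=> t0 Cf cK e0; apply: (steps_uniform hkappa sc) => //.
  exact: (ulim_continuous hkappa sc FU).
by move=> x; exact: steps_limit.
Qed.

(** Two step counts with the same limiting time differ by a short time, over
    which [iterate_time_continuous] applies. *)
Lemma chernoff_limit (t : R) f (k : nat -> nat) : 0 <= t -> C f ->
  (k n)%:R * h n @[n --> \oo] --> t ->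
  mixed_cvg kappa (fun n => J n (k n) f) (S t f).
Proof.
move=> t0 Cf kt; have [_ [c hc]] := (CkappaP hkappa f).1 Cf.
have [b hb] : exists b, forall n, (k n)%:R * h n <= b.
  have /bounded_funP[b hb] := cvg_seq_bounded (cvgP _ kt).
  by exists b => n; rewrite (le_trans (ler_norm _)).
apply: (@mixed_cvg_intro _ _ _ hkappa _ _ (expR (w * b) * c)).
- by move=> n; exact: (iterate_Ckappa sc).
- exact: (ulim_Ckappa hkappa sc FU).
- move=> n; apply: (kleW hkappa _ (iterate_kle sc n (k n) Cf hc)).
  by rewrite ler_wpM2r ?(kle_ge0 hkappa hc) // ler_expR ler_wpM2l.
move=> K e cK e0; have e2 : 0 < e / 2 by rewrite divr_gt0.
have [delta d0 Jt] := iterate_time_continuous hkappa sc (t + 1) Cf cK e2.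
have d3 : 0 < Num.min 1 (delta / 2) by rewrite lt_min ltr01 divr_gt0.
have n1 := steps_limit_uniform t0 Cf cK e2.
have /cvgrPdist_le/(_ _ d3) n2 := kt.
have n3 := h_small sc d3.
apply: filterS3 n1 n2 n3 => n; rewrite !le_min.
move=> H1 /andP[k1 k2] /andP[h1 h2] x Kx.
have := steps_le sc n t0; have := steps_gt sc t n => s2 s1.
move: k1 k2; rewrite !ler_distlC => /andP[k1 k1'] /andP[k2 k2'].
have H2 : `|J n (k n) f x - J n (steps h t n) f x| <= e / 2.
  have [ks|/ltnW sk] := leqP (k n) (steps h t n).
    rewrite distrC -(subnKC ks); apply: Jt => //; rewrite ?(subnKC ks); first lra.
    rewrite natrB // mulrBl; lra.
  rewrite -(subnKC sk); apply: Jt => //; rewrite ?(subnKC sk); first lra.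
  rewrite natrB // mulrBl; lra.
have := H1 x Kx; move: H2; rewrite !ler_norml.
move=> /andP[? ?] /andP[? ?]; apply/andP; split; lra.
Qed.

Lemma right0_bounded (s : nat -> R) : s n @[n --> \oo] --> (0 : R) ->
  exists2 b, 0 <= b & forall n, s n <= b.
Proof.
move=> s0; have /bounded_funP[b hb] := cvg_seq_bounded (cvgP _ s0).
exists b; first exact: le_trans (normr_ge0 _) (hb 0%N).
by move=> n; rewrite (le_trans (ler_norm _)).
Qed.

Lemma right0_near (s : nat -> R) (e : R) : (forall n, 0 < s n) ->
  s n @[n --> \oo] --> (0 : R) -> 0 < e -> \forall n \near \oo, 0 <= s n <= e.
Proof.
move=> sp s0 e0; have /cvgrPdist_le/(_ e e0) := s0.
by apply: filterS => n; rewrite sub0r normrN gtr0_norm // => ->; rewrite ltW.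
Qed.

Lemma ulim_generator f : Cb_infty f -> generator_graph kappa S f (G f).
Proof.
move=> sf s sp s0; have Cf := Cb_infty_Ckappa hkappa sf.
have [D D0 hD] := sc_smooth sc sf.
have [b b0 hb] := right0_bounded s0.
apply: (@mixed_cvg_intro _ _ _ hkappa _ _ (D * expR (w * b))).
- move=> n; apply: CkappaZ => //; apply: CkappaB => //.
  by apply: (ulim_Ckappa hkappa sc FU) => //; exact: ltW.
- exact: (generator_Ckappa hkappa sc).
- move=> n x; have hS := ulim_time_smooth hkappa sc FU (ltW (sp n)) Cf D0 hD x.
  rewrite -[((s n)^-1 *: _) x]/((s n)^-1 * (S (s n) f x - f x)).
  rewrite normrM gtr0_norm ?invr_gt0 // mulrC ler_pdivrMr //; apply: (le_trans hS).
  have -> : D * expR (w * b) / kappa x * s n = D * s n * expR (w * b) / kappa x.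
    by ring.
  rewrite ler_pM2r ?(kappaV_gt0 hkappa) // ler_wpM2l ?mulr_ge0 //; first exact: ltW.
  by rewrite ler_expR ler_wpM2l.
move=> K e cK e0; have [delta d0 H] := ulim_expand hkappa sc FU Foo sf cK e0.
apply: filterS (right0_near sp s0 d0) => n sn x Kx.
have := H (s n) sn x Kx.
have -> : ((s n)^-1 *: (S (s n) f - f)) x - G f x =
  (s n)^-1 * (S (s n) f x - f x - s n * G f x).
  rewrite -[((s n)^-1 *: _) x]/((s n)^-1 * (S (s n) f x - f x)).
  by rewrite [RHS]mulrBr mulrA mulVf ?gt_eqF // mul1r.
by move=> hS; rewrite normrM gtr0_norm ?invr_gt0 // mulrC ler_pdivrMr.
Qed.

Lemma ulim_semigroup : convex_monotone_semigroup kappa S.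
Proof.
split.
- by move=> t f t0 Cf; exact: (ulim_Ckappa hkappa sc FU).
- move=> t f g lam t0 Cf Cg /andP[l0 l1] x.
  have l1' : 0 <= 1 - lam by rewrite subr_ge0.
  have Clf := CkappaZ hkappa lam Cf; have Clg := CkappaZ hkappa (1 - lam) Cg.
  have := ulim_le_add hkappa sc FU t0 (CkappaD hkappa Clf Clg) Clf Clg (fun y => lexx _) x.
  by rewrite !(ulim_hom hkappa sc FU).
- by move=> t f g t0 Cf Cg; exact: (ulim_mono hkappa sc FU).
- move=> t u t0 Cu ud.
  have u_ge0 n x : 0 <= u n x.
    have [un uc] := ud x; have := nonincreasing_cvgn_ge un (cvgP _ uc) n.
    by rewrite (cvg_lim (@Rhausdorff R) uc).
  have C0 : C (0 : E -> R) := Ckappa0 hkappa.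
  have S0 : S t (0 : E -> R) = 0.
    have := ulim_hom hkappa sc FU t0 C0 (lexx 0).
    by rewrite !scale0r.
  have S_ge0 n x : 0 <= S t (u n) x.
    have := ulim_mono hkappa sc FU t0 C0 (Cu n) (u_ge0 n) x.
    by rewrite S0.
  move=> x; split.
    move=> m n mn; apply: (ulim_mono hkappa sc FU) => // y.
    by have [un _] := ud y; exact: un.
  have [_ [c hc]] := (CkappaP hkappa (u 0%N)).1 (Cu 0%N).
  have uc n : kle c (u n).
    move=> y; have [un _] := ud y; rewrite ger0_norm //.
    rewrite (le_trans (un _ _ (leq0n n))) // (le_trans _ (hc y)) // ler_norm //.
  apply/cvgrPdist_le => e e0.
  have [K' [delta [cK' d0 H]]] := ulim_tight hkappa sc FU t c (@compact_set1 _ x) e0.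
  (* Tightness needs the sequence to be small uniformly on [K'], which monotone
     convergence of continuous functions provides. *)
  have dini : \forall n \near \oo, forall y, K' y -> u n y <= delta.
    apply: compact_cover_near => // y _.
    have [un /cvgrPdist_le] := ud y.
    have d2 : 0 < delta / 2 by rewrite divr_gt0.
    move=> /(_ _ d2)[N _ /(_ N (leqnn N))].
    rewrite /= sub0r normrN ger0_norm // => uN.
    have [cN _] := Cu N; have /continuousP_dist/(_ y _ d2) hN := cN.
    exists ([set z | `|u N z - u N y| <= delta / 2], [set n | (N <= n)%N]) => /=.
      by split => //; exists N.
    move=> [z n] [/= hz Nn]; have [uz _] := ud z.
    rewrite (le_trans (uz _ _ Nn)) //.
    move: hz; rewrite ler_distl => /andP[_ ?]; lra.
  apply: filterS dini => n hn; rewrite sub0r normrN ger0_norm //.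
  by apply: (H t) => //; rewrite t0 lexx.
- by move=> f _; exact: ulim0.
- by move=> s t f s0 t0 Cf; exact: (ulim_add hkappa sc FU Foo).
- move=> r T r0 T0.
  have cr : continuous (fun x => r / kappa x).
    move=> x; apply: (@cvgM _ _ (nbhs x) _ (fun=> r) (fun x => (kappa x)^-1)).
      exact: cst_continuous.
    exact: kappaV_continuous.
  have kr : kle r (fun x => r / kappa x).
    by move=> x; rewrite ger0_norm // mulr_ge0 // ltW // kappaV_gt0.
  have Cr : C (fun x => r / kappa x) by apply/(CkappaP hkappa); split; [|exists r].
  apply: (@le_lt_trans _ _ (expR (w * T) * r)%:E); last exact: ltry.
  apply: ge_ereal_sup => _ [t /andP[t0 tT] <-]; apply/(wnorm_kleP hkappa).
  apply: (kleW hkappa _ (ulim_kle hkappa sc FU t0 Cr kr)).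
  by rewrite ler_wpM2r // ler_expR ler_wpM2l.
- move=> f Cf s sp s0; have [b b0 hb] := right0_bounded s0.
  have [_ [c hc]] := (CkappaP hkappa f).1 Cf.
  apply: (@mixed_cvg_intro _ _ _ hkappa _ _ (expR (w * b) * c)) => //.
  + by move=> n; apply: (ulim_Ckappa hkappa sc FU) => //; exact: ltW.
  + move=> n; apply: (kleW hkappa _ (ulim_kle hkappa sc FU (ltW (sp n)) Cf hc)).
    by rewrite ler_wpM2r ?(kle_ge0 hkappa hc) // ler_expR ler_wpM2l.
  move=> K e cK e0; have [delta d0 H] := ulim_right_continuous hkappa sc FU Cf cK e0.
  by apply: filterS (right0_near sp s0 d0) => n sn x Kx; exact: H.
Qed.

End SchemeLimit.

Lemma generator_unique {R : realType} {d : nat} (kappa : 'rV[R]_d -> R) S f g g' :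
  generator_graph kappa S f g -> generator_graph kappa S f g' -> g = g'.
Proof.
move=> fg fg'; apply: funext => x.
pose s (n : nat) : R := n.+1%:R^-1.
have sp n : 0 < s n by rewrite invr_gt0 ltr0n.
have s0 : s n @[n --> \oo] --> (0 : R) by exact: cvg_harmonic.
exact: (cvg_unique (@Rhausdorff R) (mixed_cvg_pointwise (x := x) (fg s sp s0))
  (mixed_cvg_pointwise (x := x) (fg' s sp s0))).
Qed.

Lemma scheme_convergence {R : realType} {d : nat} (kappa : 'rV[R]_d -> R)
  I h (w L : R) G : weight kappa -> scheme kappa I h w L G ->
  exists S : R -> ('rV[R]_d -> R) -> ('rV[R]_d -> R),
    [/\ convex_monotone_semigroup kappa S,
        forall f (t : R) k, Ckappa kappa f -> 0 <= t ->
          (k n)%:R * h n @[n --> \oo] --> t ->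
          mixed_cvg kappa (fun n => iter (k n) (I n) f) (S t f) &
        forall f, Cb_infty f -> generator_graph kappa S f (G f)].
Proof.
move=> hkappa sc; have [F [FU Foo]] := ultraFilterLemma (@eventually_filter).
exists (ulim I h F); split.
- exact: (ulim_semigroup hkappa sc).
- by move=> f t k Cf t0 kt; exact: (chernoff_limit hkappa sc).
- by move=> f sf; exact: (ulim_generator hkappa sc).
Qed.

(** * Pointwise suprema *)

Section Suprema.
Context {R : realType} {d : nat} {Theta : Type}.
Local Notation E := 'rV[R]_d.
Implicit Types (F H : Theta -> E -> R).
Hypothesis hTheta : inhabited Theta.

Lemma psup_le F x (b : R) : (forall th, F th x <= b) -> psup F x <= b.
Proof.
move=> Fb; have [th] := hTheta; apply: ge_sup; first by exists (F th x); exists th.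
by move=> _ [th' _ <-].
Qed.

Lemma psup_ge F x (b : R) th : (forall th, F th x <= b) -> F th x <= psup F x.
Proof.
move=> Fb; apply: ub_le_sup; last by exists th.
by exists b => _ [th' _ <-].
Qed.

Lemma psup_norm F x (b : R) : (forall th, `|F th x| <= b) -> `|psup F x| <= b.
Proof.
move=> Fb; have Fb' th : F th x <= b := le_trans (ler_norm _) (Fb th).
have [th] := hTheta; rewrite ler_norml psup_le // andbT.
apply: le_trans (psup_ge th Fb'); by have := Fb th; rewrite ler_norml => /andP[].
Qed.

Lemma psup_dist F H x y (b b' e : R) : (forall th, F th x <= b) ->
  (forall th, H th y <= b') -> (forall th, `|F th x - H th y| <= e) ->
  `|psup F x - psup H y| <= e.
Proof.
move=> Fb Hb FH; rewrite ler_distl lerBlDr; apply/andP; split.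
  apply: psup_le => th; have := psup_ge th Fb.
  have := FH th; rewrite ler_norml => /andP[? ?]; lra.
apply: psup_le => th; have := psup_ge th Hb.
have := FH th; rewrite ler_norml => /andP[? ?]; lra.
Qed.

End Suprema.

(** * The scheme of upper resolvents *)

Section Resolvents.
Context {R : realType} {d : nat} {Theta : Type}.
Local Notation E := 'rV[R]_d.
Implicit Types (x y : E) (f g u v : E -> R) (K : set E) (n k l : nat) (th : Theta).

Variables (kappa : E -> R) (A : Theta -> linop kappa) (omega : R).
Hypothesis hkappa : weight kappa.
Hypothesis hTheta : inhabited Theta.
Hypothesis hi : cond_i A omega.

Local Notation C := (Ckappa kappa).
Local Notation kle := (kle kappa).
Local Notation res lam th := (resolvent (A th) lam).

Definition step_size (lam : R) : R := (lam - omega)^-1.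
Local Notation h := step_size.
Local Notation w := `|omega|.

Lemma step_size_gt0 lam : omega < lam -> 0 < h lam.
Proof. by move=> ol; rewrite invr_gt0 subr_gt0. Qed.

Lemma step_sizeV lam : omega < lam -> (lam - omega) * h lam = 1.
Proof. by move=> ol; rewrite mulfV // gt_eqF // subr_gt0. Qed.

Lemma lam_step_le lam : omega < lam -> `|lam| * h lam <= expR (w * h lam).
Proof.
move=> ol; have h0 := step_size_gt0 ol.
have -> : `|lam| * h lam = `|1 + omega * h lam|.
  rewrite -[X in `|X + _|](step_sizeV ol) -mulrDl subrK normrM.
  by rewrite (gtr0_norm h0).
rewrite (le_trans (ler_normD _ _)) // normr1 normrM (gtr0_norm h0).
exact: expR_ge1Dx.
Qed.

Lemma resolvent_spec lam th f : omega < lam -> C f ->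
  dom (A th) (res lam th f) /\
  lam *: res lam th f - A th (res lam th f) = f.
Proof.
move=> ol Cf; have [[_ _ sj] _] := hi.1 th lam ol.
have [g dg gf] := sj f Cf.
have := @xgetPex _ (0 : E -> R) [set g | dom (A th) g /\ lam *: g - A th g = f].
by apply; exists g.
Qed.

Lemma resolvent_unique lam th f g : omega < lam -> C f ->
  dom (A th) g -> lam *: g - A th g = f -> res lam th f = g.
Proof.
move=> ol Cf dg gf; have [dr rf] := resolvent_spec th ol Cf.
have [[_ ij _] _] := hi.1 th lam ol.
by apply: ij; rewrite ?inE // rf gf.
Qed.

Lemma resolventP lam th (a : R) f g : omega < lam -> C f -> C g ->
  res lam th (a *: f + g) = a *: res lam th f + res lam th g.
Proof.
move=> ol Cf Cg; have [df ef] := resolvent_spec th ol Cf.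
have [dg eg] := resolvent_spec th ol Cg.
have Cfg : C (a *: f + g) by apply: CkappaD => //; exact: CkappaZ.
apply: resolvent_unique => //; first exact: (@Defs.domP _ _ _ (A th) a _ _ df dg).
rewrite (@Defs.appP _ _ _ (A th) a _ _ df dg) -[in RHS]ef -[in RHS]eg scalerDr scalerBr opprD.
by rewrite !scalerA (mulrC a) addrACA.
Qed.

Lemma resolvent0 lam th : omega < lam -> res lam th (0 : E -> R) = 0.
Proof.
move=> ol; have C0 := Ckappa0 hkappa.
have := resolventP th (-1) ol C0 C0.
by rewrite scaler0 addr0 scaleN1r addNr.
Qed.

Lemma resolventD lam th f g : omega < lam -> C f -> C g ->
  res lam th (f + g) = res lam th f + res lam th g.
Proof.
by move=> ol Cf Cg; have := resolventP th 1 ol Cf Cg; rewrite !scale1r.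
Qed.

Lemma resolventZ lam th (a : R) f : omega < lam -> C f ->
  res lam th (a *: f) = a *: res lam th f.
Proof.
move=> ol Cf; have := resolventP th a ol Cf (Ckappa0 hkappa).
by rewrite resolvent0 // !addr0.
Qed.

Lemma resolventB lam th f g : omega < lam -> C f -> C g ->
  res lam th (f - g) = res lam th f - res lam th g.
Proof.
move=> ol Cf Cg; rewrite resolventD //; last exact: CkappaN.
by congr (_ + _); have := resolventZ th (-1) ol Cg; rewrite !scaleN1r.
Qed.

Lemma resolvent_app lam th g : omega < lam -> dom (A th) g ->
  res lam th (A th g) = lam *: res lam th g - g.
Proof.
move=> ol dg; have Cg := dom_Ckappa dg; have CA := app_Ckappa dg.
have Clg := CkappaZ hkappa lam Cg.
have : res lam th (lam *: g - A th g) = g.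
  by apply: resolvent_unique => //; exact: CkappaB.
rewrite resolventB // resolventZ // => /eqP; rewrite subr_eq => /eqP ->.
by rewrite [g + _]addrC addrK.
Qed.

Lemma resolvent_mono lam th f g : omega < lam -> C f -> C g -> fle f g ->
  fle (res lam th f) (res lam th g).
Proof. by move=> ol; have [_ _ mono] := hi.2 lam th ol; exact: mono. Qed.

Lemma resolvent_weighted (p : E -> R) lam th (c : R) f : omega < lam ->
  (forall x, 0 < p x) ->
  (wnorm p ((lam - omega) *: res lam th f) <= wnorm p f)%E ->
  (forall x, `|f x| <= c / p x) ->
  forall x, `|res lam th f x| <= h lam * c / p x.
Proof.
move=> ol p0 wle /(wnorm_leP _ _ p0)/(le_trans wle)/(wnorm_leP _ _ p0) H x.
have := H x; rewrite -[((lam - omega) *: _) x]/((lam - omega) * res lam th f x).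
have l0 : 0 < lam - omega by rewrite subr_gt0.
rewrite normrM (gtr0_norm l0) => Hx.
by rewrite -mulrA /h mulrC ler_pdivlMr // mulrC.
Qed.

Lemma resolvent_kle lam th (c : R) f : omega < lam -> C f -> kle c f ->
  kle (h lam * c) (res lam th f).
Proof.
move=> ol Cf hc; apply: resolvent_weighted => //; first exact: kappa_gt0.
by have [_ H _] := hi.2 lam th ol; exact: H.
Qed.

Lemma lipbr_cst (c : R) : 0 <= c -> lipbr c (cst c : E -> R).
Proof.
move=> c0; split=> [x y|x]; first by rewrite subrr normr0 mulr_ge0 // enorm_ge0.
by rewrite ger0_norm.
Qed.

Lemma resolvent_cst lam th (c : R) x : omega < lam -> 0 <= c ->
  res lam th (cst c) x <= h lam * c.
Proof.
move=> ol c0; have [H _ _] := hi.2 lam th ol.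
have l0 : 0 < lam - omega by rewrite subr_gt0.
have := H _ (lipbr_Lipb (lipbr_cst c0)) => H1.
have H2 : (inftynorm (cst c : E -> R) <= c%:E)%E.
  by apply: supnorm_le => // y _; rewrite ger0_norm.
have := supnorm_leP (le_trans H1 H2) (I : [set: E] x).
rewrite -[((lam - omega) *: _) x]/((lam - omega) * res lam th (cst c) x).
rewrite normrM (gtr0_norm l0) => Hx.
rewrite (le_trans (ler_norm _)) // /h mulrC ler_pdivlMr // mulrC.
exact: Hx.
Qed.

(** The absolute value makes this operator monotone for every [lam]; it is
    [sup_resolvent] when [0 <= lam]. *)
Definition upper_resolvent (lam : R) f : E -> R :=
  psup (fun th => `|lam| *: res lam th f).
Local Notation Q := upper_resolvent.

Lemma scaled_resolvent_kle lam th (c : R) f : omega < lam -> C f -> kle c f ->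
  kle (expR (w * h lam) * c) (`|lam| *: res lam th f).
Proof.
move=> ol Cf hc x; have c0 := kle_ge0 hkappa hc.
have := kleZ `|lam| (resolvent_kle th ol Cf hc) x => /le_trans; apply.
rewrite normr_id mulrA ler_pM2r ?kappaV_gt0 // ler_wpM2r //.
exact: lam_step_le.
Qed.

Lemma scaled_resolvent_bounded lam f x : omega < lam -> C f ->
  exists b, forall th, (`|lam| *: res lam th f) x <= b.
Proof.
move=> ol Cf; have [_ [c hc]] := (CkappaP hkappa f).1 Cf.
exists (expR (w * h lam) * c / kappa x) => th.
exact: le_trans (ler_norm _) (scaled_resolvent_kle th ol Cf hc x).
Qed.

Lemma upper_ge lam f x th : omega < lam -> C f -> `|lam| * res lam th f x <= Q lam f x.
Proof.
move=> ol Cf; have [b hb] := scaled_resolvent_bounded x ol Cf.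
exact: (psup_ge th hb).
Qed.

Lemma upper_le lam f x (b : R) : (forall th, `|lam| * res lam th f x <= b) ->
  Q lam f x <= b.
Proof. by move=> H; apply: psup_le. Qed.

Lemma upper_kle lam (c : R) f : omega < lam -> C f -> kle c f ->
  kle (expR (w * h lam) * c) (Q lam f).
Proof.
move=> ol Cf hc x; apply: psup_norm => // th; exact: scaled_resolvent_kle.
Qed.

Lemma upper_mono lam f g : omega < lam -> C f -> C g -> fle f g ->
  fle (Q lam f) (Q lam g).
Proof.
move=> ol Cf Cg fg x; apply: upper_le => th; apply: le_trans (upper_ge x th ol Cg).
by rewrite ler_wpM2l // resolvent_mono.
Qed.

Lemma upper_subadd lam f g : omega < lam -> C f -> C g ->
  fle (Q lam (f + g)) (Q lam f + Q lam g).
Proof.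
move=> ol Cf Cg x; apply: upper_le => th.
by rewrite resolventD // mulrDr lerD // upper_ge.
Qed.

Lemma upper_hom lam (a : R) f : omega < lam -> C f -> 0 <= a ->
  Q lam (a *: f) = a *: Q lam f.
Proof.
move=> ol Cf; rewrite le_eqVlt => /predU1P[<-|a0]; apply: funext => x.
  rewrite !scale0r; apply: le_anti; apply/andP; split.
    by apply: upper_le => th; rewrite resolvent0 // mulr0.
  have [th] := hTheta; have := upper_ge x th ol (Ckappa0 hkappa).
  by rewrite resolvent0 // mulr0.
have Ca := CkappaZ hkappa a Cf.
apply: le_anti; rewrite -[(a *: _) x]/(a * Q lam f x); apply/andP; split.
  apply: upper_le => th; rewrite resolventZ // -[(a *: _) x]/(a * res lam th f x).
  by rewrite mulrCA ler_pM2l // upper_ge.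
rewrite mulrC -ler_pdivlMr //; apply: upper_le => th; rewrite ler_pdivlMr //.
have := upper_ge x th ol Ca; rewrite resolventZ // -[(a *: _) x]/(a * res lam th f x).
by rewrite mulrCA mulrC.
Qed.

Lemma upper_cst lam (c : R) x : omega < lam -> 0 <= c ->
  Q lam (cst c) x <= expR (w * h lam) * c.
Proof.
move=> ol c0; apply: upper_le => th.
apply: le_trans (ler_wpM2l (normr_ge0 _) (resolvent_cst th x ol c0)) _.
by rewrite mulrA ler_wpM2r // lam_step_le.
Qed.

Variable L : R.
Hypothesis L0 : 0 <= L.
Hypothesis htrans : forall (r : R) f (x : E) (lam : R) th,
  0 <= r -> Lipbr r f -> omega < lam ->
  (((lam - omega) ^+ 2)%:E *
     inftynorm (translate x (resolvent (A th) lam f)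
                - resolvent (A th) lam (translate x f))%R
   <= (L * r * enorm x)%:E)%E.

Lemma resolvent_translate lam th (r : R) f x y : omega < lam -> lipbr r f ->
  `|lam| * `|res lam th f (x + y) - res lam th (translate x f) y|
  <= expR (w * h lam) * L * r * enorm x * h lam.
Proof.
move=> ol lf; have r0 := lipbr_ge0 lf.
have l0 : 0 < lam - omega by rewrite subr_gt0.
have l2 : 0 < (lam - omega) ^+ 2 by rewrite exprn_gt0.
have lfr : Lipbr r f.
  by split; [exact: lf.1|apply: supnorm_le => // z _; exact: lf.2].
have H := htrans x th r0 lfr ol.
set D := (translate x _ - _)%R in H.
have H1 : (inftynorm D <= (h lam ^+ 2 * (L * r * enorm x))%:E)%E.
  rewrite EFinM -lee_pdivrMl; last first.
    by rewrite exprn_gt0 // step_size_gt0.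
  by rewrite /h exprVn invrK.
have := supnorm_leP H1 (I : [set: E] y).
rewrite -[D y]/(res lam th f (x + y) - res lam th (translate x f) y) => H2.
apply: le_trans (ler_wpM2l (normr_ge0 lam) H2) _.
have -> : `|lam| * (h lam ^+ 2 * (L * r * enorm x)) =
  (`|lam| * h lam) * (L * r * enorm x * h lam) by ring.
have -> : expR (w * h lam) * L * r * enorm x * h lam =
  expR (w * h lam) * (L * r * enorm x * h lam) by ring.
rewrite ler_wpM2r ?lam_step_le // !mulr_ge0 ?enorm_ge0 //.
exact: ltW (step_size_gt0 ol).
Qed.

Lemma upper_translate lam (r : R) f x y : omega < lam -> lipbr r f ->
  `|Q lam f (x + y) - Q lam (translate x f) y|
  <= expR (w * h lam) * L * r * enorm x * h lam.
Proof.
move=> ol lf; have Cf := lipbr_Ckappa hkappa lf.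
have Ct := lipbr_Ckappa hkappa (translate_lipbr x lf).
have [b hb] := scaled_resolvent_bounded (x + y) ol Cf.
have [b' hb'] := scaled_resolvent_bounded y ol Ct.
apply: (psup_dist hTheta hb hb') => th.
rewrite -[(_ *: _) (x + y)]/(`|lam| * res lam th f (x + y)).
rewrite -[(_ *: _) y]/(`|lam| * res lam th (translate x f) y).
by rewrite -mulrBr normrM normr_id resolvent_translate.
Qed.

(** Iterates are only controlled as long as they are known to stay in the
    space; continuity of one step is itself deduced from the tightness of one
    step. *)
Definition stable lam k : Prop :=
  forall j f, (j < k)%N -> C f -> C (iter j (Q lam) f).

Lemma iter_upper_mono lam k f g : omega < lam -> stable lam k -> C f -> C g ->
  fle f g -> fle (iter k (Q lam) f) (iter k (Q lam) g).
Proof.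
move=> ol + Cf Cg fg; elim: k => // k IH st.
apply: upper_mono => //; [exact: st|exact: st|].
by apply: IH => j u jk; apply: st; exact: ltnW.
Qed.

Lemma iter_upper_hom lam k (a : R) f : omega < lam -> stable lam k -> C f -> 0 <= a ->
  iter k (Q lam) (a *: f) = a *: iter k (Q lam) f.
Proof.
move=> ol + Cf a0; elim: k => // k IH st /=.
rewrite IH; last by move=> j u jk; apply: st; exact: ltnW.
by apply: upper_hom => //; exact: st.
Qed.

Definition tight_steps : Prop := forall (T c e : R) K, compact K -> 0 < e ->
  exists2 K', compact K' & forall lam k f, omega < lam -> stable lam k ->
    k%:R * h lam <= T -> C f -> kle c f -> (forall x, K' x -> f x <= 0) ->
    forall x, K x -> iter k (Q lam) f x <= e.

(** Bounds with respect to the second weight are preserved along the iteration,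
    and a function below [c / kappa] that is nonpositive on a large compact set
    is small with respect to that weight. *)
Lemma tight_of_ii : cond_ii A omega -> tight_steps.
Proof.
move=> [kt [[ktc ktb kt0] ktk ktA]] T c e K cK e0.
have Q_kt lam (b : R) f : omega < lam -> C f -> (forall x, `|f x| <= b / kt x) ->
    forall x, `|Q lam f x| <= expR (w * h lam) * b / kt x.
  move=> ol Cf fb x; apply: psup_norm => // th.
  have := resolvent_weighted ol kt0 (ktA lam th f ol Cf) fb x => hx.
  rewrite -[(_ *: _) x]/(`|lam| * res lam th f x) normrM normr_id.
  apply: le_trans (ler_wpM2l (normr_ge0 _) hx) _.
  have b0 : 0 <= b / kt x := le_trans (normr_ge0 _) (fb x).
  have -> : `|lam| * (h lam * b / kt x) = `|lam| * h lam * (b / kt x).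
    by rewrite !mulrA.
  by rewrite -[leRHS]mulrA ler_wpM2r // lam_step_le.
have ktVc : continuous (fun x => (kt x)^-1).
  move=> x; apply: (@continuous_comp _ _ _ kt (fun y : R => y^-1)).
    exact: ktc.
  by apply: inv_continuous; rewrite gt_eqF.
have [N N0 hN] := compact_continuous_bounded cK ktVc.
pose m := N + 1; have m0 : 0 < m by rewrite ltr_wpDl.
pose a := expR (w * `|T|); have a0 : 0 < a by exact: expR_gt0.
pose eps := e / (a * (`|c| + 1) * m).
have c1 : 0 < `|c| + 1 by rewrite ltr_wpDl.
have eps0 : 0 < eps by rewrite divr_gt0 // !mulr_gt0.
have [M hM] := ktk eps eps0.
exists (cube 0 `|M|); first exact: cube_compact.
move=> lam k f ol st kT Cf hc f0 x Kx.
have [cf [_ _]] := (CkappaP hkappa f).1 Cf.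
pose fp y := Num.max (f y) 0.
have Cfp : C fp.
  apply/(CkappaP hkappa); split.
    move=> y; apply: (@continuous_max _ _ f (fun=> 0) y); first exact: cf.
    exact: cst_continuous.
  exists c => y; rewrite /fp ger0_norm ?le_max ?lexx ?orbT // ge_max.
  rewrite (le_trans (ler_norm _) (hc y)) /=.
  exact: le_trans (normr_ge0 _) (hc y).
have ffp : fle f fp by move=> y; rewrite /fp le_max lexx.
have c0 := kle_ge0 hkappa hc.
have fpb y : `|fp y| <= (`|c| + 1) * eps / kt y.
  have r0 : 0 <= (`|c| + 1) * eps / kt y.
    apply: divr_ge0; last exact: ltW (kt0 y).
    by apply: mulr_ge0; exact: ltW.
  rewrite /fp ger0_norm ?le_max ?lexx ?orbT // ge_max r0 andbT.
  have [Ky|nKy] := pselect (cube 0 `|M| y); first exact: le_trans (f0 y Ky) r0.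
  have My : M <= enorm y.
    apply: contrapT => /negP; rewrite -ltNge => yM; apply: nKy; apply: cubeP.
    rewrite subr0 (le_trans (norm_le_enorm y)) // (le_trans (ltW yM)) //.
    exact: ler_norm.
  have := hM y My; rewrite ger0_norm; last first.
    by rewrite divr_ge0 // ltW // kappa_gt0.
  rewrite ltr_pdivrMr ?kappa_gt0 // => /ltW hy.
  rewrite (le_trans (ler_norm _)) // (le_trans (hc y)) //.
  rewrite ler_pdivrMr ?kappa_gt0 // mulrAC ler_pdivlMr // -mulrA.
  by rewrite ler_pM ?(ltW (kt0 y)) // (ger0_norm c0) lerDl.
have iterb : forall j, (j <= k)%N -> forall y, `|iter j (Q lam) fp y| <=
    expR (w * (j%:R * h lam)) * ((`|c| + 1) * eps) / kt y.
  elim=> [|j IH] jk y; first by rewrite mul0r mulr0 expR0 mul1r.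
  rewrite expR_step; apply: Q_kt => //; first exact: st.
  by apply: IH; exact: ltnW.
apply: le_trans (iter_upper_mono ol st Cf Cfp ffp x) _.
apply: le_trans (ler_norm _) _; apply: le_trans (iterb k (leqnn k) x) _.
have km : (kt x)^-1 <= m.
  by rewrite (le_trans (ler_norm _)) // (le_trans (hN x Kx)) // lerDl.
have ek : expR (w * (k%:R * h lam)) <= a.
  by rewrite ler_expR ler_wpM2l // (le_trans kT) // ler_norm.
apply: (@le_trans _ _ (a * ((`|c| + 1) * eps) * m)).
  have ce0 : 0 <= (`|c| + 1) * eps by rewrite mulr_ge0 // ltW.
  apply: ler_pM => //; first by rewrite mulr_ge0 // expR_ge0.
    by rewrite invr_ge0 ltW.
  by rewrite ler_wpM2r.
have -> : a * ((`|c| + 1) * eps) * m = eps * (a * (`|c| + 1) * m) by ring.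
by rewrite /eps divfK // gt_eqF // !mulr_gt0.
Qed.

(** The function [g] vanishes at [x] and dominates half of [c / kappa] off
    [Kt]. As [A th g] is small, [g] is almost a supersolution, so that its
    iterates remain small at [x]. *)
Lemma tight_of_ii' : cond_ii' A -> tight_steps.
Proof.
move=> hii T c e K cK e0.
have [m m0 hm] := kappaV_bounded hkappa cK.
pose r := `|c| + 1; have r0 : 0 <= r by rewrite addr_ge0.
pose a := expR (w * `|T|); have a0 : 0 < a by exact: expR_gt0.
pose B := 2 * (`|T| * a) * m + 1.
have B0 : 0 < B by rewrite ltr_wpDl // !mulr_ge0 // ltW.
pose eps := Num.min 2^-1 (e / B).
have eps0 : 0 < eps by rewrite /eps lt_min invr_gt0 ltr0n divr_gt0.
have [zeta [Kt [cKt hz]]] := hii eps r K eps0 r0 cK.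
exists Kt => // lam k f ol st kT Cf hc f0 x Kx.
have [zc [z01 zx] zK dg Ag] := hz x Kx.
set g : E -> R := fun y => r / kappa y * (1 - zeta x y) in dg Ag.
have [th0] := hTheta.
have Cg : C g := dom_Ckappa (dg th0).
have h0 := step_size_gt0 ol.
have g0 y : 0 <= g y.
  rewrite mulr_ge0 ?divr_ge0 ?subr_ge0 //; first exact/ltW/kappa_gt0.
  by case/andP: (z01 y).
have fg : fle f (2 *: g).
  move=> y; rewrite -[(2 *: g) y]/(2 * g y).
  have [Ky|nKy] := pselect (Kt y).
    by rewrite (le_trans (f0 y Ky)) // mulr_ge0.
  have zy : zeta x y <= 2^-1.
    have : (((zeta x y)%:E : \bar R) <= eps%:E)%E.
      by apply: le_trans zK; apply: ereal_sup_ubound; exists y.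
    by rewrite lee_fin => /le_trans; apply; rewrite /eps ge_min lexx.
  have ck : c / kappa y <= r / kappa y.
    rewrite ler_pM2r ?kappaV_gt0 // /r (le_trans (ler_norm c)) // lerDl.
    exact: ler01.
  have rk0 : 0 <= r / kappa y by rewrite divr_ge0 // ltW // kappa_gt0.
  have := le_trans (ler_norm _) (hc y) => fy.
  have : r / kappa y * 2^-1 <= g y by rewrite ler_wpM2l //; lra.
  lra.
have kAg th : kle eps (A th g).
  apply/(wnorm_kleP hkappa); apply: le_trans Ag.
  by apply: ereal_sup_ubound; exists th.
have stepg y : Q lam g y <= g y + eps * h lam / kappa y.
  apply: upper_le => th.
  have := resolvent_kle th ol (app_Ckappa (dg th)) (kAg th) y.
  rewrite resolvent_app // -[(_ - _) y]/(lam * res lam th g y - g y).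
  rewrite (mulrC (h lam)) => hy.
  have rg0 : 0 <= res lam th g y.
    have := resolvent_mono th ol (Ckappa0 hkappa) Cg g0 y.
    by rewrite resolvent0.
  have := g0 y; move: hy; rewrite ler_norml => /andP[h1 h2] gy.
  have [l0|l0] := leP 0 lam; first by rewrite (ger0_norm l0); lra.
  rewrite (ltr0_norm l0) mulNr.
  lra.
pose b j := eps * (j%:R * h lam) * expR (w * (j%:R * h lam)).
have b0 j : 0 <= b j.
  by rewrite mulr_ge0 ?expR_ge0 // mulr_ge0 ?mulr_ge0 // ltW.
have Ck (s : R) : C (fun y => s / kappa y).
  apply/(CkappaP hkappa); split.
    move=> y; apply: (@cvgM _ _ (nbhs y) _ (fun=> s) (fun y => (kappa y)^-1)).
      exact: cst_continuous.
    exact: kappaV_continuous.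
  exists `|s| => y; by rewrite normrM (gtr0_norm (kappaV_gt0 hkappa y)).
have kk (s : R) : 0 <= s -> kle s (fun y => s / kappa y).
  by move=> s0 y; rewrite ger0_norm // divr_ge0 // ltW // kappa_gt0.
have iterb : forall j, (j <= k)%N -> forall y,
    iter j (Q lam) g y <= g y + b j / kappa y.
  elim=> [|j IH] jk y; first by rewrite /b mul0r mulr0 mul0r mul0r addr0.
  have Cj : C (iter j (Q lam) g) by apply: st.
  have Cu : C (g + fun y => b j / kappa y) by exact: CkappaD.
  have h1 := upper_mono ol Cj Cu (IH (ltnW jk)) y.
  have h2 := upper_subadd ol Cg (Ck (b j)) y.
  have h3 := le_trans (ler_norm _) (upper_kle ol (Ck (b j)) (kk _ (b0 j)) y).
  have h4 := stepg y.
  apply: le_trans h1 (le_trans h2 (le_trans (lerD h4 h3) _)).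
  rewrite -addrA lerD2l -mulrDl ler_pM2r ?kappaV_gt0 // /b -natr1.
  rewrite [(_ + 1) * h lam]mulrDl mul1r [w * (_ + _)]mulrDr expRD.
  set E1 := expR (w * (j%:R * h lam)); set E2 := expR (w * h lam).
  have E11 : 1 <= E1 by rewrite -expR0 ler_expR !mulr_ge0 // ltW.
  have E21 : 1 <= E2 by rewrite -expR0 ler_expR mulr_ge0 // ltW.
  have eh : 0 <= eps * h lam by rewrite mulr_ge0 // ltW.
  have E12 : 1 <= E1 * E2 by rewrite -[1]mulr1 ler_pM.
  have -> : eps * h lam + E2 * (eps * (j%:R * h lam) * E1) =
    eps * (j%:R * h lam) * (E1 * E2) + eps * h lam by ring.
  by rewrite [eps * (_ + _)]mulrDr mulrDl lerD2l ler_peMr.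
have C2g := CkappaZ hkappa 2 Cg.
apply: le_trans (iter_upper_mono ol st Cf C2g fg x) _.
rewrite (iter_upper_hom ol st Cg) // -[(2 *: _) x]/(2 * iter k (Q lam) g x).
have gx : g x = 0 by rewrite /g zx subrr mulr0.
have := iterb k (leqnn k) x; rewrite gx add0r => itx.
have kT' : k%:R * h lam <= `|T| := le_trans kT (ler_norm T).
have kh0 : 0 <= k%:R * h lam by rewrite mulr_ge0 // ltW.
have ek : expR (w * (k%:R * h lam)) <= a by rewrite ler_expR ler_wpM2l.
have bk : b k <= eps * (`|T| * a).
  rewrite /b -mulrA; apply: ler_wpM2l; first exact: ltW.
  by apply: ler_pM => //; exact: expR_ge0.
have bkx : b k / kappa x <= eps * (`|T| * a) * m.
  by apply: ler_pM => //; [rewrite invr_ge0 ltW // kappa_gt0|exact: hm].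
have : eps * B <= e by rewrite -ler_pdivlMr // /eps ge_min lexx orbT.
rewrite /B => eB; have e0' := ltW eps0.
lra.
Qed.

Hypothesis tight : tight_steps.

(** Lipschitz data have uniformly Lipschitz images, and the one-step case of
    tightness transfers this to all data by density. *)
Lemma scaled_resolvent_equicontinuous lam f x (e : R) : omega < lam -> C f ->
  0 < e -> \forall y \near x, forall th,
    `|(`|lam| * res lam th f y) - `|lam| * res lam th f x| <= e.
Proof.
move=> ol Cf e0; have [_ [c hc]] := (CkappaP hkappa f).1 Cf.
have h0 := step_size_gt0 ol.
have [c' hd] := lipschitz_dense hkappa Cf hc.
have [B B0 hB] := kappa_bounded hkappa.
have e6 : 0 < e / 6 by rewrite divr_gt0.
have [K' cK' Ht] := tight (h lam) (c + c' + B) (@cube_compact _ _ x 1) e6.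
pose a := expR (w * h lam); have a0 : 0 < a by exact: expR_gt0.
pose delta := Num.min 1 (e / 6 / a).
have d0 : 0 < delta by rewrite /delta lt_min ltr01 divr_gt0.
have [g [[r lg] gc fg]] := hd K' delta cK' d0.
have Cg := lipbr_Ckappa hkappa lg; have r0 := lipbr_ge0 lg.
have st1 : stable lam 1 by move=> [|j] u.
have half u : C u -> kle (c + c') u -> (forall y, K' y -> u y <= delta) ->
    forall y th, cube x 1 y -> `|lam| * res lam th u y <= e / 6 + e / 6.
  move=> Cu ku ud y th xy.
  have Cd := Ckappa_cst hkappa delta; have Cud := CkappaB hkappa Cu Cd.
  have -> : u = (u - cst delta) + cst delta by rewrite subrK.
  rewrite resolventD // mulrDr lerD //.
    apply: le_trans (upper_ge y th ol Cud) _.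
    apply: (Ht lam 1%N) => //; first by rewrite mul1r.
      apply: kleB => // z; have -> : cst delta z = delta by [].
      rewrite (gtr0_norm d0).
      rewrite ler_pdivlMr ?kappa_gt0 // -[leRHS]mul1r.
      apply: ler_pM => //; [exact: ltW|exact/ltW/kappa_gt0|].
      by rewrite /delta ge_min lexx.
    by move=> z K'z; rewrite !fctE subr_le0 ud.
  apply: le_trans (ler_wpM2l (normr_ge0 _) (resolvent_cst th y ol (ltW d0))) _.
  rewrite mulrA; apply: (@le_trans _ _ (a * delta)).
    by rewrite ler_wpM2r ?lam_step_le // ltW.
  by rewrite mulrC -ler_pdivlMr // /delta ge_min lexx orbT.
have near_g y th : cube x 1 y ->
    `|(`|lam| * res lam th f y) - `|lam| * res lam th g y| <= e / 3.
  move=> xy; have Cd := CkappaB hkappa Cf Cg; have Cd' := CkappaB hkappa Cg Cf.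
  have e3 : e / 3 = e / 6 + e / 6 by lra.
  rewrite e3 ler_norml -mulrBr; apply/andP; split.
    rewrite lerNl -mulrN opprB.
    have := half _ Cd' _ _ y th xy; rewrite resolventB //; apply.
      by rewrite addrC; exact: kleB.
    by move=> z K'z; have := fg z K'z; rewrite distrC; apply: le_trans; rewrite ler_norm.
  have := half _ Cd _ _ y th xy; rewrite resolventB //; apply; first exact: kleB.
  by move=> z K'z; apply: le_trans (fg z K'z); rewrite ler_norm.
pose Lam := a * L * r * h lam + `|lam| * (h lam * r).
have Lam0 : 0 <= Lam.
  by rewrite addr_ge0 // !mulr_ge0 // ltW.
have lipg y th : `|(`|lam| * res lam th g y) - `|lam| * res lam th g x|
    <= Lam * enorm (y - x).
  have lt := translate_lipbr (y - x) lg.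
  have Ct := lipbr_Ckappa hkappa lt.
  have h1 := resolvent_translate th (y - x) x ol lg.
  rewrite subrK in h1.
  set q := enorm (y - x) in h1 *; have q0 : 0 <= q := enorm_ge0 _.
  have rq0 : 0 <= r * q by rewrite mulr_ge0.
  have bt z : `|translate (y - x) g z - g z| <= r * q.
    by rewrite /translate (le_trans (lg.1 _ _)) // addrK.
  have key u v : C u -> C v -> (forall z, `|u z - v z| <= r * q) ->
      res lam th u x - res lam th v x <= h lam * (r * q).
    move=> Cu Cv uv; have Cc := Ckappa_cst hkappa (r * q).
    have := resolvent_mono th ol (CkappaB hkappa Cu Cv) Cc
      (fun z => le_trans (ler_norm _) (uv z)) x.
    rewrite resolventB // => /le_trans; apply; exact: resolvent_cst.
  have h2 : `|res lam th (translate (y - x) g) x - res lam th g x| <= h lam * (r * q).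
    rewrite ler_norml (key _ _ Ct Cg bt) andbT lerNl opprB.
    by apply: key => // z; rewrite distrC.
  rewrite -mulrBr normrM normr_id.
  apply: (@le_trans _ _ (`|lam| * (`|res lam th g y - res lam th (translate (y - x) g) x|
    + `|res lam th (translate (y - x) g) x - res lam th g x|))).
    by rewrite ler_wpM2l // ler_distD.
  rewrite mulrDr; apply: le_trans (lerD h1 (ler_wpM2l (normr_ge0 _) h2)) _.
  rewrite /Lam -/a mulrDl lerD //; first by rewrite mulrAC.
  by rewrite !mulrA.
pose M := Lam * d%:R + 1.
have M0 : 0 < M by rewrite ltr_wpDl // mulr_ge0.
have q0 : 0 < Num.min 1 (e / 3 / M) by rewrite lt_min ltr01 !divr_gt0.
have := near_norm x q0; apply: filterS => y; rewrite lt_min => /andP[y1 yM] th.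
have a1 := near_g y th (cubeP (ltW y1)).
have a2 : `|(`|lam| * res lam th f x) - `|lam| * res lam th g x| <= e / 3.
  by apply: near_g; apply: cubeP; rewrite subrr normr0.
have a3 : `|(`|lam| * res lam th g y) - `|lam| * res lam th g x| <= e / 3.
  rewrite (le_trans (lipg y th)) //.
  apply: (@le_trans _ _ (Lam * (d%:R * `|y - x|))).
    by rewrite ler_wpM2l // enorm_le_norm.
  rewrite mulrA; apply: (@le_trans _ _ (M * `|y - x|)).
    by rewrite ler_wpM2r // lerDl.
  by rewrite mulrC -ler_pdivlMr // ltW.
move: a1 a2 a3; rewrite !ler_norml => /andP[? ?] /andP[? ?] /andP[? ?].
apply/andP; split; lra.
Qed.

Lemma upper_Ckappa lam f : omega < lam -> C f -> C (Q lam f).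
Proof.
move=> ol Cf; have [_ [c hc]] := (CkappaP hkappa f).1 Cf.
apply/(CkappaP hkappa); split; last first.
  by exists (expR (w * h lam) * c); exact: upper_kle.
apply/continuousP_dist => x e e0.
have := scaled_resolvent_equicontinuous x ol Cf e0; apply: filterS => y hy.
have [b hb] := scaled_resolvent_bounded y ol Cf.
have [b' hb'] := scaled_resolvent_bounded x ol Cf.
exact: (psup_dist hTheta hb hb').
Qed.

Lemma upper_stable lam k : omega < lam -> stable lam k.
Proof.
move=> ol j f _ Cf; elim: j => //= j IH; exact: upper_Ckappa.
Qed.

Hypothesis hiv : cond_iv A omega.

Lemma resolvent_increment lam th f : omega < lam -> 0 < lam -> dom (A th) f ->
  forall x, `|lam| * res lam th f x - f x = res lam th (A th f) x.
Proof.
move=> ol l0 df x; rewrite (gtr0_norm l0) resolvent_app //.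
Qed.

Lemma app_uniform_kle f : Cb_infty f ->
  exists2 c, 0 <= c & forall th, kle c (A th f).
Proof.
move=> sf; have [h1 _] := hiv.2 f set0 sf (@compact0 _).
set s := ereal_sup _ in h1.
have s_ge th : (wnorm kappa (A th f) <= s)%E.
  by apply: ereal_sup_ubound; exists th.
have [th0] := hTheta.
have s0 : (0 <= s)%E := le_trans (wnorm_ge0 hkappa (A th0 f)) (s_ge th0).
exists (fine s); first exact: fine_ge0.
by move=> th; apply/(wnorm_kleP hkappa); rewrite fineK // ge0_fin_numE.
Qed.

Lemma upper_smooth f : Cb_infty f -> exists2 c, 0 <= c &
  forall lam, omega < lam -> 0 < lam -> kle (c * h lam) (Q lam f - f).
Proof.
move=> sf; have [c c0 hc] := app_uniform_kle sf; exists c => // lam ol l0 x.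
have Cf := Cb_infty_Ckappa hkappa sf.
have df th : dom (A th) f by exact: hiv.1.
have bnd th : `|(`|lam| * res lam th f x) - f x| <= c * h lam / kappa x.
  rewrite resolvent_increment // (mulrC c).
  exact: (resolvent_kle th ol (app_Ckappa (df th)) (hc th) x).
rewrite -[(_ - _) x]/(Q lam f x - f x) ler_distl; apply/andP; split.
  have [th] := hTheta; apply: le_trans (upper_ge x th ol Cf).
  by have := bnd th; rewrite ler_distl => /andP[].
by apply: upper_le => th; have := bnd th; rewrite ler_distl => /andP[].
Qed.

Lemma upper_generator (mu : nat -> R) f K (e : R) : Cb_infty f -> compact K -> 0 < e ->
  (forall n, omega < mu n) -> (forall n, 0 < mu n) -> mu n @[n --> \oo] --> +oo ->
  \forall n \near \oo, forall x, K x ->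
    `|(h (mu n))^-1 * (Q (mu n) f x - f x) - psup (fun th => A th f) x| <= e.
Proof.
move=> sf cK e0 om m0 moo; have [_ hK] := hiv.2 f K sf cK.
have Cf := Cb_infty_Ckappa hkappa sf.
have df th : dom (A th) f by exact: hiv.1.
have [c c0 hc] := app_uniform_kle sf.
have hn := cvg_comp _ _ moo hK.
have := ereal_cvg0P hn e0; apply: filterS => n /= En x Kx.
have ol := om n; have l0 := m0 n; set lam := mu n in En ol l0 *.
have h0 := step_size_gt0 ol.
have bA th : A th f x <= c / kappa x := le_trans (ler_norm _) (hc th x).
have Eth th : `|(lam - omega) * res lam th (A th f) x - A th f x| <= e.
  apply: (@supnorm_leP _ _ K ((lam - omega) *: res lam th (A th f) - A th f)) => //.
  by apply: le_trans En; apply: ereal_sup_ubound; exists th.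
have inc th : (h lam)^-1 * (`|lam| * res lam th f x - f x) =
    (lam - omega) * res lam th (A th f) x.
  by rewrite resolvent_increment // /h invrK.
rewrite ler_distl; apply/andP; split.
  rewrite lerBlDr; apply: psup_le => // th.
  have := Eth th; rewrite ler_distlC => /andP[_]; rewrite -inc => /le_trans; apply.
  apply: lerD => //; apply: ler_wpM2l; first by rewrite invr_ge0 ltW.
  by apply: lerD => //; exact: upper_ge.
rewrite mulrC ler_pdivrMr // lerBlDr; apply: upper_le => th.
rewrite -lerBlDr -ler_pdivrMr // mulrC inc.
have := Eth th; rewrite ler_distl => /andP[_] /le_trans; apply.
by rewrite lerD2r; exact: psup_ge bA.
Qed.

Lemma resolvent_scheme (mu : nat -> R) :
  (forall n, omega < mu n) -> (forall n, 0 < mu n) -> mu n @[n --> \oo] --> +oo ->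
  exists L', scheme kappa (fun n => Q (mu n)) (fun n => h (mu n)) w L'
    (fun f => psup (fun th => A th f)).
Proof.
move=> om m0 moo.
have hc : h (mu n) @[n --> \oo] --> (0 : R).
  apply/cvgrPdist_le => e e0.
  have /cvgryPge/(_ (omega + e^-1)) := moo; apply: filterS => n hn.
  have h0 := step_size_gt0 (om n).
  rewrite sub0r normrN (gtr0_norm h0) /h -[leRHS]invrK lef_pV2.
  - by rewrite lerBrDl.
  - by rewrite posrE subr_gt0.
  - by rewrite posrE invr_gt0.
have [b b0 hb] := right0_bounded hc.
exists (expR (w * b) * L); split=> //.
- by move=> n; exact: step_size_gt0.
- by rewrite mulr_ge0 // expR_ge0.
- by move=> n f Cf; exact: upper_Ckappa.
- by move=> n f g Cf Cg; exact: upper_mono.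
- by move=> n f g Cf Cg; exact: upper_subadd.
- by move=> n a f Cf a0; exact: upper_hom.
- by move=> n c f Cf; exact: upper_kle.
- by move=> n c x c0; exact: upper_cst.
- move=> n r f x y lf; have r0 := lipbr_ge0 lf.
  apply: le_trans (upper_translate x y (om n) lf) _.
  have h0 := step_size_gt0 (om n).
  rewrite ler_pM2r // ler_wpM2r ?enorm_ge0 // ler_wpM2r // ler_wpM2r //.
  by rewrite ler_expR ler_wpM2l.
- move=> T c e K cK e0; have [K' cK' H] := tight T c cK e0.
  exists K' => // n k f kT Cf hcf f0; apply: (H (mu n)) => //.
  exact: upper_stable.
- move=> f sf; have [c c0 H] := upper_smooth sf; exists c => // n.
  exact: H.
- by move=> f K e sf cK e0; exact: upper_generator.
Qed.

Lemma sup_resolvent_pos lam f : 0 <= lam -> sup_resolvent A lam f = Q lam f.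
Proof. by move=> l0; rewrite /sup_resolvent /upper_resolvent ger0_norm. Qed.

(** A negative factor is absorbed into the argument, so that the operator
    preserves the space although it is not monotone. *)
Lemma sup_resolvent_neg lam f : omega < lam -> lam < 0 -> C f ->
  sup_resolvent A lam f = Q lam (- f).
Proof.
move=> ol l0 Cf; rewrite /sup_resolvent /upper_resolvent; congr psup.
apply: funext => th; rewrite (ltr0_norm l0).
have := resolventZ th (-1) ol Cf; rewrite !scaleN1r => ->.
by rewrite scalerN scaleNr opprK.
Qed.

Lemma sup_resolvent_Ckappa lam f : omega < lam -> C f -> C (sup_resolvent A lam f).
Proof.
move=> ol Cf; have [l0|l0] := leP 0 lam.
  by rewrite sup_resolvent_pos //; exact: upper_Ckappa.
by rewrite sup_resolvent_neg //; apply: upper_Ckappa => //; exact: CkappaN.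
Qed.

End Resolvents.

Theorem theorem3p2 (R : realType) (d : nat) (hd : (0 < d)%N)
  (kappa : 'rV[R]_d -> R) (hkappa : weight kappa)
  (Theta : Type) (hTheta : inhabited Theta)
  (A : Theta -> linop kappa) (omega : R)
  (hi : cond_i A omega)
  (hii : cond_ii A omega \/ cond_ii' A)
  (hiii : cond_iii A omega)
  (hiv : cond_iv A omega)
  (lam : nat -> R) (hlam : forall n, omega < lam n)
  (hlamoo : lam n @[n --> \oo] --> +oo) :
  let h := fun n => (lam n - omega)^-1 in
  let I := fun n => sup_resolvent A (lam n) in
  exists S : R -> ('rV[R]_d -> R) -> ('rV[R]_d -> R),
    [/\ convex_monotone_semigroup kappa S,
        forall (f : 'rV[R]_d -> R) (t : R) (k : nat -> nat),
          Ckappa kappa f -> 0 <= t ->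
          (k n)%:R * h n @[n --> \oo] --> t ->
          mixed_cvg kappa (fun n => iter (k n) (I n) f) (S t f),
        Cb_infty `<=` generator_dom kappa S &
        forall f : 'rV[R]_d -> R, Cb_infty f ->
          generator kappa S f = psup (fun theta => A theta f)].
Proof.
move=> h I; have [L [L0 htrans]] := hiii.
have tight : tight_steps A omega.
  case: hii; first exact: (tight_of_ii hkappa hTheta hi).
  exact: (tight_of_ii' hkappa hTheta hi).
(* Finitely many [lam n] may fail to be positive. Replacing them changes neither
   the limit nor, by [sup_resolvent_Ckappa], membership in the space. *)
pose mu n := if 0 < lam n then lam n else `|omega| + 1.
have m0 n : 0 < mu n.
  by rewrite /mu; case: ifP => // _; rewrite ltr_wpDl.
have om n : omega < mu n.
  rewrite /mu; case: ifP => // _.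
  by rewrite (le_lt_trans (ler_norm omega)) // ltrDl.
have mulam : \forall n \near \oo, mu n = lam n.
  have /cvgryPgt/(_ 0) := hlamoo; apply: filterS => n; rewrite /mu => ->.
  by [].
have moo : mu n @[n --> \oo] --> +oo.
  apply: cvg_trans hlamoo; apply: near_eq_cvg.
  by apply: filterS mulam => n ->.
have [L' sc] := resolvent_scheme hkappa hTheta hi L0 htrans tight hiv om m0 moo.
have [S [Ssg Slim Sgen]] := scheme_convergence hkappa sc.
exists S; split=> //.
- move=> f t k Cf t0 kt.
  have kt' : (k n)%:R * step_size omega (mu n) @[n --> \oo] --> t.
    apply: cvg_trans kt; apply: near_eq_cvg.
    by apply: filterS mulam => n; rewrite /h /step_size => ->.
  apply: (mixed_cvg_eventually hkappa _ _ (Slim f t k Cf t0 kt')).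
    move=> n; elim: (k n) => //= j IH.
    exact: (sup_resolvent_Ckappa hkappa hTheta hi L0 htrans tight).
  apply: filterS mulam => n mn; rewrite /I -mn.
  have -> : sup_resolvent A (mu n) = upper_resolvent A (mu n); last by [].
  by apply: funext => u; rewrite sup_resolvent_pos // ltW.
- move=> f sf; have Cf := Cb_infty_Ckappa hkappa sf; split; first exact: Cf.
  by exists (psup (fun th => A th f)); exact: Sgen.
- move=> f sf; rewrite /generator; apply: (generator_unique (S := S) (f := f)).
    apply: (@xgetPex _ 0 [set g | generator_graph kappa S f g]).
    by exists (psup (fun th => A th f)); exact: Sgen.
  exact: Sgen.
Qed.
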